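(* Let $0 < p_1, p_2, \theta_1, \theta_2 < \infty$ and $\theta_2 = p_2 \le p_1 \neq \theta_1$. Assume that $v_1, v_2 \in \mathcal{W}(\mathbb{R}^n)$, $\omega_1 \in {}^{\mathbf c}\Omega_{\theta_1}$ and $\omega_2 \in \Omega_{\theta_2}$. Write $\|\mathrm{I}\|$ for $\|\mathrm{I}\|_{{}^{\mathbf c}LM_{p_1\theta_1,\omega_1}(\mathbb{R}^n,v_1)\to LM_{p_2\theta_2,\omega_2}(\mathbb{R}^n,v_2)}$. (i) If $\theta_1 \le p_2$, then $$\|\mathrm{I}\| \approx \sup_{t\in(0,\infty)} \|\omega_1\|_{\theta_1,(0,t)}^{-1}\, \Big\| \|\omega_2\|_{p_2,(|\cdot|,\infty)}\Big\|_{p_1\to p_2,\,v_1^{-1}v_2,\,B(0,t)}.$$ (ii) If $p_2 < \theta_1$, then $$\|\mathrm{I}\| \approx \left(\int_0^\infty \Big\| \|\omega_2\|_{p_2,(|\cdot|,\infty)}\Big\|_{p_1\to p_2,\,v_1^{-1}v_2,\,B(0,t)}^{\theta_1\to p_2}\, d\Big(-\|\omega_1\|_{\theta_1,(0,t)}^{-\theta_1\to p_2}\Big)\right)^{\frac{1}{\theta_1\to p_2}} + \|\omega_1\|_{\theta_1,(0,\infty)}^{-1}\, \Big\| \|\omega_2\|_{p_2,(|\cdot|,\infty)}\Big\|_{p_1\to p_2,\,v_1^{-1}v_2,\,\mathbb{R}^n}.$$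
   Context: Let $n\ge 1$. For measurable $A$ (in $\mathbb{R}^n$ or $\mathbb{R}$), $\mathfrak{M}(A)$ is the set of measurable functions on $A$, $\mathfrak{M}^+(A)$ the non-negative ones, and $\mathcal{W}(A)$ the set of weights: measurable functions that are positive and finite a.e. on $A$. For $p\in(0,\infty]$, $\|f\|_{p,A}=(\int_A|f|^p)^{1/p}$ if $p<\infty$ and $\|f\|_{\infty,A}=\operatorname{ess\,sup}_A|f|$. For a non-negative measurable $w$, $\|f\|_{p,w,A}:=\|fw\|_{p,A}$ (the weight is inside the power). $B(0,t)$ is the open ball of radius $t$ centred at $0$ and ${}^{\mathbf c}B(0,t)=\mathbb{R}^n\setminus B(0,t)$. For $0<p,\theta\le\infty$, $\omega\in\mathfrak{M}^+(0,\infty)$, $v\in\mathcal{W}(\mathbb{R}^n)$: - $LM_{p\theta,\omega}(\mathbb{R}^n,v)$ is the set of $f\in L^{\rm loc}_{p,v}(\mathbb{R}^n)$ (i.e. $\|f\|_{p,v,K}<\infty$ for compact $K$) with $\|f\|_{LM_{p\theta,\omega}(\mathbb{R}^n,v)}:=\big\|\,t\mapsto\|f\|_{p,v,B(0,t)}\big\|_{\theta,\omega,(0,\infty)}<\infty$; - ${}^{\mathbf c}LM_{p\theta,\omega}(\mathbb{R}^n,v)$ is the set of $f\in\bigcap_{t>0}L_{p,v}({}^{\mathbf c}B(0,t))$ (i.e. $\|f\|_{p,v,{}^{\mathbf c}B(0,t)}<\infty$ for all $t>0$) with $\|f\|_{{}^{\mathbf c}LM_{p\theta,\omega}(\mathbb{R}^n,v)}:=\big\|\,t\mapsto\|f\|_{p,v,{}^{\mathbf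 c}B(0,t)}\big\|_{\theta,\omega,(0,\infty)}<\infty$. $\Omega_\theta=\{\omega\in\mathfrak{M}^+(0,\infty):0<\|\omega\|_{\theta,(t,\infty)}<\infty\ \forall t>0\}$ and ${}^{\mathbf c}\Omega_\theta=\{\omega\in\mathfrak{M}^+(0,\infty):0<\|\omega\|_{\theta,(0,t)}<\infty\ \forall t>0\}$. $\|\mathrm{I}\|_{X\to Y}\in[0,\infty]$ is the least constant $c$ with $\|f\|_Y\le c\|f\|_X$ for all $f\in X$ ($\infty$ if there is none). For $0<p,q\le\infty$, the symbol $p\to q$ used as an exponent denotes the number defined by $\frac1{p\to q}=\frac1q-\frac1p$ if $q<p$, and $p\to q=\infty$ if $q\ge p$; the exponent $-\theta_1\to p_2$ means $-(\theta_1\to p_2)$. Integrals $\int_0^\infty F(t)\,d(G(t))$ with $G$ non-decreasing are Lebesgue–Stieltjes integrals over $(0,\infty)$. $A\approx B$ means $\lambda^{-1}B\le A\le\lambda B$ with $\lambda\ge1$ depending only on inessential parameters, i.e. on $n$ and the exponents $p_i,\theta_i$, but not on the weights (in particular one side is infinite iff the other is). Conventions: $0/0=0$, $0\cdot(\pm\infty)=0$, $1/(\pm\infty)=0$. *)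

(* Defs.v *)
From HB Require Import structures.
From mathcomp Require Import all_boot all_order all_algebra.
From mathcomp Require Import all_classical all_reals all_analysis.
From mathcomp Require Import measurable_realfun ess_sup_inf.

Set Implicit Arguments.
Unset Strict Implicit.
Unset Printing Implicit Defensive.

Import Order.TTheory GRing.Theory Num.Theory.
Import numFieldNormedType.Exports.

Local Open Scope classical_set_scope.
Local Open Scope ring_scope.

(* Lebesgue measure on R^n.  The dimension is written n.+1, so that n ranges
   over the dimensions >= 1.  As the library does for
   [completed_lebesgue_measure] on the line, the measure is the Caratheodory
   measure of the Lebesgue outer measure, i.e. of the infimum of the total
   volumes of the countable covers by boxes; "measurable" therefore means
   Lebesgue measurable. *)
Section lebesgue_Rn.
Context (R : realType) (n : nat).
Implicit Types (b : 'rV[R]_n.+1 * 'rV[R]_n.+1) (A : set 'rV[R]_n.+1).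

Definition box b : set 'rV[R]_n.+1 :=
  [set x | forall i, b.1 0 i < x 0 i <= b.2 0 i].

Definition box_volume b : R := \prod_i (b.2 0 i - b.1 0 i).

Definition box_cover A : set (nat -> 'rV[R]_n.+1 * 'rV[R]_n.+1) :=
  [set b : nat -> 'rV[R]_n.+1 * 'rV[R]_n.+1 | (forall k i, (b k).1 0 i <= (b k).2 0 i) /\
           A `<=` \bigcup_k box (b k)].

Definition lebesgue_outer A : \bar R :=
  ereal_inf [set (\sum_(k <oo) (box_volume (b k))%:E)%E | b in box_cover A].

Lemma box_volume_ge0 b : (forall i, b.1 0 i <= b.2 0 i) -> 0 <= box_volume b.
Proof. by move=> b12; apply: prodr_ge0 => i _; rewrite subr_ge0. Qed.

Lemma lebesgue_outer_ge0 A : (0 <= lebesgue_outer A)%E.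
Proof.
apply: le_ereal_inf_tmp => _ [b [b12 _] <-].
by apply: nneseries_ge0 => k _ _; rewrite lee_fin box_volume_ge0.
Qed.

Lemma lebesgue_outer0 : lebesgue_outer set0 = 0%E.
Proof.
apply/eqP; rewrite eq_le lebesgue_outer_ge0 andbT.
apply: ereal_inf_lbound => /=; exists (fun=> (0, 0)); first by split.
rewrite /box_volume; under eq_eseriesr do rewrite big_ord_recl /= subrr mul0r.
exact: eseries0.
Qed.

Lemma lebesgue_outer_sigma_subadditive A F :
  subset_sigma_subadditive lebesgue_outer A F.
Proof.
move=> AF.
have [[i ioo]|] := pselect (exists i, lebesgue_outer (F i) = +oo%E).
  rewrite (eseries_pinfty _ _ ioo) ?leey// => k _.
  by rewrite -ltNye (lt_le_trans _ (lebesgue_outer_ge0 _)).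
rewrite -forallNE => Foo.
suff add2e (e : {posnum R}) : (lebesgue_outer A <=
    \sum_(i <oo) lebesgue_outer (F i) + e%:num%:E)%E.
  by apply/lee_addgt0Pr => _/posnumP[].
rewrite (le_trans _ (epsilon_trick _ _ _))//; last first.
  by move=> k; exact: lebesgue_outer_ge0.
pose P k (b : nat -> 'rV[R]_n.+1 * 'rV[R]_n.+1) := box_cover (F k) b /\
  (\sum_(j <oo) (box_volume (b j))%:E <=
     lebesgue_outer (F k) + (e%:num / (2 ^ k.+1)%:R)%:E)%E.
have [G PG] : {G & forall k, P k (G k)}.
  apply: (@choice _ _ P) => k; rewrite /P.
  have en1 : (0 < e%:num / (2 ^ k.+1)%:R :> R) by [].
  have fF : lebesgue_outer (F k) \is a fin_num.
    by rewrite ge0_fin_numE ?lebesgue_outer_ge0// ltey; apply/eqP.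
  have [_ [b Fb <-] bS] := lb_ereal_inf_adherent en1 fF.
  by exists b; split => //; exact/ltW.
pose v x := (box_volume (uncurry G x))%:E.
have v_ge0 x : (0 <= v x)%E.
  by case: x => i j; rewrite lee_fin box_volume_ge0// => l; exact: (PG i).1.1.
apply: (@le_trans _ _ (\esum_(i in setT) v i)%E).
  apply: ereal_inf_lbound => /=.
  have /card_esym/ppcard_eqP[f] := card_nat2.
  exists (uncurry G \o f).
    split => [k i|t /AF [i _ /(PG i).1.2 [j _ Bijt]]].
      by rewrite /=; case: (f k) => ? ? /=; exact: (PG _).1.1.
    by exists (f^-1%FUN (i, j)) => //=; rewrite invK ?inE.
  rewrite -(esum_pred_image v _ xpredT) ?[fun=> _]set_true//.
  by rewrite image_eq.
rewrite (_ : esum _ _ = \sum_(i <oo) \sum_(j <oo) v (i, j))%E; last first.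
  pose J : nat -> set (nat * nat) := fun i => [set (i, j) | j in setT].
  rewrite (_ : setT = \bigcup_k J k); last first.
    by rewrite predeqE => -[a b]; split => // _; exists a => //; exists b.
  rewrite esum_bigcupT //=; last first.
    apply/trivIsetP => i j _ _ ij.
    rewrite predeqE => -[k m] /=; split => //= -[] [_] _ [<-{k} _].
    by move=> [m' _] [] /esym/eqP; rewrite (negbTE ij).
  rewrite -(image_id [set: nat]) -fun_true esum_pred_image//; last first.
    by move=> k _; exact: esum_ge0.
  apply: eq_eseriesr => /= j _.
  rewrite -(esum_pred_image v (pair j) predT)//=; last first.
    by move=> ? ? _ _; exact: (@can_inj _ _ _ snd).
  by congr esum; rewrite predeqE => -[a b]; split; move=> [i _ <-]; exists i.
apply: lee_nneseries => [i _ _|i _]; last exact: (PG i).2.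
by apply: nneseries_ge0 => j _ _; exact: v_ge0.
Qed.

HB.instance Definition _ := isSubsetOuterMeasure.Build R _ lebesgue_outer
  lebesgue_outer0 lebesgue_outer_ge0 lebesgue_outer_sigma_subadditive.

Definition Rn : Type := caratheodory_type lebesgue_outer.
HB.instance Definition _ := Measurable.on Rn.

Definition lebesgue_Rn : set Rn -> \bar R := lebesgue_outer.
HB.instance Definition _ := isMeasure.Build _ _ _ lebesgue_Rn
  (@caratheodory_measure0 R _ lebesgue_outer)
  (@caratheodory_measure_ge0 R _ lebesgue_outer)
  (@caratheodory_measure_sigma_additive R _ lebesgue_outer).

Definition eucl_norm (x : Rn) : R :=
  Num.sqrt (\sum_i (x : 'rV[R]_n.+1) 0 i ^+ 2).

Definition eball (t : R) : set Rn := [set x | eucl_norm x < t].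

End lebesgue_Rn.
Arguments Rn : clear implicits.
Arguments lebesgue_Rn {R n}.

(* Lebesgue-Stieltjes measure d(G(t)) on ]0, +oo[, for G non-decreasing on
   ]0, +oo[; G may be unbounded below near 0.  The library's
   [lebesgue_stieltjes_measure] handles right-continuous non-decreasing
   functions on the whole line, so it is applied to s |-> G(e^s +), the right
   limit (an infimum, by monotonicity) of G at e^s, and carried to ]0, +oo[ by
   the increasing bijection exp.  See [stieltjes_itvoc]. *)
Section stieltjes.
Context (R : realType) (G : R -> R).
Hypothesis ndG : {in `]0, +oo[ &, {homo G : x y / x <= y}}.

Definition right_lim (t : R) : R := inf [set G u | u in `]t, +oo[].

Definition stieltjes_cdf (_ : {in `]0, +oo[ &, {homo G : x y / x <= y}}) :=
  fun s : R => right_lim (expR s).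

Local Notation cdf := (stieltjes_cdf ndG).

Let has_inf_right s : has_inf [set G u | u in `]expR s, +oo[].
Proof.
split; first by exists (G (expR s + 1)), (expR s + 1); rewrite //= in_itv/= andbT ltrDl.
exists (G (expR s)) => _ [u /= + <-]; rewrite in_itv/= andbT => su.
by apply: ndG; rewrite ?in_itv/= ?andbT ?expR_gt0 ?(lt_trans _ su) ?expR_gt0 ?ltW.
Qed.

Lemma stieltjes_cdf_nd : nondecreasing cdf.
Proof.
move=> x y xy; apply: lb_le_inf; first exact: (has_inf_right y).1.
move=> _ [u /= + <-]; rewrite in_itv/= andbT => yu.
apply: ge_inf; first exact: (has_inf_right x).2.
by exists u; rewrite //= in_itv/= andbT (le_lt_trans _ yu)// ler_expR.
Qed.

Lemma stieltjes_cdf_rc : right_continuous cdf.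
Proof.
move=> x; apply/cvgrPdist_le => /= e e0.
have [_ [u /= + <-]] := inf_adherent e0 (has_inf_right x).
rewrite in_itv/= andbT => xu Gu.
have u0 : 0 < u by rewrite (lt_trans _ xu)// expR_gt0.
near=> y.
have xy : x <= y by near: y; exact: nbhs_right_ge.
have yu : expR y < u.
  rewrite -(lnK u0) ltr_expR; near: y; apply: nbhs_right_lt.
  by rewrite -(expRK x) ltr_ln ?posrE ?expR_gt0.
rewrite distrC ger0_norm ?subr_ge0 ?stieltjes_cdf_nd// lerBlDl.
apply: le_trans (ltW Gu); apply: ge_inf; first exact: (has_inf_right y).2.
by exists u; rewrite //= in_itv/= andbT.
Unshelve. all: by end_near. Qed.

HB.instance Definition _ :=
  isCumulative.Build R _ R cdf stieltjes_cdf_nd stieltjes_cdf_rc.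

Definition stieltjes_measure : set R -> \bar R :=
  pushforward (lebesgue_stieltjes_measure cdf) (@expR R).

Let stieltjes0 : stieltjes_measure set0 = 0%E.
Proof. by rewrite /stieltjes_measure /pushforward preimage_set0 measure0. Qed.

Let stieltjes_ge0 A : (0 <= stieltjes_measure A)%E.
Proof. exact: measure_ge0. Qed.

Let stieltjes_sigma_additive : semi_sigma_additive stieltjes_measure.
Proof.
move=> F mF tF mUF; rewrite /stieltjes_measure /pushforward preimage_bigcup.
have mexp A : measurable A -> measurable (@expR R @^-1` A).
  by move=> mA; rewrite -[X in measurable X]setTI; exact: measurable_expR.
apply: measure_semi_sigma_additive.
- by move=> n; exact: mexp.
- apply/trivIsetP => /= i j _ _ ij; rewrite -preimage_setI.
  by move/trivIsetP : tF => /(_ _ _ _ _ ij) ->//; rewrite preimage_set0.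
- by rewrite -preimage_bigcup; exact: mexp.
Qed.

HB.instance Definition _ := isMeasure.Build _ _ _ stieltjes_measure
  stieltjes0 stieltjes_ge0 stieltjes_sigma_additive.

Lemma stieltjes_itvoc (a b : R) : 0 < a -> a <= b ->
  stieltjes_measure `]a, b] = (right_lim b - right_lim a)%:E.
Proof.
move=> a0 ab; have b0 := lt_le_trans a0 ab.
rewrite /stieltjes_measure /pushforward.
have -> : @expR R @^-1` `]a, b] = `]ln a, ln b]%classic.
  apply/seteqP; split => s /=; rewrite !in_itv/=.
    by rewrite -{1}(lnK a0) -{1}(lnK b0) ltr_expR ler_expR.
  by rewrite -{2}(lnK a0) -{2}(lnK b0) ltr_expR ler_expR.
rewrite /lebesgue_stieltjes_measure /measure_extension/= measurable_mu_extE/=; last first.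
  exact: is_ocitv.
have [->|ab'] := eqVneq a b.
  by rewrite set_itvoc0 ?wlength0 ?subrr// ?lexx.
rewrite wlength_itv/= lte_fin ltr_ln ?posrE// lt_neqAle ab' ab/=.
by rewrite -EFinB /stieltjes_cdf !lnK.
Qed.

End stieltjes.

Local Open Scope ereal_scope.

(* (Quasi-)norms over a set.  Functions take extended real values; the library
   computes 0 * (+oo) = 0 and (+oo)^-1 = 0. *)
Section norms.
Context d (T : measurableType d) (R : realType).
Variable mu : {measure set T -> \bar R}.

Definition norm_on (p : \bar R) (A : set T) (f : T -> \bar R) : \bar R :=
  'N[mu]_p[f \_ A].

Definition wnorm_on (p : \bar R) (w : T -> \bar R) (A : set T)
    (f : T -> \bar R) : \bar R :=
  norm_on p A (f \* w).

Definition nneg_mfun (A : set T) : set (T -> \bar R) :=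
  [set f | measurable_fun A f /\ forall x, A x -> 0 <= f x].

Definition weight (A : set T) : set (T -> \bar R) :=
  [set w | measurable_fun A w /\ {ae mu, forall x, A x -> 0 < w x < +oo}].

Lemma le_norm_on (p : R) (A B : set T) (f : T -> \bar R) : (0 < p)%R ->
  measurable A -> measurable B -> A `<=` B -> measurable_fun B f ->
  norm_on p%:E A f <= norm_on p%:E B f.
Proof.
move=> p0 mA mB AB mf; rewrite /norm_on unlock.
have mp (C : set T) : measurable C -> C `<=` B ->
    measurable_fun setT (fun x => `|(f \_ C) x| `^ p).
  move=> mC CB.
  apply: (measurableT_comp (measurable_poweR p)).
  apply: measurableT_comp => //.
  by apply/(measurable_restrictT _ mC)/(measurable_funS mB CB mf).
apply: gt0_ler_poweR.
- by rewrite invr_ge0 ltW.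
- by rewrite in_itv/= leey andbT integral_ge0// => x _; exact: poweR_ge0.
- by rewrite in_itv/= leey andbT integral_ge0// => x _; exact: poweR_ge0.
apply: ge0_le_integral => //.
- by move=> x _; exact: poweR_ge0.
- exact: mp.
- exact: mp.
move=> x _; apply: gt0_ler_poweR; rewrite ?in_itv/= ?leey ?andbT//.
  exact: ltW.
rewrite !patchE; case: ifPn => [xA|_].
  by rewrite (mem_set (AB _ (set_mem xA))).
by rewrite abse0 abse_ge0.
Qed.

End norms.

(* The real line with the Lebesgue (not merely Borel) measurable sets: the type
   on which [completed_lebesgue_measure] is a measure. *)
Notation Rline R := (caratheodory_type ((wlength (@idfun R))^*)%mu).

Definition half_line (R : realType) : set (Rline R) := `]0%R, +oo[%classic.
Arguments half_line {R}.

Section morrey.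
Context (R : realType) (n : nat).
Local Notation leb1 := (@completed_lebesgue_measure R).
Local Notation lebn := (@lebesgue_Rn R n).
Implicit Types (p theta : \bar R) (omega : Rline R -> \bar R) (v : Rn R n -> \bar R).

Record qspace (T : Type) := QSpace {
  carrier : set (T -> \bar R) ;
  qnorm : (T -> \bar R) -> \bar R }.

(* The operator norm of the identity; ereal_inf set0 = +oo. *)
Definition id_norm T (X Y : qspace T) : \bar R :=
  ereal_inf [set c%:E | c in [set c : R | (0 <= c)%R /\
    forall f, carrier X f -> qnorm Y f <= c%:E * qnorm X f]].

Definition LM_norm p theta omega v (f : Rn R n -> \bar R) : \bar R :=
  wnorm_on leb1 theta omega half_line
    (fun t => wnorm_on lebn p v (@eball R n t) f).

Definition LM p theta omega v : qspace (Rn R n) := QSpace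
  [set f | [/\ measurable_fun setT f,
     forall K : set 'rV[R]_n.+1, compact K -> wnorm_on lebn p v K f < +oo &
     LM_norm p theta omega v f < +oo]]
  (LM_norm p theta omega v).

Definition cLM_norm p theta omega v (f : Rn R n -> \bar R) : \bar R :=
  wnorm_on leb1 theta omega half_line
    (fun t => wnorm_on lebn p v (~` @eball R n t) f).

Definition cLM p theta omega v : qspace (Rn R n) := QSpace
  [set f | [/\ measurable_fun setT f,
     forall t : R, (0 < t)%R -> wnorm_on lebn p v (~` @eball R n t) f < +oo &
     cLM_norm p theta omega v f < +oo]]
  (cLM_norm p theta omega v).

Definition Omega theta : set (Rline R -> \bar R) :=
  [set omega | nneg_mfun half_line omega /\
     forall t : R, (0 < t)%R -> 0 < norm_on leb1 theta `]t, +oo[ omega < +oo].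

Definition cOmega theta : set (Rline R -> \bar R) :=
  [set omega | nneg_mfun half_line omega /\
     forall t : R, (0 < t)%R -> 0 < norm_on leb1 theta `]0%R, t[ omega < +oo].

(* The exponent p -> q, given by 1 / (p -> q) = 1 / q - 1 / p for q < p. *)
Definition exp_to p q : \bar R := if q < p then (q^-1 - p^-1)^-1 else +oo.

Definition omega_tail p omega (x : Rn R n) : \bar R :=
  norm_on leb1 p `]eucl_norm x, +oo[ omega.

(* The non-decreasing function t |-> - ||omega||_{theta,(0,t)} ^ (- (theta -> q)).
   [fine] is harmless: the norms are positive and finite, and the exponent is
   finite when q < theta. *)
Definition neg_pow (theta q : R) omega (t : R) : R :=
  (- fine (norm_on leb1 theta%:E `]0%R, t[ omega)
       `^ (- fine (exp_to theta%:E q%:E)))%R.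

Lemma neg_pow_nd (theta q : R) omega :
  (0 < theta)%R -> (0 < q)%R -> cOmega theta%:E omega ->
  {in `]0%R, +oo[ &, {homo neg_pow theta q omega : s t / (s <= t)%R}}.
Proof.
move=> theta0 q0 [[momega _] homega] s t; rewrite !in_itv/= !andbT => s0 t0 st.
have r0 : (0 <= fine (exp_to theta%:E q%:E))%R.
  rewrite /exp_to; case: ifPn => //; rewrite lte_fin => qtheta.
  have -> : ((q%:E)^-1 - (theta%:E)^-1 = (q^-1 - theta^-1)%:E)%E.
    by rewrite /inve !gt_eqF.
  have d0 : (0 < q^-1 - theta^-1)%R.
    by rewrite subr_gt0 ltf_pV2 ?posrE.
  by rewrite /inve gt_eqF//= invr_ge0 ltW.
have /andP[Ns0 Nsoo] := homega _ s0; have /andP[Nt0 Ntoo] := homega _ t0.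
have le_st : norm_on leb1 theta%:E `]0%R, s[ omega <=
             norm_on leb1 theta%:E `]0%R, t[ omega.
  have mitv (i : interval R) : measurable ([set` i] : set (Rline R)).
    by apply: sub_caratheodory; exact: (@measurable_itv R i).
  apply: le_norm_on => //.
  - by move=> x /=; rewrite !in_itv/= => /andP[-> xs] /=; exact: lt_le_trans st.
  - apply: measurable_funS momega; first exact: mitv.
    by move=> x; rewrite /half_line/= !in_itv/= => /andP[->].
rewrite lerN2 !powRN lef_pV2 ?posrE ?powR_gt0 ?fine_gt0 ?Ns0 ?Nt0//.
apply: ge0_ler_powR => //; rewrite ?nnegrE ?fine_ge0 ?(ltW Ns0) ?(ltW Nt0)//.
by rewrite fine_le// ge0_fin_numE// ltW.
Qed.

Definition equiv_upto (lam : R) (a b : \bar R) : Prop :=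
  (lam^-1)%:E * b <= a /\ a <= lam%:E * b.

End morrey.

(* Main.v *)
(* Write p = p2 = theta2, P = p1, theta = theta1.  By Tonelli, the norm of f in
   the target space is the L^p norm of f v2 W, where W(x) is the L^p norm of
   omega2 over (|x|, oo).  With g = |f v1| and u = W v2 / v1, the embedding with
   constant c becomes the Hardy-type inequality
     (int (g u)^p)^(1/p) <= c (int_0^oo G(t)^theta omega1(t)^theta dt)^(1/theta),
   where G(t) is the L^P norm of g off B(0,t).  Put M(t) = int_0^t omega1^theta,
   s = P -> p, r = theta -> p, N(A) = ||u||_{s,A}, and take radii t_0 > t_1 > ...
   tending to 0 along which M decreases geometrically; M is continuous.

   Sufficiency: Hoelder on each ring B(t_k) \ B(t_{k+1}) bounds the integral of
   (g u)^p by G(t_{k+1})^p N(B(t_k))^p.  The sum of G(t_{k+1})^theta M(t_k) is at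
   most 4 int G^theta omega1^theta, and one concludes with l^theta in l^p if
   theta <= p, and with Hoelder for sums if p < theta; in the latter case the
   sum of M(t_k)^(-r/theta) N(B(t_k))^r is dominated by the Stieltjes integral,
   except for its first term, which needs the term at infinity when M is
   bounded by 2 M(t_0).

   Necessity: on each ring pick g_k of L^P norm at most 1 which nearly attains
   N, and test with g = sum_k a_k g_k, the a_k being those for which Hoelder for
   sums is sharp.  If the ratio of the M(t_k) is large enough, the passages from
   G(t_k) to a_k and from rings to balls lose only constants, because the tails
   can be absorbed in the left-hand side. *)
Require Import Defs.
From HB Require Import structures.
From mathcomp Require Import all_boot all_order all_algebra.
From mathcomp Require Import all_classical all_reals all_analysis.
From mathcomp Require Import measurable_realfun ess_sup_inf.
From mathcomp Require Import ring lra.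
Set Implicit Arguments.
Unset Strict Implicit.
Unset Printing Implicit Defensive.
Import Order.TTheory GRing.Theory Num.Theory.
Import numFieldNormedType.Exports.
Local Open Scope classical_set_scope.
Local Open Scope ring_scope.
Local Open Scope ereal_scope.

(** * Lebesgue measure on R^n *)

(** The absorption arguments cancel or subtract the very sums that they bound, so these must be
    finite beforehand. Hence only finitely many radii are used at a time, with bounds that do not
    depend on their number, and the full integrals are reached by monotone convergence. In the
    necessity part, testing a single ball ([radial_lower]) gives the finiteness of N on balls, and
    it also controls the boundary term left by the cut at K. In the sufficiency part, finiteness of
    N on balls is extracted from the finiteness of the condition.

    The rings ask of the norm with exponent P -> p only monotonicity, Hoelder, near-sharpness of
    Hoelder, a quasi-triangle inequality over disjoint sets and continuity along increasing unions.
    Once these are proved both for P = p, where the exponent is infinite, and for p < P, the two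
    cases need no separate treatment.

    The Hardy-type inequality lives on any sigma-finite space with a measurable radius [rho >= 0]
    whose zero set is null. Of R^n it uses only that the norm is measurable and the origin is
    null. *)

Lemma measurable_half_space (R : realType) (n : nat) (i : 'I_n.+1) (a : R) :
  measurable ([set x : Rn R n | ((x : 'rV[R]_n.+1) 0%R i <= a)%R] : set (Rn R n)).
Proof.
set H := [set _ | _].
apply: le_caratheodory_measurable => X /=.
rewrite [leRHS]/lebesgue_outer; apply: le_ereal_inf_tmp => _ [b [b12 Xb] <-].
(* The hyperplane cuts box k at height [c k], clamped to the edge so that a box on one side leaves a
   degenerate half. The two halves have exactly the volume of the box, which is the Caratheodory
   inequality for covers. *)
pose c k := Num.max ((b k).1 0%R i) (Num.min a ((b k).2 0%R i)).
pose upd (v : 'rV[R]_n.+1) (s : R) : 'rV[R]_n.+1 :=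
  (\row_j (if j == i then s else v 0 j))%R.
pose bL k := ((b k).1, upd (b k).2 (c k)).
pose bR k := (upd (b k).1 (c k), (b k).2).
have cle k : ((b k).1 0 i <= c k <= (b k).2 0 i)%R.
  by rewrite /c le_max lexx/= ge_max b12 ge_min lexx ?orbT.
have bL12 k j : ((bL k).1 0 j <= (bL k).2 0 j)%R.
  by rewrite /= mxE; case: ifPn => [/eqP ->|_]; [case/andP: (cle k)|exact: b12].
have bR12 k j : ((bR k).1 0 j <= (bR k).2 0 j)%R.
  by rewrite /= mxE; case: ifPn => [/eqP ->|_]; [case/andP: (cle k)|exact: b12].
have -> : \sum_(k <oo) (box_volume (b k))%:E =
    \sum_(k <oo) (box_volume (bL k))%:E + \sum_(k <oo) (box_volume (bR k))%:E.
  rewrite -nneseriesD//; last 2 first.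
  - by move=> k _; rewrite lee_fin box_volume_ge0.
  - by move=> k _; rewrite lee_fin box_volume_ge0.
  apply: eq_eseriesr => k _; rewrite -EFinD; congr EFin.
  have volE v w : box_volume (v, w) = ((w 0 i - v 0 i) * \prod_(j | j != i) (w 0 j - v 0 j))%R.
    by rewrite /box_volume (bigD1 i).
  rewrite [b k]surjective_pairing /bL /bR !volE !mxE eqxx.
  under [X in (_ + _ * X)%R]eq_bigr => j /negbTE ji do rewrite mxE ji.
  under [X in (_ * X + _)%R]eq_bigr => j /negbTE ji do rewrite mxE ji.
  by rewrite -mulrDl; congr (_ * _)%R; ring.
apply: leeD; apply: ereal_inf_lbound => /=.
- exists bL => //; split => // x [/Xb [k _ kx] Hx]; exists k => // j.
  have := kx j; rewrite /= mxE; case: ifPn => [/eqP ->|//].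
  by move=> /andP[-> x2]/=; rewrite /c le_max le_min x2 Hx orbT.
- exists bR => //; split => // x [/Xb [k _ kx] Hx]; exists k => // j.
  have := kx j; rewrite /= mxE; case: ifPn => [/eqP ->|//].
  move=> /andP[x1 ->]; rewrite andbT /c gt_max x1/= gt_min.
  by move/negP: Hx; rewrite -ltNge => ->.
Qed.

Lemma measurable_coord (R : realType) (n : nat) (i : 'I_n.+1) :
  measurable_fun setT (fun x : Rn R n => (x : 'rV[R]_n.+1) 0%R i).
Proof.
move=> mT; apply: (measurability _ (RGenOInfty.measurableE R)) => //.
move=> _ [_ [a ->] <-]; rewrite setTI.
rewrite (_ : _ @^-1` _ = ~` [set x | ((x : 'rV[R]_n.+1) 0%R i <= a)%R]).
  by apply: measurableC; exact: measurable_half_space.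
by apply/seteqP; split => x /=; rewrite in_itv/= andbT ltNge => /negP.
Qed.

Lemma measurable_eucl_norm (R : realType) (n : nat) :
  measurable_fun setT (@eucl_norm R n).
Proof.
apply: (@measurableT_comp _ _ _ _ _ _ (@Num.sqrt R)).
  by apply: continuous_measurable_fun; exact: sqrt_continuous.
apply: measurable_sum => i.
by apply: measurable_funX; exact: measurable_coord.
Qed.

Lemma measurable_eball (R : realType) (n : nat) (t : R) :
  measurable (@eball R n t).
Proof.
have := @measurable_eucl_norm R n measurableT `]-oo, t[%classic (measurable_itv _).
by rewrite setTI; congr measurable; apply/seteqP; split => x /=; rewrite in_itv.
Qed.

Lemma box_measurable (R : realType) (n : nat) (b : 'rV[R]_n.+1 * 'rV[R]_n.+1) :
  measurable (box b : set (Rn R n)).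
Proof.
rewrite (_ : box b = \big[setI/setT]_(i < n.+1)
    ((fun x : Rn R n => (x : 'rV[R]_n.+1) 0%R i) @^-1` `](b.1 0%R i), (b.2 0%R i)])).
  apply: bigsetI_measurable => i _; rewrite -[X in measurable X]setTI.
  by apply: measurable_coord => //; exact: measurable_itv.
rewrite -bigcap_seq; apply/seteqP; split => x /=.
  by move=> bx i _ /=; rewrite in_itv/=; exact: bx.
by move=> bx i; have /= := bx i; rewrite in_itv/=; apply; rewrite mem_index_enum.
Qed.

Lemma lebesgue_Rn_box_le (R : realType) (n : nat) (b : 'rV[R]_n.+1 * 'rV[R]_n.+1) :
  (forall i, b.1 0%R i <= b.2 0%R i)%R -> lebesgue_Rn (box b) <= (box_volume b)%:E.
Proof.
move=> b12; apply: ereal_inf_lbound => /=.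
exists (fun k => if k == 0%N then b else (0%R, 0%R)).
  split; first by move=> k j; case: ifPn.
  by move=> x bx; exists 0%N.
rewrite nneseries_recl//=; last first.
  by move=> k _; rewrite lee_fin box_volume_ge0// => j; case: ifPn.
rewrite eseries_cond eseries0 ?adde0// => k _; case: k => //= k _.
by rewrite /box_volume big_ord_recl /= subrr mul0r.
Qed.

(** Required by Tonelli in [LM_normE] and by the truncations in [lt_integral_truncation]. *)
Lemma lebesgue_Rn_sigma_finite (R : realType) (n : nat) :
  sigma_finite setT (@lebesgue_Rn R n).
Proof.
exists (fun k => box (const_mx (- k%:R), const_mx k%:R)%R); last first.
  move=> k; split; first exact: box_measurable.
  apply: le_lt_trans (ltry (box_volume (const_mx (- k%:R), const_mx k%:R)%R)).
  apply: lebesgue_Rn_box_le => i /=; rewrite !mxE (@le_trans _ _ 0%R) ?oppr_le0//.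
apply/seteqP; split => // x _.
pose s := (\sum_i `|(x : 'rV[R]_n.+1) 0 i|)%R.
have xs i : (`|(x : 'rV[R]_n.+1) 0 i| <= s)%R.
  by rewrite /s (bigD1 i)//= lerDl sumr_ge0.
exists (Num.truncn s).+1 => // i /=; rewrite !mxE.
have : (`|(x : 'rV[R]_n.+1) 0 i| < (Num.truncn s).+1%:R)%R.
  by apply: le_lt_trans (xs i) _; exact: truncnS_gt.
by rewrite ltr_norml => /andP[-> /ltW ->].
Qed.

HB.instance Definition _ (R : realType) (n : nat) :=
  @Measure_isSigmaFinite.Build _ (Rn R n) R (@lebesgue_Rn R n)
    (lebesgue_Rn_sigma_finite R n).

Lemma lebesgue_Rn_origin (R : realType) (n : nat) :
  lebesgue_Rn [set x : Rn R n | eucl_norm x = 0%R] = 0.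
Proof.
apply/eqP; rewrite eq_le measure_ge0 andbT; apply/lee_addgt0Pr => e e0; rewrite add0e.
(* With [d <= 1], the cube of side [d] has volume at most [d], hence at most [e], in every
   dimension. *)
pose d : R := Num.min e 1%R.
have d0 : (0 < d)%R by rewrite lt_min e0 ltr01.
apply: (@le_trans _ _ (lebesgue_Rn (box (const_mx (- d), const_mx 0) : set (Rn R n))%R)).
  apply: le_outer_measure => x /= /eqP; rewrite sqrtr_eq0 => x0 i /=; rewrite !mxE.
  suff -> : (x : 'rV[R]_n.+1) 0%R i = 0%R by rewrite lexx andbT oppr_lt0.
  apply/eqP; rewrite -sqrf_eq0 eq_le sqr_ge0 andbT.
  apply: le_trans x0; rewrite (bigD1 i)//= lerDl sumr_ge0// => j _.
  exact: sqr_ge0.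
apply: (le_trans (@lebesgue_Rn_box_le R n (const_mx (- d), const_mx 0)%R _)).
  by move=> i /=; rewrite !mxE oppr_le0 ltW.
rewrite lee_fin /box_volume big_ord_recl/= !mxE sub0r opprK.
apply: (@le_trans _ _ (e * 1)%R); last by rewrite mulr1.
apply: ler_pM => //; first exact: ltW.
- by apply: prodr_ge0 => i _; rewrite !mxE sub0r opprK ltW.
- by rewrite ge_min lexx.
- by apply: prodr_ile1 => i _; rewrite !mxE sub0r opprK (ltW d0)/= ge_min lexx orbT.
Qed.

(** * Discrete inequalities *)

Section discrete_inequalities.
Local Open Scope ring_scope.
Context (R : realType).
Implicit Types (x y a b : nat -> R).

(** The induction keeps one extra copy of the last term on the left: it pays for twice the half of
    [x K] that the next step costs. *)
Lemma sum_absorb_prev x y (K : nat) : (forall k, 0 <= x k) ->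
  x 0%N <= y 0%N -> (forall k, x k.+1 <= y k.+1 + x k / 2) ->
  \sum_(k < K.+1) x k <= 2 * \sum_(k < K.+1) y k.
Proof.
move=> x0 xy0 xy.
suff : \sum_(k < K.+1) x k + x K <= 2 * \sum_(k < K.+1) y k.
  by apply: le_trans; rewrite lerDl.
elim: K => [|K ih]; first by rewrite !big_ord1; lra.
by rewrite !(big_ord_recr K.+1)/=; have := xy K; lra.
Qed.

(** Here each term refers to the following one, so a finite sum cannot absorb the last reference; it
    stays as the boundary term [x K]. *)
Lemma sum_absorb_next x y (K : nat) : 0 <= x 0%N -> (forall k, x k <= y k + x k.+1 / 2) ->
  \sum_(k < K) x k <= 2 * \sum_(k < K) y k + x K.
Proof.
move=> x0 xy; elim: K => [|K ih].
  by rewrite !big_ord0 mulr0 add0r.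
by rewrite !big_ord_recr/=; have := xy K; lra.
Qed.

Lemma powRD_le_sum (s t q : R) : 0 <= s -> 0 <= t -> 1 <= q ->
  s `^ q + t `^ q <= (s + t) `^ q.
Proof.
move=> s0 t0 q1.
have q0 : 0 <= q - 1 by lra.
have split u : 0 <= u -> u `^ q = u * u `^ (q - 1).
  move=> u0; have [->|un0] := eqVneq u 0; first by rewrite powR0 ?mul0r//; lra.
  by rewrite -{2}(powRr1 u0) -powRD ?un0 ?implybT//; congr (_ `^ _); lra.
rewrite !split ?addr_ge0// mulrDl.
by apply: lerD; apply: ler_wpM2l => //; apply: ge0_ler_powR; rewrite ?nnegrE //; lra.
Qed.

Lemma powR_sum_le (q : R) a (K : nat) : 1 <= q -> (forall k, 0 <= a k) ->
  \sum_(k < K) a k `^ q <= (\sum_(k < K) a k) `^ q.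
Proof.
move=> q1 a0; elim: K => [|K ih]; first by rewrite !big_ord0 powR_ge0.
rewrite !big_ord_recr/=; apply: (le_trans _ (powRD_le_sum _ _ q1)) => //.
  by rewrite lerD2r.
exact: sumr_ge0.
Qed.

Lemma powRD_le (s t q : R) : 0 <= s -> 0 <= t -> 0 <= q ->
  (s + t) `^ q <= 2 `^ q * (s `^ q + t `^ q).
Proof.
move=> s0 t0 q0; wlog st : s t s0 t0 / s <= t.
  move=> H; have [|ts] := leP s t; first exact: H.
  by rewrite addrC [X in _ * X]addrC H// ltW.
apply: (@le_trans _ _ ((2 * t) `^ q)).
  by rewrite ge0_ler_powR ?nnegrE ?addr_ge0 ?mulr_ge0//; lra.
by rewrite powRM// ler_wpM2l ?powR_ge0// lerDr powR_ge0.
Qed.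

(** Induction on the two-term inequality, applied to the norms of the first K terms paired with the
    new terms. *)
Lemma hoelder_sum a b (p q : R) (K : nat) : 0 < p -> 0 < q -> p^-1 + q^-1 = 1 ->
  (forall k, 0 <= a k) -> (forall k, 0 <= b k) ->
  \sum_(k < K) a k * b k <=
    (\sum_(k < K) a k `^ p) `^ p^-1 * (\sum_(k < K) b k `^ q) `^ q^-1.
Proof.
move=> p0 q0 pq a0 b0; elim: K => [|K ih].
  by rewrite !big_ord0 mulr_ge0 ?powR_ge0.
rewrite !big_ord_recr/=; set X := \sum_(k < K) a k `^ p; set Y := \sum_(k < K) b k `^ q.
have X0 : 0 <= X by apply: sumr_ge0 => i _; exact: powR_ge0.
have Y0 : 0 <= Y by apply: sumr_ge0 => i _; exact: powR_ge0.
have := hoelder2 (powR_ge0 X p^-1) (a0 K) (powR_ge0 Y q^-1) (b0 K) p0 q0 pq.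
have cancel (x e : R) : 0 <= x -> 0 < e -> (x `^ e^-1) `^ e = x.
  by move=> x0 e0; rewrite -powRrM mulVf ?gt_eqF// powRr1.
rewrite (cancel _ _ X0 p0) (cancel _ _ Y0 q0); apply: le_trans.
by rewrite lerD2r.
Qed.

End discrete_inequalities.

(** * Powers and integrals of extended real functions *)

Lemma le_poweR (R : realType) (r : R) (x y : \bar R) :
  (0 <= r)%R -> 0 <= x -> x <= y -> x `^ r <= y `^ r.
Proof.
by move=> r0 x0 xy; apply: gt0_ler_poweR; rewrite ?in_itv/= ?leey ?andbT ?(le_trans x0).
Qed.

Lemma poweRK (R : realType) (r : R) (x : \bar R) :
  (0 < r)%R -> 0 <= x -> (x `^ r) `^ r^-1 = x.
Proof. by move=> r0 x0; rewrite -poweRrM mulfV ?gt_eqF// poweRe1. Qed.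

Lemma poweRVK (R : realType) (r : R) (x : \bar R) :
  (0 < r)%R -> 0 <= x -> (x `^ r^-1) `^ r = x.
Proof. by move=> r0 x0; rewrite -poweRrM mulVf ?gt_eqF// poweRe1. Qed.

Lemma poweRD_le (R : realType) (x y : \bar R) (q : R) : 0 <= x -> 0 <= y -> (0 <= q)%R ->
  (x + y) `^ q <= (2 `^ q)%:E * (x `^ q + y `^ q).
Proof.
move=> x0 y0 q0.
have [->|qn0] := eqVneq q 0%R.
  by rewrite !poweRe0 powRr0 mul1e leeDl.
case: x y x0 y0 => [x| |] [y| |]// x0 y0.
- by rewrite lee_fin; apply: powRD_le.
- by rewrite addey// poweRyr// addey// gt0_muley ?leey// lte_fin powR_gt0.
- by rewrite addye// poweRyr// addye// gt0_muley ?leey// lte_fin powR_gt0.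
- by rewrite addye// poweRyr// addye// gt0_muley ?leey// lte_fin powR_gt0.
Qed.

Lemma measurable_abse_poweR d (T : measurableType d) (R : realType)
    (f : T -> \bar R) (q : R) :
  measurable_fun setT f -> measurable_fun setT (fun x => `|f x| `^ q).
Proof.
move=> mf; apply: (measurableT_comp (measurable_poweR _)).
exact: measurableT_comp mf.
Qed.

Section integral_lemmas.
Context d (T : measurableType d) (R : realType).
Variable mu : {measure set T -> \bar R}.
Implicit Types (A D : set T) (f g h : T -> \bar R).

Lemma integral_sum_pieces D (F : nat -> set T) h (K : nat) :
  (forall k, measurable (F k)) -> trivIset setT F ->
  D = \big[setU/set0]_(k < K) F k ->
  measurable_fun D h -> (forall x, D x -> 0 <= h x) ->
  \int[mu]_(x in D) h x = \sum_(k < K) \int[mu]_(x in F k) h x.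
Proof.
move=> mF tF ->; rewrite -!(big_mkord xpredT) => mh h0.
rewrite ge0_integral_bigsetU// ?iota_uniq//; first by rewrite big_mkord.
exact: sub_trivIset tF.
Qed.

(** Serves twice: with Lebesgue measure and density [h] on the half-line, and with the Stieltjes
    measure and density 1. *)
Lemma sum_le_integral D (F : nat -> set T) f h (c : nat -> \bar R) (K : nat) :
  measurable D -> (forall k, measurable (F k)) -> trivIset setT F ->
  (forall k, (k < K)%N -> F k `<=` D) ->
  measurable_fun D f -> measurable_fun D h ->
  (forall x, D x -> 0 <= f x) -> (forall x, D x -> 0 <= h x) ->
  (forall k, 0 <= c k) ->
  (forall k x, (k < K)%N -> F k x -> c k <= f x) ->
  \sum_(k < K) c k * \int[mu]_(x in F k) h x <= \int[mu]_(x in D) (f x * h x).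
Proof.
move=> mD mF tF FD mf mh f0 h0 c0 cf.
have UD : \big[setU/set0]_(k < K) F k `<=` D.
  by rewrite -bigcup_mkord => x [k /= kK Fx]; exact: (FD k).
have mfh : measurable_fun D (fun x => f x * h x) by exact: emeasurable_funM.
apply: (@le_trans _ _ (\int[mu]_(x in \big[setU/set0]_(k < K) F k) (f x * h x))); last first.
  apply: ge0_subset_integral => //; first exact: bigsetU_measurable.
  by move=> x Dx; rewrite mule_ge0 ?f0 ?h0.
rewrite (integral_sum_pieces mF tF erefl); last 2 first.
- exact: measurable_funS mfh.
- by move=> x /UD Dx; rewrite mule_ge0 ?f0 ?h0.
apply: lee_sum => -[k kK] _ /=.
have FkD := FD k kK.
have h0k x : F k x -> 0 <= h x by move=> /FkD; exact: h0.
have mhk : measurable_fun (F k) h by exact: measurable_funS mh.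
rewrite -ge0_integralZl//; apply: ge0_le_integral => //.
- by move=> x Fx; rewrite mule_ge0 ?h0k.
- by apply: emeasurable_funM => //; exact: measurable_cst.
- exact: measurable_funS mfh.
- by move=> x Fx; rewrite lee_wpmul2r ?h0k// cf.
Qed.

Lemma integral_le_sum D (F : nat -> set T) f h (c : nat -> \bar R) (K : nat) :
  (forall k, measurable (F k)) -> trivIset setT F ->
  D = \big[setU/set0]_(k < K) F k ->
  measurable_fun D f -> measurable_fun D h ->
  (forall x, D x -> 0 <= f x) -> (forall x, D x -> 0 <= h x) ->
  (forall k, 0 <= c k) ->
  (forall k x, (k < K)%N -> F k x -> f x <= c k) ->
  \int[mu]_(x in D) (f x * h x) <= \sum_(k < K) c k * \int[mu]_(x in F k) h x.
Proof.
move=> mF tF DE mf mh f0 h0 c0 cf.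
have FD k : (k < K)%N -> F k `<=` D.
  by move=> kK x Fx; rewrite DE -bigcup_mkord; exists k.
have mD : measurable D by rewrite DE; exact: bigsetU_measurable.
have mfh : measurable_fun D (fun x => f x * h x) by exact: emeasurable_funM.
rewrite (integral_sum_pieces mF tF DE)//; last first.
  by move=> x Dx; rewrite mule_ge0 ?f0 ?h0.
apply: lee_sum => -[k kK] _ /=.
have FkD := FD k kK.
have h0k x : F k x -> 0 <= h x by move=> /FkD; exact: h0.
have mhk : measurable_fun (F k) h by exact: measurable_funS mh.
rewrite -ge0_integralZl//; apply: ge0_le_integral => //.
- by move=> x Fx; rewrite mule_ge0 ?h0k ?f0//; exact: FkD.
- exact: measurable_funS mfh.
- by apply: emeasurable_funM => //; exact: measurable_cst.
- by move=> x Fx; rewrite lee_wpmul2r ?h0k// cf.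
Qed.

(** Reduction to real-valued functions. If one integral vanishes, the product is null a.e.;
    otherwise an infinite integral makes the right side infinite; and in the remaining case both
    functions are finite a.e. *)
Lemma ehoelder f g (p q : R) :
  measurable_fun setT f -> measurable_fun setT g ->
  (forall x, 0 <= f x) -> (forall x, 0 <= g x) ->
  (0 < p)%R -> (0 < q)%R -> (p^-1 + q^-1 = 1)%R ->
  \int[mu]_x (f x * g x) <=
    (\int[mu]_x (f x `^ p)) `^ p^-1 * (\int[mu]_x (g x `^ q)) `^ q^-1.
Proof.
move=> mf mg f0 g0 p0 q0 pq.
have mpow h r : measurable_fun setT h -> measurable_fun setT (fun x => h x `^ r).
  by move=> mh; exact: measurableT_comp (measurable_poweR _) mh.
have If0 h r : 0 <= \int[mu]_x (h x `^ r).
  by apply: integral_ge0 => x _; exact: poweR_ge0.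
have mfg : measurable_fun setT (fun x => f x * g x) by exact: emeasurable_funM.
have ae0 h r : measurable_fun setT h -> (forall x, 0 <= h x) -> (0 < r)%R ->
    \int[mu]_x (h x `^ r) = 0 -> {ae mu, forall x, h x = 0}.
  move=> mh h0 r0 Ih.
  have : \int[mu]_x `|h x `^ r| = 0.
    by rewrite -[RHS]Ih; apply: eq_integral => x _; rewrite gee0_abs ?poweR_ge0.
  move/(ae_eq_integral_abs mu measurableT (mpow _ _ mh)).
  by apply: filterS => x /(_ I); exact: poweR_eq0_eq0.
have prod0 : {ae mu, forall x, f x * g x = 0} -> \int[mu]_x (f x * g x) = 0.
  move=> fg0; rewrite -[RHS](integral0 mu setT); apply: ae_eq_integral => //.
  by apply: filterS fg0 => x ->.
have nonneg : 0 <= (\int[mu]_x (f x `^ p)) `^ p^-1 * (\int[mu]_x (g x `^ q)) `^ q^-1.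
  by rewrite mule_ge0 ?poweR_ge0.
have [fp0|fpn0] := eqVneq (\int[mu]_x (f x `^ p)) 0.
  rewrite prod0//; apply: filterS (ae0 _ _ mf f0 p0 fp0) => x ->.
  by rewrite mul0e.
have [gq0|gqn0] := eqVneq (\int[mu]_x (g x `^ q)) 0.
  rewrite prod0//; apply: filterS (ae0 _ _ mg g0 q0 gq0) => x ->.
  by rewrite mule0.
have Fpos : 0 < (\int[mu]_x (f x `^ p)) `^ p^-1.
  by rewrite poweR_gt0// lt0e fpn0 If0.
have Gpos : 0 < (\int[mu]_x (g x `^ q)) `^ q^-1.
  by rewrite poweR_gt0// lt0e gqn0 If0.
have [fpy|fpny] := eqVneq (\int[mu]_x (f x `^ p)) +oo.
  by rewrite fpy poweRyr ?gt0_mulye ?leey// invr_eq0 gt_eqF.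
have [gqy|gqny] := eqVneq (\int[mu]_x (g x `^ q)) +oo.
  by rewrite gqy poweRyr ?gt0_muley ?leey// invr_eq0 gt_eqF.
have aefin h r : measurable_fun setT h -> (forall x, 0 <= h x) -> (0 < r)%R ->
    \int[mu]_x (h x `^ r) != +oo -> {ae mu, forall x, h x = (fine (h x))%:E}.
  move=> mh h0 r0 Ihy.
  have int : mu.-integrable setT (fun x => h x `^ r).
    apply/integrableP; split; first exact: mpow.
    rewrite (_ : \int[mu]_x _ = \int[mu]_x (h x `^ r)) ?ltey//.
    by apply: eq_integral => x _; rewrite gee0_abs ?poweR_ge0.
  have := integrable_ae measurableT int.
  apply: filterS => x /(_ I) hxfin; rewrite fineK// ge0_fin_numE//.
  by apply: (@lty_poweRy _ _ r); rewrite ?gt_eqF// ltey_eq hxfin.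
have aef := aefin _ _ mf f0 p0 fpny; have aeg := aefin _ _ mg g0 q0 gqny.
pose f' x := fine (f x); pose g' x := fine (g x).
have mf' : measurable_fun setT f' by exact: measurableT_comp.
have mg' : measurable_fun setT g' by exact: measurableT_comp.
have := hoelder mu mf' mg' p0 q0 pq.
rewrite Lnorm1 unlock.
have E h r : measurable_fun setT h -> (forall x, 0 <= h x) ->
    {ae mu, forall x, h x = (fine (h x))%:E} ->
    \int[mu]_x `|(EFin \o (fun x => fine (h x))) x| `^ r = \int[mu]_x (h x `^ r).
  move=> mh h0 aeh; apply: ge0_ae_eq_integral => //.
  - by apply: mpow; apply: measurableT_comp => //; apply/measurable_EFinP; exact: measurableT_comp.
  - exact: mpow.
  - by move=> x _; exact: poweR_ge0.
  - by move=> x _; exact: poweR_ge0.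
  - by apply: filterS aeh => x hx _; rewrite -[in RHS](gee0_abs (h0 x)) [in RHS]hx.
rewrite (E _ _ mf f0 aef) (E _ _ mg g0 aeg); apply: le_trans.
rewrite le_eqVlt; apply/orP; left; apply/eqP; apply: ge0_ae_eq_integral => //.
- apply: measurableT_comp => //; apply/measurable_EFinP; exact: measurable_funM.
- by move=> x _; rewrite mule_ge0.
apply: filterS2 aef aeg => x fx gx _ /=.
by rewrite -[LHS]gee0_abs ?mule_ge0// [in LHS]fx [in LHS]gx.
Qed.

End integral_lemmas.

(** Truncating [v] at height m on A intersected with a set of finite measure gives a bounded
    function with finite integral, and monotone convergence passes [y]. Finiteness is what allows
    the result to be normalized when near-extremal functions are built. *)
Lemma lt_integral_truncation d (T : measurableType d) (R : realType)
    (mu : {sigma_finite_measure set T -> \bar R}) (A : set T) (v : T -> \bar R) (y : \bar R) :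
  measurable A -> measurable_fun setT v -> (forall x, 0 <= v x) ->
  y < \int[mu]_(x in A) v x ->
  exists h : T -> R, [/\ measurable_fun setT h, (forall x, 0 <= h x)%R,
    (forall x, ~ A x -> h x = 0%R), (forall x, (h x)%:E <= v x) &
    y < \int[mu]_x (h x)%:E < +oo].
Proof.
move=> mA mv v0 yv.
have /sigma_finiteP[E [TE ndE mE]] := sigma_finiteT mu.
pose w m x := mine (v x) m%:R%:E.
pose g m := w m \_ (A `&` E m).
have mAE m : measurable (A `&` E m) by apply: measurableI => //; exact: (mE m).1.
have w0 m x : 0 <= w m x by rewrite le_min v0 lee_fin ler0n.
have wm m x : w m x <= m%:R%:E by rewrite ge_min lexx orbT.
have wv m x : w m x <= v x by rewrite ge_min lexx.
have mw m : measurable_fun setT (w m) by apply: measurable_mine => //; exact: measurable_cst.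
have mg m : measurable_fun setT (g m).
  by apply/(measurable_restrictT _ (mAE m)); exact: measurable_funTS.
have g0 m x : 0 <= g m x by apply: erestrict_ge0 => z _; exact: w0.
have ndg x : nondecreasing_seq (g ^~ x).
  move=> m n mn; apply: (@le_trans _ _ ((w n \_ (A `&` E m)) x)).
    by apply: lee_restrict => z _; rewrite le_min wv (le_trans (wm _ _))// lee_fin ler_nat.
  apply: restrict_lee => [z _|]; first exact: w0.
  by apply: setIS; apply/subsetPset; exact: ndE.
have [m ym] : exists m, y < \int[mu]_x g m x.
  apply: contrapT => /forallNP nex; move: yv; apply/negP; rewrite -leNgt integral_mkcond.
  apply: (@le_trans _ _ (\int[mu]_x limn (g ^~ x))).
    apply: ge0_le_integral => //.
    - by move=> x _; apply: erestrict_ge0.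
    - by apply/(measurable_restrictT _ mA); exact: measurable_funTS.
    - by apply: emeasurable_fun_cvg mg _ => x _; exact: ereal_nondecreasing_is_cvgn.
    move=> x _; rewrite patchE; case: ifPn => [/set_mem Ax|_]; last first.
      by apply: lime_ge; [exact: ereal_nondecreasing_is_cvgn|exact: nearW].
    rewrite (cvg_lim _ (ereal_nondecreasing_cvgn (ndg x)))//.
    have [k _ kx] : (\bigcup_i E i) x by rewrite -TE.
    have gE j : (k <= j)%N -> g j x = w j x.
      move=> kj; rewrite /g patchE mem_set//; split => //.
      by have /subsetPset := ndE _ _ kj; exact.
    have [vy|vy] := eqVneq (v x) +oo.
      rewrite vy leye_eq; apply/eqP/eqyP => B _.
      pose j := maxn k (Num.truncn B).+1.
      apply: (@le_trans _ _ (g j x)); last by apply: ereal_sup_ubound; exists j.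
      rewrite gE ?leq_maxl// /w vy minye lee_fin ltW//.
      by apply: lt_le_trans (truncnS_gt _) _; rewrite ler_nat leq_maxr.
    have vfin : v x \is a fin_num by rewrite ge0_fin_numE// ltey.
    pose j := maxn k (Num.truncn (fine (v x))).+1.
    apply: ereal_sup_ubound; exists j => //.
    rewrite gE ?leq_maxl// /w min_l// -(fineK vfin) lee_fin ltW//.
    by apply: lt_le_trans (truncnS_gt _) _; rewrite ler_nat leq_maxr.
  rewrite monotone_convergence//.
  apply: lime_le.
    apply: ereal_nondecreasing_is_cvgn => i j ij; apply: ge0_le_integral => //.
    by move=> x _; exact: ndg.
  by apply: nearW => n; rewrite leNgt; apply/negP; exact: nex.
have gfin x : g m x \is a fin_num.
  rewrite ge0_fin_numE//; apply: (@le_lt_trans _ _ m%:R%:E); last exact: ltry.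
  by rewrite /g patchE; case: ifPn => // _; rewrite lee_fin.
exists (fun x => fine (g m x)); split.
- exact: measurableT_comp.
- by move=> x; rewrite fine_ge0.
- by move=> x nAx; rewrite /g patchE memNset// => -[].
- by move=> x; rewrite fineK// /g patchE; case: ifPn.
under eq_integral do rewrite fineK//.
rewrite ym/= -integral_mkcond.
apply: (@le_lt_trans _ _ (\int[mu]_(x in A `&` E m) (cst m%:R%:E x))).
  by apply: ge0_le_integral => //; exact: measurable_funTS.
rewrite integral_cst// lte_mul_pinfty ?lee_fin// (le_lt_trans _ (mE m).2)//.
by apply: le_measure; rewrite ?inE//; exact: (mE m).1.
Qed.

(** * The weighted norms as functions of the domain *)

Section norm_on_theory.
Context d (T : measurableType d) (R : realType).
Variable mu : {measure set T -> \bar R}.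
Implicit Types (A B : set T) (f g u : T -> \bar R).

Lemma norm_on_ge0 (p : \bar R) A f : 0 <= norm_on mu p A f.
Proof. exact: Lnorm_ge0. Qed.

Lemma norm_onE (p : R) A f : (0 < p)%R -> measurable A ->
  norm_on mu p%:E A f = (\int[mu]_(x in A) `|f x| `^ p) `^ p^-1.
Proof.
move=> p0 mA; rewrite /norm_on unlock [in RHS]integral_mkcond; congr (_ `^ _).
apply: eq_integral => x _; rewrite !patchE; case: ifPn => // _.
by rewrite abse0 poweR0r// gt_eqF.
Qed.

Lemma norm_on_poweR (p : R) A f : (0 < p)%R -> measurable A ->
  norm_on mu p%:E A f `^ p = \int[mu]_(x in A) `|f x| `^ p.
Proof.
move=> p0 mA; rewrite norm_onE// poweRVK//.
by apply: integral_ge0 => x _; exact: poweR_ge0.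
Qed.

Lemma norm_ony_leP A f (y : \bar R) : 0 <= y ->
  norm_on mu +oo A f <= y <-> {ae mu, forall x, A x -> `|f x| <= y}.
Proof.
move=> y0; have E : {ae mu, forall x, A x -> `|f x| <= y} <->
    {ae mu, forall x, `|(f \_ A) x| <= y}.
  split; apply: filterS => x.
    by rewrite patchE; case: ifPn => [/set_mem xA ->//|_ _]; rewrite abse0.
  by move=> + Ax; rewrite patchE mem_set.
(* On a space of measure zero the [+oo]-norm is 0 by definition, not an essential supremum; there
   the a.e. statement is trivial and [0 <= y] gives the other one. *)
rewrite E /norm_on unlock; case: ifPn => [_|]; first by split => [/ess_supP|H]; last exact/ess_supP.
rewrite -leNgt => muT; split => // _.
exists setT; split => //; apply/eqP; rewrite eq_le muT/=; exact: measure_ge0.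
Qed.

End norm_on_theory.

Lemma exp_to_lt (R : realType) (P p : R) : (0 < p)%R -> (p < P)%R ->
  exp_to P%:E p%:E = ((p^-1 - P^-1)^-1)%:E.
Proof.
move=> p0 pP; have P0 := lt_trans p0 pP.
rewrite /exp_to lte_fin pP !inver !gt_eqF// -EFinB inver gt_eqF//.
by rewrite subr_gt0 ltf_pV2 ?posrE.
Qed.

Lemma exp_to_refl (R : realType) (p : \bar R) : exp_to p p = +oo.
Proof. by rewrite /exp_to ltxx. Qed.

Lemma exp_to_pos (R : realType) (P p : R) : (0 < p)%R -> (p < P)%R ->
  (0 < (p^-1 - P^-1)^-1)%R.
Proof.
by move=> p0 pP; rewrite invr_gt0 subr_gt0 ltf_pV2 ?posrE// (lt_trans p0).
Qed.

Section norm_on_exp_to.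
Context d (T : measurableType d) (R : realType).
Variable mu : {sigma_finite_measure set T -> \bar R}.
Variables (P p : R) (p0 : (0 < p)%R) (pP : (p <= P)%R).
Variables (u : T -> \bar R) (mu_u : measurable_fun setT u).
Implicit Types (A B : set T) (g : T -> \bar R).
Local Notation N A := (norm_on mu (exp_to P%:E p%:E) A u).

Let P0 : (0 < P)%R. Proof. exact: lt_le_trans pP. Qed.

Let mpow := @measurable_abse_poweR _ T R.

Lemma norm_exp_to_le A B : measurable A -> measurable B -> A `<=` B -> N A <= N B.
Proof.
move=> mA mB AB; move: pP; rewrite le_eqVlt => /predU1P[->|ltpP].
  rewrite exp_to_refl; apply/norm_ony_leP; first exact: norm_on_ge0.
  have /norm_ony_leP := lexx (norm_on mu +oo B u).
  move/(_ (norm_on_ge0 _ _ _ _)); apply: filterS => x /(_ _)/[swap] /AB Bx.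
  exact.
rewrite exp_to_lt//; apply: le_norm_on => //; first exact: exp_to_pos.
exact: measurable_funTS.
Qed.

(** With s = P -> p, this is Hoelder for the conjugate exponents P/p and s/p. For P = p the
    essential supremum is pulled out instead. *)
Lemma norm_exp_to_hoelder A g : measurable A -> measurable_fun setT g ->
  \int[mu]_(x in A) `|g x * u x| `^ p <=
    (\int[mu]_(x in A) `|g x| `^ P) `^ (p / P) * N A `^ p.
Proof.
move=> mA mg; move: pP; rewrite le_eqVlt => /predU1P[<-|ltpP].
  rewrite exp_to_refl divff ?gt_eqF// poweRe1; last first.
    by apply: integral_ge0 => x _; exact: poweR_ge0.
  rewrite -ge0_integralZr//; last 3 first.
  - by apply: measurable_funTS; exact: mpow.
  - by move=> x _; exact: poweR_ge0.
  - exact: poweR_ge0.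
  have /norm_ony_leP := lexx (norm_on mu +oo A u).
  move/(_ (norm_on_ge0 _ _ _ _)) => uN.
  apply: ae_ge0_le_integral => //.
  - by move=> x _; exact: poweR_ge0.
  - by apply: measurable_funTS; apply: mpow; exact: emeasurable_funM.
  - by move=> x _; rewrite mule_ge0 ?poweR_ge0.
  - apply: emeasurable_funM; last exact: measurable_cst.
    by apply: measurable_funTS; exact: mpow.
  apply: filterS uN => x /(_ _)/[swap] Ax /(_ Ax) ux.
  rewrite abseM poweRM// lee_wpmul2l ?poweR_ge0// le_poweR// ltW//.
rewrite exp_to_lt//; set s : R := ((p^-1 - P^-1)^-1)%R.
have s0 : (0 < s)%R by exact: exp_to_pos.
have sE : (s^-1 = p^-1 - P^-1)%R by rewrite invrK.
rewrite norm_onE// -poweRrM.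
pose a x := ((fun x => `|g x| `^ p) \_ A) x.
pose b x := ((fun x => `|u x| `^ p) \_ A) x.
have -> : \int[mu]_(x in A) `|g x * u x| `^ p = \int[mu]_x (a x * b x).
  rewrite integral_mkcond; apply: eq_integral => x _.
  rewrite /a /b !patchE; case: ifPn => _; last by rewrite mule0.
  by rewrite abseM poweRM.
have IE h (q : R) : (0 < q)%R ->
    \int[mu]_(x in A) `|h x| `^ q = \int[mu]_x (((fun x => `|h x| `^ p) \_ A) x `^ (q / p)).
  move=> q0; rewrite [LHS]integral_mkcond; apply: eq_integral => x _.
  rewrite !patchE; case: ifPn => _; last by rewrite poweR0r// gt_eqF// divr_gt0.
  by rewrite -poweRrM mulrCA divff ?gt_eqF// mulr1.
rewrite (IE g)// (IE u)// -/a -/b.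
have -> : (p / P = (P / p)^-1)%R by rewrite invf_div.
have -> : (s^-1 * p = (s / p)^-1)%R by rewrite invf_div mulrC.
have mA0 h : measurable_fun setT h -> measurable_fun setT ((fun x => `|h x| `^ p) \_ A).
  by move=> mh; apply/(measurable_restrictT _ mA); apply: measurable_funTS; exact: mpow.
apply: ehoelder.
- exact: mA0.
- exact: mA0.
- by move=> x; apply: erestrict_ge0 => z _; exact: poweR_ge0.
- by move=> x; apply: erestrict_ge0 => z _; exact: poweR_ge0.
- by rewrite divr_gt0.
- by rewrite divr_gt0.
- rewrite !invf_div mulrC [X in (_ + X)%R]mulrC -mulrDl sE addrC subrK mulVf// gt_eqF//.
Qed.

(** Passes from balls to the whole space in the term at infinity: by monotone convergence for a
    finite exponent, by a countable union of null sets for the essential supremum. *)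
Lemma norm_exp_to_bigcup (F : nat -> set T) (y : \bar R) :
  (forall k, measurable (F k)) -> nondecreasing_seq F -> 0 <= y ->
  (forall k, N (F k) <= y) -> N (\bigcup_k F k) <= y.
Proof.
move=> mF ndF y0 FN; move: pP; rewrite le_eqVlt => /predU1P[pPE|ltpP].
  move: FN; rewrite -pPE exp_to_refl => FN.
  apply/norm_ony_leP => //.
  have : {ae mu, forall x, forall k, F k x -> `|u x| <= y}.
    by apply/ae_foralln => k; apply/norm_ony_leP => //.
  by apply: filterS => x ux [k _]; exact: ux.
move: FN; rewrite exp_to_lt//; set s : R := ((p^-1 - P^-1)^-1)%R => FN.
have s0 : (0 < s)%R by exact: exp_to_pos.
have mU : measurable (\bigcup_k F k) by exact: bigcup_measurable.
rewrite -(poweRK s0 y0) norm_onE//; apply: le_poweR; first by rewrite invr_ge0 ltW.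
  by apply: integral_ge0 => x _; exact: poweR_ge0.
apply: (cvge_to_le (ge0_nondecreasing_set_cvg_integral ndF mF _ _)).
- by move=> k; apply: measurable_funTS; exact: mpow.
- by move=> k x _; exact: poweR_ge0.
- apply: nearW => k; rewrite -(norm_on_poweR _ _ s0)//; apply: le_poweR => //.
    exact: ltW.
  exact: norm_on_ge0.
Qed.

(** The constant is 2^(r/s) with s = P -> p, written through 1/s = 1/p - 1/P so that it becomes 1
    when s is infinite. *)
Lemma norm_exp_toU A B (r : R) : measurable A -> measurable B -> [disjoint A & B] ->
  (0 <= r)%R ->
  N (A `|` B) `^ r <= (2 `^ (r * (p^-1 - P^-1)))%:E * (N A `^ r + N B `^ r).
Proof.
move=> mA mB AB r0; move: pP; rewrite le_eqVlt => /predU1P[<-|ltpP].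
  rewrite exp_to_refl subrr mulr0 powRr0 mul1e.
  set NA := norm_on _ _ A _; set NB := norm_on _ _ B _.
  apply: (@le_trans _ _ (maxe NA NB `^ r)).
    apply: le_poweR => //; first exact: norm_on_ge0.
    apply/norm_ony_leP; first by rewrite le_max norm_on_ge0.
    have /norm_ony_leP := lexx NA; move/(_ (norm_on_ge0 _ _ _ _)).
    have /norm_ony_leP := lexx NB; move/(_ (norm_on_ge0 _ _ _ _)).
    apply: filterS2 => x Bx Ax [/Ax|/Bx] H; rewrite le_max H ?orbT//.
  rewrite /maxe; case: ifPn => _.
    by rewrite leeDr// poweR_ge0.
  by rewrite leeDl// poweR_ge0.
rewrite exp_to_lt//; set s : R := ((p^-1 - P^-1)^-1)%R.
have s0 : (0 < s)%R by exact: exp_to_pos.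
rewrite -[(p^-1 - P^-1)%R]invrK -/s.
rewrite !norm_onE//; last exact: measurableU.
rewrite ge0_integral_setU//; last 2 first.
- by apply: measurable_funTS; exact: mpow.
- by move=> x _; exact: poweR_ge0.
rewrite -!poweRrM [(s^-1 * r)%R]mulrC.
have rs0 : (0 <= r / s)%R by rewrite divr_ge0// ltW.
set IA := \int[mu]_(x in A) _; set IB := \int[mu]_(x in B) _.
have IA0 : 0 <= IA by apply: integral_ge0 => x _; exact: poweR_ge0.
have IB0 : 0 <= IB by apply: integral_ge0 => x _; exact: poweR_ge0.
exact: poweRD_le.
Qed.

End norm_on_exp_to.

(** * Near-extremal functions for Hoelder's inequality *)

Section saturation.
Context d (T : measurableType d) (R : realType).
Variable mu : {sigma_finite_measure set T -> \bar R}.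
Implicit Types (A : set T) (u : T -> \bar R).

(** Converse of Hoelder. The extremal function is a normalized |u|^(s/P), with s = P -> p, but |u|^s
    may have infinite integral or infinite values; it is replaced by a truncation [h] below it, and
    [g] is (h/I)^(1/P) with I the integral of [h]. *)
Lemma norm_exp_to_saturate (P p : R) u A (y : R) : (0 < p)%R -> (p <= P)%R ->
  measurable_fun setT u -> measurable A -> (0 <= y)%R ->
  y%:E < norm_on mu (exp_to P%:E p%:E) A u ->
  exists g : T -> R, [/\ measurable_fun setT g, (forall x, 0 <= g x)%R,
    (forall x, ~ A x -> g x = 0%R), \int[mu]_x ((g x)%:E `^ P) <= 1 &
    (y `^ p)%:E <= \int[mu]_x (((g x)%:E * `|u x|) `^ p)].
Proof.
move=> p0 pP mu_u mA y0 yN.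
have P0 : (0 < P)%R by exact: lt_le_trans pP.
have mabs : measurable_fun setT (fun x => `|u x|) by exact: measurableT_comp.
have normalize (h : T -> R) : measurable_fun setT h -> (forall x, 0 <= h x)%R ->
    0 < \int[mu]_x (h x)%:E < +oo -> exists2 I : R, \int[mu]_x (h x)%:E = I%:E &
    \int[mu]_x ((((h x / I) `^ P^-1)%R)%:E `^ P) = 1.
  move=> mh h0 /andP[I0 Ioo].
  have Ifin : \int[mu]_x (h x)%:E \is a fin_num by rewrite gt0_fin_numE.
  exists (fine (\int[mu]_x (h x)%:E)); first by rewrite fineK.
  set I := fine _; have IE : \int[mu]_x (h x)%:E = I%:E by rewrite fineK.
  have I0' : (0 < I)%R by rewrite -lte_fin -IE.
  transitivity (\int[mu]_x ((I^-1)%:E * (h x)%:E)).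
    apply: eq_integral => x _; rewrite poweR_EFin -powRrM mulVf ?gt_eqF// powRr1 ?divr_ge0//.
      by rewrite mulrC EFinM.
    exact: ltW.
  rewrite ge0_integralZl//; last 3 first.
  - exact/measurable_EFinP.
  - by move=> x _; rewrite lee_fin.
  - by rewrite lee_fin invr_ge0 ltW.
  by rewrite IE -EFinM mulVf// gt_eqF.
have mg (h : T -> R) (I : R) : measurable_fun setT h ->
    measurable_fun setT (fun x => (h x / I) `^ P^-1)%R.
  move=> mh; apply: (measurableT_comp (measurable_powR _)).
  by apply: measurable_funM => //; exact: measurable_cst.
have mgu (g : T -> R) : measurable_fun setT g ->
    measurable_fun setT (fun x => ((g x)%:E * `|u x|) `^ p).
  move=> mg'; apply: (measurableT_comp (measurable_poweR _)).
  by apply: emeasurable_funM => //; exact/measurable_EFinP.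
move: yN; move: (pP); rewrite le_eqVlt => /predU1P[pPE|ltpP].
  rewrite -{1}pPE exp_to_refl => yN.
  (* For P = p, mass is placed where |u| exceeds [y]. This set is not null because [y] is below the
     essential supremum, and [h] below its indicator vanishes elsewhere. *)
  pose D := A `&` [set x | y%:E < `|u x|].
  have mD : measurable D.
    apply: measurableI => //; rewrite -[X in measurable X]setTI.
    rewrite (_ : [set x | _] = (fun x => `|u x|) @^-1` `]y%:E, +oo[%classic); last first.
      by apply/seteqP; split => x /=; rewrite in_itv/= andbT.
    apply: mabs => //; exact: emeasurable_itv.
  have D0 : 0 < mu D.
    rewrite lt_neqAle measure_ge0 andbT; apply/eqP => D0; move: yN; apply/negP.
    rewrite -leNgt; apply/norm_ony_leP; first by rewrite lee_fin.
    exists D; split => // x /= /not_implyP[Ax /negP]; rewrite -ltNge => yu.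
    by split.
  have := @lt_integral_truncation _ _ _ mu A (fun x => (\1_D x)%:E) 0 mA.
  case.
  - by apply/measurable_EFinP; exact: measurable_indic.
  - by move=> x; rewrite lee_fin.
  - by rewrite integral_indic// (_ : D `&` A = D)// setIidl// => x [].
  move=> h [mh h0 hA hD I0].
  have [I IE gP] := normalize h mh h0 I0.
  exists (fun x => (h x / I) `^ P^-1)%R; split => //.
  - exact: mg.
  - by move=> x; exact: powR_ge0.
  - by move=> x nA; rewrite hA// mul0r powR0// invr_eq0 gt_eqF.
  - by rewrite gP.
  rewrite -[leLHS]mule1 -gP -pPE -ge0_integralZl//; last 3 first.
  - apply: (measurableT_comp (measurable_poweR _)); apply/measurable_EFinP.
    by rewrite pPE; exact: mg.
  - by move=> x _; exact: poweR_ge0.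
  - by rewrite lee_fin powR_ge0.
  apply: ge0_le_integral => //.
  - by move=> x _; rewrite mule_ge0 ?poweR_ge0// lee_fin powR_ge0.
  - apply: emeasurable_funM; first exact: measurable_cst.
    apply: (measurableT_comp (measurable_poweR _)); apply/measurable_EFinP.
    by rewrite pPE; exact: mg.
  - by apply: mgu; rewrite pPE; exact: mg.
  move=> x _; rewrite poweRM// ?lee_fin ?powR_ge0// muleC.
  have [Dx|nDx] := pselect (D x).
    rewrite lee_wpmul2l ?poweR_ge0// -poweR_EFin le_poweR// ?lee_fin//; first exact: ltW.
    exact: ltW Dx.2.
  have -> : h x = 0%R.
    by apply/eqP; rewrite eq_le h0 andbT -lee_fin (le_trans (hD x))// indicE memNset.
  by rewrite mul0r powR0 ?invr_eq0 ?gt_eqF// poweR0r ?gt_eqF// !mul0e.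
rewrite exp_to_lt//; set s : R := ((p^-1 - P^-1)^-1)%R => yN.
have s0 : (0 < s)%R by exact: exp_to_pos.
have := @lt_integral_truncation _ _ _ mu A (fun x => `|u x| `^ s) (y `^ s)%:E mA.
case.
- exact: (measurableT_comp (measurable_poweR _)).
- by move=> x; exact: poweR_ge0.
- rewrite -norm_on_poweR// -poweR_EFin ltNge; apply/negP => NV; move: yN.
  apply/negP; rewrite -leNgt -(poweRK s0 (norm_on_ge0 _ _ _ _)).
  rewrite -(@poweRK _ s y%:E)// le_poweR// ?poweR_ge0// invr_ge0 ltW//.
move=> h [mh h0 hA hu /andP[yI Ioo]].
have I0 : 0 < \int[mu]_x (h x)%:E < +oo.
  by rewrite Ioo andbT; apply: le_lt_trans yI; rewrite lee_fin powR_ge0.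
have [I IE gP] := normalize h mh h0 I0.
have I0' : (0 < I)%R by case/andP: I0 => + _; rewrite IE.
exists (fun x => (h x / I) `^ P^-1)%R; split => //.
- exact: mg.
- by move=> x; exact: powR_ge0.
- by move=> x nA; rewrite hA// mul0r powR0// invr_eq0 gt_eqF.
- by rewrite gP.
have sp : (p / P + p / s = 1)%R.
  by rewrite /s invrK; field; rewrite !gt_eqF.
(* Since p/P + p/s = 1 and h <= |u|^s, the integrand is at least (h/I)^(p/P) h^(p/s) = I^(-p/P) h.
   Its integral I^(p/s) is at least y^p, because I exceeds y^s. *)
apply: (@le_trans _ _ (\int[mu]_x ((I `^ (- (p / P)))%:E * (h x)%:E))).
  rewrite ge0_integralZl//; last 3 first.
  - exact/measurable_EFinP.
  - by move=> x _; rewrite lee_fin.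
  - by rewrite lee_fin powR_ge0.
  rewrite IE -EFinM lee_fin.
  have -> : (I `^ (- (p / P)) * I = (I `^ (p / s)))%R.
    rewrite -{2}(powRr1 (ltW I0')) -powRD; last by rewrite (gt_eqF I0') implybT.
    by congr (_ `^ _)%R; rewrite -sp addrA addNr add0r.
  have -> : (y `^ p = (y `^ s) `^ (p / s))%R by rewrite -powRrM mulrCA divff ?gt_eqF// mulr1.
  apply: ge0_ler_powR; rewrite ?nnegrE ?powR_ge0 ?(ltW I0')//.
    by rewrite divr_ge0 ?ltW.
  by rewrite -lee_fin -IE ltW.
apply: ge0_le_integral => //.
- by move=> x _; rewrite mule_ge0 ?lee_fin ?powR_ge0.
- by apply: emeasurable_funM; [exact: measurable_cst|exact/measurable_EFinP].
- by apply: mgu; exact: mg.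
move=> x _; rewrite poweRM ?lee_fin ?powR_ge0// poweR_EFin -powRrM [(P^-1 * p)%R]mulrC.
have hus : (h x `^ (p / s))%:E <= `|u x| `^ p.
  have -> : `|u x| `^ p = (`|u x| `^ s) `^ (p / s).
    by rewrite -poweRrM mulrCA divff ?gt_eqF// mulr1.
  by rewrite -poweR_EFin le_poweR// ?lee_fin// divr_ge0// ltW.
apply: (@le_trans _ _ (((h x / I) `^ (p / P))%:E * (h x `^ (p / s))%:E)); last first.
  by rewrite lee_wpmul2l// lee_fin powR_ge0.
rewrite -!EFinM lee_fin powRM ?invr_ge0 ?(ltW I0')// mulrAC -powRD ?sp ?oner_eq0// powRr1//.
by rewrite -[(I^-1)%R]powR_inv1 ?(ltW I0')// -powRrM mulN1r mulrC.
Qed.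

End saturation.

(** * The primitive of a weight on the half-line *)

Lemma lt_integral_nondecreasing_set d (T : measurableType d) (R : realType)
    (mu : {measure set T -> \bar R}) (F : nat -> set T) (h : T -> \bar R) (y : \bar R) :
  nondecreasing_seq F -> (forall k, measurable (F k)) ->
  measurable_fun (\bigcup_k F k) h -> (forall x, (\bigcup_k F k) x -> 0 <= h x) ->
  y < \int[mu]_(x in \bigcup_k F k) h x -> exists k, y < \int[mu]_(x in F k) h x.
Proof.
move=> ndF mF mh h0 yh; apply: contrapT => /forallNP H; move: yh; apply/negP.
rewrite -leNgt; apply: (cvge_to_le (ge0_nondecreasing_set_cvg_integral ndF mF _ _)).
- by move=> k; apply: measurable_funS mh => //; [exact: bigcup_measurable|exact: bigcup_sup].
- by move=> k x Fx; apply: h0; exists k.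
- by apply: nearW => k; rewrite leNgt; apply/negP.
Qed.

Lemma measurable_Rline_itv (R : realType) (i : interval R) :
  measurable ([set` i] : set (Rline R)).
Proof. by apply: sub_caratheodory; exact: (@measurable_itv R i). Qed.

Section primitive.
Context (R : realType).
Local Notation leb := (@completed_lebesgue_measure R).
Variable h : Rline R -> \bar R.
Hypothesis mh : measurable_fun half_line h.
Hypothesis h0 : forall t, half_line t -> 0 <= h t.
Hypothesis hfin : forall t : R, (0 < t)%R ->
  0 < \int[leb]_(s in (`]0%R, t[%classic : set R)) h s < +oo.

Definition primitive (t : R) : R := fine (\int[leb]_(s in (`]0%R, t[%classic : set R)) h s).
Local Notation M := primitive.

Let mitv := @measurable_Rline_itv R.

Let half_itv (a : R) (b : itv_bound R) (c : bool) : (0 <= a)%R -> (c ==> (0 < a)%R) ->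
  [set` Interval (BSide c a) b] `<=` @half_line R.
Proof.
move=> a0 ca x; rewrite /half_line /= !in_itv/= andbT => /andP[+ _].
case: c ca => /= [a0'|_]; first exact: lt_le_trans.
exact: le_lt_trans.
Qed.

Let mhs (i : interval R) : [set` i] `<=` @half_line R ->
  measurable_fun ([set` i] : set (Rline R)) h.
Proof. by move=> ih; apply: measurable_funS mh => //; exact: (mitv `]0%R, +oo[). Qed.

Lemma primitiveE (t : R) : (0 < t)%R ->
  \int[leb]_(s in (`]0%R, t[%classic : set R)) h s = (M t)%:E.
Proof.
by move=> t0; have /andP[I0 Ioo] := hfin t0; rewrite fineK// ge0_fin_numE// ltW.
Qed.

Lemma primitive_gt0 (t : R) : (0 < t)%R -> (0 < M t)%R.
Proof. by move=> t0; rewrite -lte_fin -primitiveE//; case/andP: (hfin t0). Qed.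

Lemma integral_itv_primitive (a b : R) : (0 < a)%R -> (a <= b)%R ->
  \int[leb]_(s in (`[a, b[%classic : set R)) h s = (M b - M a)%:E.
Proof.
move=> a0 ab; have b0 := lt_le_trans a0 ab.
have Hb : `]0%R, b[%classic `<=` @half_line R by exact: half_itv.
have E : (`]0%R, b[%classic : set (Rline R)) = `]0%R, a[ `|` `[a, b[.
  apply/seteqP; split => x /=; rewrite !in_itv/=.
    by move=> /andP[-> ->]; rewrite andbT/=; case: (ltP x a); [left|right].
  move=> [/andP[-> xa]|/andP[ax ->]]; first by rewrite (lt_le_trans xa).
  by rewrite (lt_le_trans a0).
have := primitiveE b0; rewrite E ge0_integral_setU; [|exact: mitv|exact: mitv| | |]; last 3 first.
- by rewrite -E; exact: mhs.
- by rewrite -E => x /Hb; exact: h0.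
- apply/eqP; rewrite -subset0 => x [] /=; rewrite !in_itv/= => /andP[_ xa] /andP[ax _].
  by move: xa; rewrite ltNge ax.
rewrite primitiveE//; set I := integral _ _ _ => EI.
by rewrite EFinB -EI addeAC subee// add0e.
Qed.

Lemma primitive_le (a b : R) : (0 < a)%R -> (a <= b)%R -> (M a <= M b)%R.
Proof.
move=> a0 ab; rewrite -subr_ge0 -lee_fin -integral_itv_primitive//.
apply: integral_ge0 => x; rewrite /= in_itv/= => /andP[ax _]; apply: h0.
by rewrite /half_line/= in_itv/= (lt_le_trans a0).
Qed.

Lemma primitive_lt (a b : R) : (0 < a)%R -> (0 < b)%R -> (M a < M b)%R -> (a < b)%R.
Proof. by move=> a0 b0; apply: contraTT; rewrite -!leNgt; exact: primitive_le. Qed.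

Lemma primitive_left (y t : R) : (0 < t)%R -> (y < M t)%R ->
  exists s, (0 < s < t)%R /\ (y < M s)%R.
Proof.
move=> t0 yM.
pose F k : set (Rline R) := `]0%R, (t - k.+1%:R^-1)%R]%classic.
have UF : \bigcup_k F k = `]0%R, t[%classic by rewrite /F [RHS]itv_bnd_open_bigcup.
have [] := @lt_integral_nondecreasing_set _ _ _ leb F h y%:E.
- move=> i j ij; apply/subsetPset => x; rewrite /F/= !in_itv/= => /andP[->/=] /le_trans; apply.
  by rewrite lerB// lef_pV2 ?posrE// ler_nat.
- by move=> k; exact: mitv.
- by rewrite UF; apply: mhs; exact: half_itv.
- by rewrite UF => x tx; apply: h0; move: x tx; exact: half_itv.
- by rewrite UF primitiveE// lte_fin.
(* The maximum with [t / 2] keeps [s] positive; [k.+2] instead of [k.+1] makes the half-closed [F k]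
   fit into the open interval up to [s]. *)
move=> k yF; pose s : R := Num.max (t / 2)%R (t - k.+2%:R^-1)%R.
have s0 : (0 < s)%R by rewrite lt_max divr_gt0.
exists s; split.
  rewrite s0/= gt_max ltrBlDr ltrDl invr_gt0 ltr0Sn andbT; lra.
rewrite -lte_fin -primitiveE//; apply: lt_le_trans yF _.
apply: ge0_subset_integral; [exact: mitv|exact: mitv| | |].
- by apply: mhs; exact: half_itv.
- by move=> x sx; apply: h0; move: x sx; exact: half_itv.
- move=> x; rewrite /F/= !in_itv/= => /andP[->/=] xk; apply: le_lt_trans xk _.
  by rewrite lt_max; apply/orP; right; rewrite ltrD2l ltrN2 ltf_pV2 ?posrE// ltr_nat.
Qed.

(* The open interval is the increasing union of [a + 1/(k+1), b[, and the
   point [a] is negligible. *)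
Let integral_open_right (a b y : R) : (0 <= a)%R -> (a < b)%R ->
  y%:E < \int[leb]_(s in (`]a, b[%classic : set R)) h s ->
  exists t, (a < t < b)%R /\ y%:E < \int[leb]_(s in (`[t, b[%classic : set R)) h s.
Proof.
move=> a0 ab yh.
pose F k : set (Rline R) := `[(a + k.+1%:R^-1)%R, b[%classic.
have UF : \bigcup_k F k = `]a, b[%classic by rewrite /F [RHS]itv_open_bnd_bigcup.
have [] := @lt_integral_nondecreasing_set _ _ _ leb F h y%:E.
- move=> i j ij; apply/subsetPset => x; rewrite /F/= !in_itv/= => /andP[+ ->]; rewrite andbT.
  by apply: le_trans; rewrite lerD2l lef_pV2 ?posrE// ler_nat.
- by move=> k; exact: mitv.
- by rewrite UF; apply: mhs; exact: half_itv.
- by rewrite UF => x tx; apply: h0; move: x tx; exact: half_itv.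
- by rewrite UF.
move=> k yF; pose t : R := Num.min ((a + b) / 2)%R (a + k.+2%:R^-1)%R.
have at_ : (a < t)%R by rewrite lt_min ltrDl invr_gt0 ltr0Sn andbT; lra.
exists t; split.
  by rewrite at_ gt_min; apply/orP; left; lra.
have t0 : (0 < t)%R by exact: le_lt_trans at_.
apply: lt_le_trans yF _.
apply: ge0_subset_integral; [exact: mitv|exact: mitv| | |].
- by apply: mhs; exact: half_itv (ltW _) _.
- by move=> x sx; apply: h0; move: x sx; exact: half_itv (ltW _) _.
- move=> x; rewrite /F/= !in_itv/= => /andP[xk ->]; rewrite andbT; apply: le_trans xk.
  by rewrite ge_min; apply/orP; right; rewrite lerD2l lef_pV2 ?posrE// ler_nat.
Qed.

Lemma primitive_right (y t : R) : (0 < t)%R -> (M t < y)%R ->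
  exists s, (t < s)%R /\ (M s < y)%R.
Proof.
move=> t0 My; have t1 : (t < t + 1)%R by rewrite ltrDl.
have E : \int[leb]_(s in (`]t, (t + 1)%R[%classic : set R)) h s = (M (t + 1) - M t)%:E.
  rewrite -integral_itv_primitive ?(ltW t1)//.
  have lebt : leb [set t] = 0 by exact: lebesgue_measure_set1.
  rewrite [RHS](@ge0_negligible_integral _ _ _ leb _ [set t])//.
  - congr integral; apply/seteqP; split => x /=; rewrite !in_itv/=.
      by move=> /andP[tx ->]; rewrite (ltW tx); split => // xt; move: tx; rewrite xt ltxx.
    by move=> [/andP[tx ->] /eqP xt]; rewrite lt_neqAle eq_sym xt tx.
  - by rewrite -set_itv1; exact: mitv.
  - by apply: mhs; exact: half_itv (ltW _) _.
  - by move=> x sx; apply: h0; move: x sx; exact: half_itv (ltW _) _.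
(* [M s < y] means that the integral over [s, t + 1[ exceeds M (t + 1) - y. The integral over ]t, t
   + 1[ exceeds it because [M t < y], and some such [s] already suffices. *)
have [|s [/andP[ts st]]] := @integral_open_right t (t + 1) (M (t + 1) - y) (ltW t0) t1.
  by rewrite E lte_fin ltrD2l ltrN2.
rewrite integral_itv_primitive ?(lt_trans t0)// ?(ltW st)// lte_fin ltrD2l ltrN2 => My'.
by exists s.
Qed.

Lemma primitive_small (y : R) : (0 < y)%R -> exists s, (0 < s)%R /\ (M s < y)%R.
Proof.
move=> y0; have [|s [/andP[s0 s1]]] := @integral_open_right 0 1 (M 1 - y) (lexx _) ltr01.
  by rewrite primitiveE// lte_fin gtrBl.
rewrite integral_itv_primitive ?(ltW s1)// lte_fin ltrD2l ltrN2 => My.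
by exists s.
Qed.

(** At the supremum of the points where M is at most [y], a value above [y] contradicts left
    continuity and a value below it contradicts right continuity. *)
Lemma primitive_ivt (y T : R) : (0 < T)%R -> (0 < y < M T)%R ->
  exists t, (0 < t < T)%R /\ M t = y.
Proof.
move=> T0 /andP[y0 yT].
pose S := [set t : R | (0 < t)%R /\ (M t <= y)%R].
have [s [s0 Ms]] := primitive_small y0.
have ST t : S t -> (t < T)%R.
  by move=> [t0 Mt]; apply: primitive_lt => //; exact: le_lt_trans yT.
have supS : has_sup S.
  by split; [exists s; split => //; exact: ltW|exists T => t /ST /ltW].
have t0 : (0 < sup S)%R.
  by apply: (lt_le_trans s0); apply: ub_le_sup; [exact: supS.2|split => //; exact: ltW].
have Mt : M (sup S) = y.
  apply/eqP; rewrite eq_le; apply/andP; split.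
    rewrite leNgt; apply/negP => /(primitive_left t0)[b [/andP[b0 bS] yb]].
    have : (sup S <= b)%R.
      apply: ge_sup; first exact: supS.1.
      move=> t [t0' Mt]; apply/ltW; apply: primitive_lt => //; exact: le_lt_trans yb.
    by rewrite leNgt bS.
  rewrite leNgt; apply/negP => /(primitive_right t0)[b [Sb My]].
  have : (b <= sup S)%R.
    by apply: ub_le_sup; [exact: supS.2|split; [exact: lt_trans Sb|exact: ltW]].
  by rewrite leNgt Sb.
exists (sup S); split => //; rewrite t0/=.
by apply: primitive_lt => //; rewrite Mt.
Qed.

Let exprn_unbounded (r B : R) : (1 < r)%R -> exists k, (B < r ^+ k)%R.
Proof.
move=> r1; have bernoulli k : (1 + k%:R * (r - 1) <= r ^+ k)%R.
  elim: k => [|k ih]; first by rewrite mul0r addr0 expr0.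
  rewrite exprS; apply: (@le_trans _ _ (r * (1 + k%:R * (r - 1)))%R); last first.
    by rewrite ler_wpM2l//; lra.
  have : (0 <= k%:R * (r - 1) * (r - 1))%R by rewrite !mulr_ge0//; lra.
  by rewrite -natr1; lra.
exists (Num.truncn (B / (r - 1))).+1; apply: lt_le_trans (bernoulli _).
have x0 : (0 < r - 1)%R by lra.
have := truncnS_gt (B / (r - 1))%R; rewrite ltr_pdivrMr//; lra.
Qed.

Lemma primitive_geometric (T r : R) : (0 < T)%R -> (1 < r)%R ->
  exists t : nat -> R, [/\ t 0%N = T, (forall k, 0 < t k)%R,
    (forall k, t k.+1 < t k)%R, (forall k, M (t k) = M T / r ^+ k)%R &
    forall e, (0 < e)%R -> exists k, (t k < e)%R].
Proof.
move=> T0 r1; have r0 : (0 < r)%R by exact: lt_trans r1.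
have MT := primitive_gt0 T0.
(* M may be constant on intervals, so [M t = M T] would not pin down the first radius; the last
   clause does. *)
have /choice[t tP] : forall k, exists t, (0 < t)%R /\ M t = (M T / r ^+ k)%R /\ (k = 0%N -> t = T).
  case=> [|k]; first by exists T; rewrite expr0 divr1.
  have [|s [/andP[s0 _] Ms]] := @primitive_ivt (M T / r ^+ k.+1)%R T T0.
    rewrite divr_gt0 ?exprn_gt0//= ltr_pdivrMr ?exprn_gt0// ltr_pMr//.
    exact: exprn_egt1.
  by exists s.
exists t; split.
- by have [_ [_]] := tP 0%N; apply.
- by move=> k; case: (tP k).
- move=> k; have [tk [Mk _]] := tP k; have [tk1 [Mk1 _]] := tP k.+1.
  apply: primitive_lt => //; rewrite Mk Mk1 ltr_pM2l// ltf_pV2 ?posrE ?exprn_gt0//.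
  by rewrite exprS ltr_pMl// exprn_gt0.
- by move=> k; case: (tP k) => _ [].
- move=> e e0; have [k rk] := exprn_unbounded (M T / M e)%R r1.
  exists k; have [tk [Mk _]] := tP k; apply: primitive_lt => //; rewrite Mk.
  by rewrite ltr_pdivrMr ?exprn_gt0// mulrC -ltr_pdivrMr// primitive_gt0.
Qed.

End primitive.

(** * The Stieltjes measure of a power of the primitive *)

Section neg_pow_measure.
Context (R : realType) (theta q : R).
Hypotheses (theta0 : (0 < theta)%R) (q0 : (0 < q)%R) (qtheta : (q < theta)%R).
Local Notation leb := (@completed_lebesgue_measure R).
Variable omega : Rline R -> \bar R.
Hypothesis homega : cOmega theta%:E omega.
Local Notation h := (fun t => `|omega t| `^ theta).
Local Notation M := (primitive h).
Local Notation r := ((q^-1 - theta^-1)^-1)%R.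

Lemma cOmega_measurable : measurable_fun half_line h.
Proof.
apply: (measurableT_comp (measurable_poweR _)); apply: measurableT_comp => //.
exact: homega.1.1.
Qed.

Lemma cOmega_ge0 t : half_line t -> 0 <= h t.
Proof. by move=> _; exact: poweR_ge0. Qed.

Lemma cOmega_integral (t : R) : (0 < t)%R ->
  0 < \int[leb]_(s in (`]0%R, t[%classic : set R)) h s < +oo.
Proof.
move=> t0; have := homega.2 _ t0.
rewrite norm_onE//; last exact: measurable_Rline_itv.
set I := integral _ _ _ => /andP[I0 Ioo].
have Ige : 0 <= I by apply: integral_ge0 => x _; exact: poweR_ge0.
apply/andP; split; first by apply: (@gt0_poweR _ _ theta^-1); rewrite ?invr_gt0.
by apply: (@lty_poweRy _ _ theta^-1); rewrite ?invr_eq0 ?gt_eqF.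
Qed.

Let hprim := (primitiveE cOmega_integral).

Lemma cOmega_norm (t : R) : (0 < t)%R ->
  norm_on leb theta%:E `]0%R, t[ omega = (M t `^ theta^-1)%:E.
Proof.
move=> t0; rewrite norm_onE//; last exact: measurable_Rline_itv.
by rewrite hprim.
Qed.

Lemma neg_powE (t : R) : (0 < t)%R ->
  neg_pow theta q omega t = (- M t `^ (- (r / theta)))%R.
Proof.
move=> t0; rewrite /neg_pow cOmega_norm// exp_to_lt//= -powRrM; congr (- (_ `^ _))%R.
by rewrite mulrN mulrC.
Qed.

(** The Stieltjes measure of an interval is given by right limits; right continuity of M turns them
    into plain values. *)
Lemma right_lim_neg_pow (t : R) : (0 < t)%R ->
  right_lim (neg_pow theta q omega) t = neg_pow theta q omega t.
Proof.
move=> t0; have rt0 : (0 < r / theta)%R by rewrite divr_gt0 ?exp_to_pos.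
have nd := neg_pow_nd theta0 q0 homega.
have lb : lbound [set neg_pow theta q omega u | u in `]t, +oo[] (neg_pow theta q omega t).
  move=> _ [u /= + <-]; rewrite in_itv/= andbT => tu.
  by apply: nd; [rewrite in_itv/= t0|rewrite in_itv/= (lt_trans t0)|exact: ltW].
have ne : [set neg_pow theta q omega u | u in `]t, +oo[] !=set0.
  by exists (neg_pow theta q omega (t + 1)), (t + 1)%R; rewrite //= in_itv/= andbT ltrDl.
apply/eqP; rewrite eq_le lb_le_inf// andbT leNgt; apply/negP => tinf.
have hinf u : (t < u)%R -> (right_lim (neg_pow theta q omega) t <= neg_pow theta q omega u)%R.
  move=> tu; apply: ge_inf; first by exists (neg_pow theta q omega t).
  by exists u; rewrite //= in_itv/= andbT.
set z := right_lim _ _ in tinf hinf.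
have z0 : (z < 0)%R.
  apply: le_lt_trans (hinf (t + 1)%R _) _; rewrite ?ltrDl//.
  by rewrite neg_powE ?addr_gt0// oppr_lt0 powR_gt0// primitive_gt0 ?addr_gt0//; exact: cOmega_integral.
have Mt0 := primitive_gt0 cOmega_integral t0.
have Nz0 : (0 < - z)%R by rewrite oppr_gt0.
set rho := (r / theta)%R in rt0 *.
have powNE u : (0 < u)%R -> ((M u `^ (- rho)) `^ rho^-1 = (M u)^-1)%R.
  move=> u0; rewrite -powRrM mulNr mulfV ?gt_eqF// powR_inv1//.
  exact: (ltW (primitive_gt0 cOmega_integral u0)).
(* The level of M at which the distribution function equals [z]. If the right limit [z] exceeded the
   value at [t], then [M t < y], so M would still be below [y] slightly to the right, contradicting
   the infimum. *)
pose y := (((- z) `^ rho^-1)^-1)%R.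
have y0 : (0 < y)%R by rewrite invr_gt0 powR_gt0.
have [|u [tu Mu]] := @primitive_right _ h cOmega_measurable cOmega_ge0 cOmega_integral y t t0.
  rewrite -[ltLHS]invrK ltf_pV2 ?posrE ?powR_gt0 ?invr_gt0// -powNE//.
  apply: gt0_ltr_powR; rewrite ?invr_gt0 ?nnegrE ?powR_ge0 ?(ltW Nz0)//.
  by rewrite ltrNl -neg_powE.
have u0 := lt_trans t0 tu.
have Mu0 := primitive_gt0 cOmega_integral u0.
have : (- z < M u `^ (- rho))%R.
  rewrite ltNge; apply/negP => MuN; move: Mu; apply/negP; rewrite -leNgt.
  rewrite -[leRHS]invrK lef_pV2 ?posrE ?powR_gt0 ?invr_gt0// -powNE//.
  by apply: ge0_ler_powR; rewrite ?invr_ge0 ?nnegrE ?powR_ge0 ?(ltW Nz0)// ltW.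
have := hinf u tu; rewrite neg_powE// -lerN2 opprK => /le_lt_trans/[apply].
by rewrite ltxx.
Qed.

Lemma stieltjes_neg_pow (a b : R) : (0 < a)%R -> (a <= b)%R ->
  stieltjes_measure (neg_pow_nd theta0 q0 homega) `]a, b] =
  (M a `^ (- (r / theta)) - M b `^ (- (r / theta)))%:E.
Proof.
move=> a0 ab; rewrite stieltjes_itvoc// !right_lim_neg_pow ?neg_powE ?(lt_le_trans a0)//.
by rewrite opprK addrC.
Qed.

End neg_pow_measure.

(** * Monotone functions and decompositions into rings *)

Lemma nondecreasing_measurable_ereal (R : realType) (f : R -> \bar R) :
  {homo f : x y / (x <= y)%R >-> x <= y} -> measurable_fun setT f.
Proof.
move=> fnd mT; apply: (measurability _ (ErealGenOInfty.measurableE R)) => //.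
move=> _ [_ [a ->] <-]; rewrite setTI; apply: is_interval_measurable.
move=> x y /= xa _ z /andP[xz _]; move: xa; rewrite !in_itv/= !andbT => xa.
by rewrite (lt_le_trans xa)// fnd.
Qed.

Lemma nonincreasing_measurable_ereal (R : realType) (f : R -> \bar R) :
  {homo f : x y / (x <= y)%R >-> y <= x} -> measurable_fun setT f.
Proof.
move=> fni mT; apply: (measurability _ (ErealGenOInfty.measurableE R)) => //.
move=> _ [_ [a ->] <-]; rewrite setTI; apply: is_interval_measurable.
move=> x y /= _ ya z /andP[_ zy]; move: ya; rewrite !in_itv/= !andbT => ya.
by rewrite (lt_le_trans ya)// fni.
Qed.

Lemma measurable_Rline_id (R : realType) :
  measurable_fun setT (fun t : Rline R => t : R).
Proof. by move=> _ Y mY; rewrite setTI; exact: sub_caratheodory. Qed.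

Lemma trivIset_rings T (B : nat -> set T) : (forall k, B k.+1 `<=` B k) ->
  trivIset setT (fun k => B k `\` B k.+1).
Proof.
move=> Bn; have Bni i j : (i <= j)%N -> B j `<=` B i.
  move=> /subnK <-; elim: (j - i)%N => [//|m ih]; rewrite addSn.
  by apply: subset_trans ih; exact: Bn.
apply/trivIsetP => i j _ _; wlog ij : i j / (i < j)%N.
  move=> H; rewrite neq_ltn => /orP[ij|ji]; first by apply: H => //; rewrite ltn_eqF.
  by rewrite setIC; apply: H => //; rewrite ltn_eqF.
by move=> _; rewrite -subset0 => x [[_ nB] [/(Bni _ _ ij)]].
Qed.

Lemma bigsetU_rings T (B : nat -> set T) (K : nat) : (forall k, B k.+1 `<=` B k) ->
  B 0%N `\` B K = \big[setU/set0]_(k < K) (B k `\` B k.+1).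
Proof.
move=> Bn; have B0 k : B k `<=` B 0%N.
  by elim: k => [//|k ih]; exact: subset_trans (Bn k) ih.
elim: K => [|K ih]; first by rewrite big_ord0 setDv.
rewrite big_ord_recr -ih/=; apply/seteqP; split => x /=.
  by move=> [xB0 nx]; have [xBK|] := pselect (B K x); [right|left].
by move=> [[xB0 nx]|[xBK nx]]; split => //; [move/Bn|exact: B0 xBK].
Qed.

(** * The Hardy-type inequality: sufficiency *)

Section radial_hardy.
Context d (X : measurableType d) (R : realType).
Variable mu : {sigma_finite_measure set X -> \bar R}.
Variables (rho : X -> R) (mrho : measurable_fun setT rho).
Hypothesis rho0 : forall x, (0 <= rho x)%R.
Hypothesis rho_null : mu [set x | rho x = 0%R] = 0.
Variables (P p theta : R) (p0 : (0 < p)%R) (pP : (p <= P)%R) (theta0 : (0 < theta)%R).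
Variables (u : X -> \bar R) (mu_u : measurable_fun setT u).
Local Notation leb := (@completed_lebesgue_measure R).
Variable h : Rline R -> \bar R.
Hypothesis mh : measurable_fun half_line h.
Hypothesis h0 : forall t, half_line t -> 0 <= h t.
Hypothesis hfin : forall t : R, (0 < t)%R ->
  0 < \int[leb]_(s in (`]0%R, t[%classic : set R)) h s < +oo.
Local Notation M := (primitive h).
Local Notation N A := (norm_on mu (exp_to P%:E p%:E) A u).

Let P0 : (0 < P)%R. Proof. exact: lt_le_trans pP. Qed.

Definition rball (t : R) : set X := [set x | (rho x < t)%R].

(** This is G(t)^P, without the root; accordingly [hardy_rhs] has the exponent theta/P and is the
    theta-th power of the source norm. *)
Definition outer_integral (g : X -> \bar R) (t : R) : \bar R :=
  \int[mu]_(x in ~` rball t) `|g x| `^ P.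

Definition hardy_rhs (g : X -> \bar R) : \bar R :=
  \int[leb]_(t in half_line) (outer_integral g t `^ (theta / P) * h t).

Lemma measurable_rball t : measurable (rball t).
Proof.
have := mrho measurableT (measurable_itv `]-oo, t[).
by rewrite setTI; congr measurable; apply/seteqP; split => x /=; rewrite in_itv.
Qed.

Lemma rball_subset s t : (s <= t)%R -> rball s `<=` rball t.
Proof. by move=> st x /lt_le_trans; exact. Qed.

Let mpow := @measurable_abse_poweR _ X R.

Lemma outer_integral_ge0 g t : 0 <= outer_integral g t.
Proof. by apply: integral_ge0 => x _; exact: poweR_ge0. Qed.

Lemma outer_integral_ni g : measurable_fun setT g ->
  {homo outer_integral g : s t / (s <= t)%R >-> t <= s}.
Proof.
move=> mg s t st; apply: ge0_subset_integral.
- by apply: measurableC; exact: measurable_rball.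
- by apply: measurableC; exact: measurable_rball.
- by apply: measurable_funTS; exact: mpow.
- by move=> x _; exact: poweR_ge0.
- by apply: subsetC; exact: rball_subset.
Qed.

Lemma outer_integral_measurable g (q : R) : measurable_fun setT g ->
  measurable_fun half_line (fun t : Rline R => outer_integral g t `^ q).
Proof.
move=> mg; apply: measurable_funTS; apply: (measurableT_comp (measurable_poweR _)).
apply: (@measurableT_comp _ _ _ _ _ _ (outer_integral g : R -> \bar R) _ (fun t : Rline R => t : R)).
  by apply: nonincreasing_measurable_ereal; exact: outer_integral_ni.
exact: measurable_Rline_id.
Qed.

Lemma measurable_half_line : measurable (@half_line R).
Proof. exact: (@measurable_Rline_itv R `]0%R, +oo[). Qed.

Lemma hardy_rhs_ge0 g : 0 <= hardy_rhs g.
Proof. by apply: integral_ge0 => t /h0 ?; rewrite mule_ge0 ?poweR_ge0. Qed.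

Section upper.
Variables (g : X -> \bar R) (mg : measurable_fun setT g).
Hypothesis gfin : forall t : R, (0 < t)%R -> outer_integral g t < +oo.
Hypothesis Nfin : forall t : R, (0 < t)%R -> N (rball t) < +oo.

(* The set {rho = 0}, which no shell meets, is negligible. *)
Lemma integral_le_shells (B : \bar R) : 0 <= B ->
  (forall (T e : R), (0 < e)%R -> (e < T)%R ->
    \int[mu]_(x in rball T `\` rball e) `|g x * u x| `^ p <= B) ->
  \int[mu]_x `|g x * u x| `^ p <= B.
Proof.
move=> B0 HB.
have mgu : measurable_fun setT (fun x => `|g x * u x| `^ p).
  by apply: mpow; exact: emeasurable_funM.
have mnull : measurable [set x | rho x = 0%R].
  have := mrho measurableT (measurable_set1 0%R).
  by rewrite setTI; congr measurable; apply/seteqP; split => x /=.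
rewrite (@ge0_negligible_integral _ _ _ mu _ _ _ mnull)//; last first.
  by move=> x _; exact: poweR_ge0.
pose F k := rball k.+2%:R `\` rball k.+1%:R^-1.
have mF k : measurable (F k) by apply: measurableD; exact: measurable_rball.
have ndF : nondecreasing_seq F.
  move=> i j ij; apply/subsetPset; apply: setDSS; apply: rball_subset.
    by rewrite ler_nat.
  by rewrite lef_pV2 ?posrE// ler_nat.
have -> : setT `\` [set x | rho x = 0%R] = \bigcup_k F k.
  apply/seteqP; split => x /=; last first.
    move=> [k _ [_ /= /negP]]; rewrite -leNgt => kx; split => // x0.
    by move: kx; rewrite x0 leNgt invr_gt0 ltr0Sn.
  move=> [_ /eqP xn0]; have x0 : (0 < rho x)%R by rewrite lt_def xn0 rho0.
  pose k := maxn (Num.truncn (rho x)) (Num.truncn (rho x)^-1).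
  exists k => //; split; rewrite /rball/=.
    apply: lt_le_trans (truncnS_gt _) _.
    by rewrite ler_nat ltnS ltnW// ltnS leq_maxl.
  apply/negP; rewrite -leNgt -[leRHS]invrK lef_pV2 ?posrE ?invr_gt0//.
  apply: le_trans (ltW (truncnS_gt _)) _.
  by rewrite ler_nat ltnS leq_maxr.
apply: (cvge_to_le (ge0_nondecreasing_set_cvg_integral ndF mF _ _)).
- by move=> k; exact: measurable_funTS.
- by move=> k x _; exact: poweR_ge0.
- apply: nearW => k; apply: HB; first by rewrite invr_gt0.
  apply: (@le_lt_trans _ _ 1%R); last by rewrite ltr1n.
  by rewrite invf_le1// ler1n.
Qed.

Variables (t : nat -> R) (T : R).
Hypotheses (t_0 : t 0%N = T) (tpos : forall k, (0 < t k)%R)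
  (tdec : forall k, (t k.+1 < t k)%R) (Mt : forall k, M (t k) = (M T / 2 ^+ k)%R).

(** Ring k lies outside the ball of radius t_(k+1) and inside that of radius t_k: the inner radius
    is used for [g], the outer one for [u]. *)
Let a k : R := fine (outer_integral g (t k.+1)).
Let n k : R := fine (N (rball (t k))).

Let aE k : outer_integral g (t k.+1) = (a k)%:E.
Proof. by rewrite fineK// ge0_fin_numE ?gfin// outer_integral_ge0. Qed.

Let nE k : N (rball (t k)) = (n k)%:E.
Proof. by rewrite fineK// ge0_fin_numE ?Nfin// norm_on_ge0. Qed.

Let a0 k : (0 <= a k)%R. Proof. by rewrite -lee_fin -aE outer_integral_ge0. Qed.

Let n0 k : (0 <= n k)%R. Proof. by rewrite -lee_fin -nE norm_on_ge0. Qed.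

Lemma integral_shell_le_sum (K : nat) :
  \int[mu]_(x in rball T `\` rball (t K)) `|g x * u x| `^ p <=
  (\sum_(k < K) a k `^ (p / P) * n k `^ p)%:E.
Proof.
pose B k := rball (t k).
have Bn k : B k.+1 `<=` B k by apply: rball_subset; exact: ltW.
have mB k : measurable (B k `\` B k.+1) by apply: measurableD; exact: measurable_rball.
have mgu : measurable_fun setT (fun x => `|g x * u x| `^ p).
  by apply: mpow; exact: emeasurable_funM.
rewrite (@integral_sum_pieces _ _ _ _ _ (fun k => B k `\` B k.+1) _ K)//; last 4 first.
- exact: trivIset_rings.
- by rewrite -(bigsetU_rings _ Bn) /B t_0.
- exact: measurable_funTS.
- by move=> x _; exact: poweR_ge0.
rewrite -sumEFin; apply: lee_sum => -[k kK] _ /=.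
apply: le_trans (norm_exp_to_hoelder _ p0 pP mu_u _ mg) _ => //.
rewrite EFinM -!poweR_EFin -nE -aE; apply: lee_pmul; rewrite ?poweR_ge0//.
  apply: le_poweR; first by rewrite divr_ge0// ltW.
    by apply: integral_ge0 => x _; exact: poweR_ge0.
  apply: ge0_subset_integral; [exact: mB|by apply: measurableC; exact: measurable_rball| | |].
  - by apply: measurable_funTS; exact: mpow.
  - by move=> x _; exact: poweR_ge0.
  - by move=> x [].
apply: le_poweR; [exact: ltW|exact: norm_on_ge0|].
by apply: (norm_exp_to_le mu p0 pP mu_u); [exact: mB|exact: measurable_rball|move=> x []].
Qed.

(** The k-th term is charged to [t_(k+2), t_(k+1)[, one step further in than ring k: there the outer
    integral is still at least [a k], and [h] has mass M(t_(k+1)) - M(t_(k+2)) = M(t_k)/4. This is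
    the origin of the 4. *)
Lemma sum_outer_le_hardy_rhs (K : nat) :
  (\sum_(k < K) a k `^ (theta / P) * M (t k))%:E <= 4%:E * hardy_rhs g.
Proof.
pose B k : set (Rline R) := `]0%R, t k.+1[%classic.
have Bn k : B k.+1 `<=` B k.
  by move=> x /=; rewrite /B/= !in_itv/= => /andP[->/=] /lt_trans; apply.
pose F k := B k `\` B k.+1.
have FE k : F k = `[t k.+2, t k.+1[%classic.
  apply/seteqP; split => x /=; rewrite /F /B/= !in_itv/=.
    by move=> [/andP[-> ->] /negP]; rewrite /= -leNgt andbT.
  move=> /andP[tx ->]; rewrite (lt_le_trans (tpos _) tx); split => //.
  by apply/negP; rewrite /= -leNgt.
have IF k : \int[leb]_(s in F k) h s = ((M (t k)) / 4)%:E.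
  rewrite FE integral_itv_primitive//; last exact: ltW.
  by rewrite !Mt; congr EFin; rewrite !exprS; field; rewrite expf_neq0.
have := @sum_le_integral _ _ _ leb half_line F
  (fun t => outer_integral g t `^ (theta / P)) h (fun k => (a k `^ (theta / P))%:E) K
  measurable_half_line.
rewrite -/(hardy_rhs g) => H.
apply: (@le_trans _ _ (4%:E * (\sum_(k < K) (a k `^ (theta / P))%:E * \int[leb]_(s in F k) h s))).
  under [in leRHS]eq_bigr do rewrite IF -EFinM.
  rewrite sumEFin -EFinM lee_fin mulr_sumr le_eqVlt; apply/orP; left; apply/eqP.
  by apply: eq_bigr => k _; field.
apply: lee_wpmul2l => //; apply: H.
- by move=> k; rewrite FE; exact: measurable_Rline_itv.
- exact: trivIset_rings.
- move=> k _ x; rewrite FE /half_line/= !in_itv/= andbT => /andP[tx _].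
  exact: lt_le_trans tx.
- exact: outer_integral_measurable.
- exact: mh.
- by move=> x _; exact: poweR_ge0.
- exact: h0.
- by move=> k; rewrite lee_fin powR_ge0.
- move=> k x _; rewrite FE /= in_itv/= => /andP[_ xt].
  rewrite -poweR_EFin -aE; apply: le_poweR.
  + by rewrite divr_ge0// ltW.
  + exact: outer_integral_ge0.
  + by apply: outer_integral_ni => //; exact: ltW.
Qed.

Lemma shell_bound_le (Q : R) (K : nat) : (theta <= p)%R -> (0 <= Q)%R ->
  (forall s, (0 < s)%R -> N (rball s) <= (Q * M s `^ theta^-1)%:E) ->
  \int[mu]_(x in rball T `\` rball (t K)) `|g x * u x| `^ p <=
  (Q `^ p)%:E * (4%:E * hardy_rhs g) `^ (p / theta).
Proof.
move=> thetap Q0 HQ; apply: le_trans (integral_shell_le_sum K) _.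
have Mpos k : (0 < M (t k))%R by exact: primitive_gt0.
apply: (@le_trans _ _ (Q `^ p * (\sum_(k < K) a k `^ (theta / P) * M (t k)) `^ (p / theta))%:E).
  rewrite lee_fin.
  apply: (@le_trans _ _ (\sum_(k < K) Q `^ p * (a k `^ (theta / P) * M (t k)) `^ (p / theta))%R).
    apply: ler_sum => -[k kK] _ /=.
    rewrite powRM ?powR_ge0 ?(ltW (Mpos k))// -powRrM.
    have -> : (theta / P * (p / theta) = p / P)%R by field; rewrite !gt_eqF.
    rewrite mulrCA ler_wpM2l ?powR_ge0//.
    have -> : (Q `^ p * M (t k) `^ (p / theta) = (Q * M (t k) `^ theta^-1) `^ p)%R.
      by rewrite powRM ?powR_ge0// -powRrM [(theta^-1 * p)%R]mulrC.
    rewrite ge0_ler_powR ?nnegrE ?n0 ?mulr_ge0 ?powR_ge0 ?(ltW p0)//.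
    by rewrite -lee_fin -nE; exact: HQ.
  rewrite -mulr_sumr ler_wpM2l ?powR_ge0//.
  apply: (@powR_sum_le R _ (fun k => a k `^ (theta / P) * M (t k))%R).
    by rewrite ler_pdivlMr// mul1r.
  by move=> k; rewrite mulr_ge0 ?powR_ge0// ltW.
rewrite EFinM lee_wpmul2l ?lee_fin ?powR_ge0// -poweR_EFin.
apply: le_poweR; last exact: sum_outer_le_hardy_rhs.
  by rewrite divr_ge0// ltW.
by rewrite lee_fin; apply: sumr_ge0 => k _; rewrite mulr_ge0 ?powR_ge0// ltW.
Qed.

Lemma shell_bound_gt (r B : R) (K : nat) : (p < theta)%R -> r = ((p^-1 - theta^-1)^-1)%R ->
  (\sum_(k < K) M (t k) `^ (- (r / theta)) * fine (N (rball (t k))) `^ r <= B)%R ->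
  \int[mu]_(x in rball T `\` rball (t K)) `|g x * u x| `^ p <=
  (B `^ (p / r))%:E * (4%:E * hardy_rhs g) `^ (p / theta).
Proof.
move=> ptheta rE HB; apply: le_trans (integral_shell_le_sum K) _.
have r0 : (0 < r)%R by rewrite rE; exact: exp_to_pos.
have Mpos k : (0 < M (t k))%R by exact: primitive_gt0.
pose S := (\sum_(k < K) a k `^ (theta / P) * M (t k))%R.
have pr : (p / theta + p / r = 1)%R by rewrite rE invrK; field; rewrite !gt_eqF.
have S0 : (0 <= S)%R by apply: sumr_ge0 => k _; rewrite mulr_ge0 ?powR_ge0// ltW.
apply: (@le_trans _ _ (S `^ (p / theta) * B `^ (p / r))%:E).
  rewrite lee_fin.
  (* The factor M(t_k)^(p/theta) M(t_k)^(-p/theta) is inserted; the exponents theta/p and r/p are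
     conjugate since p/theta + p/r = 1. *)
  have := @hoelder_sum R (fun k => a k `^ (p / P) * M (t k) `^ (p / theta))%R
    (fun k => M (t k) `^ (- (p / theta)) * n k `^ p)%R (theta / p) (r / p) K.
  rewrite !divr_gt0// !invf_div pr => /(_ isT isT erefl).
  move=> /(_ (fun k => mulr_ge0 (powR_ge0 _ _) (powR_ge0 _ _))).
  move=> /(_ (fun k => mulr_ge0 (powR_ge0 _ _) (powR_ge0 _ _))).
  rewrite [X in (X <= _)%R -> _](_ : _ = \sum_(k < K) a k `^ (p / P) * n k `^ p)%R; last first.
    apply: eq_bigr => k _; rewrite -mulrA [X in (_ * X)%R]mulrA -powRD.
      by rewrite subrr powRr0 mul1r.
    by rewrite (gt_eqF (Mpos k)) implybT.
  move/le_trans; apply; apply: ler_pM; rewrite ?powR_ge0//.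
    rewrite (_ : (\sum_(k < K) _)%R = S)//; apply: eq_bigr => k _.
    rewrite powRM ?powR_ge0// -!powRrM.
    have -> : (p / P * (theta / p) = theta / P)%R by field; rewrite !gt_eqF.
    have -> : (p / theta * (theta / p) = 1)%R by field; rewrite !gt_eqF.
    by rewrite powRr1// ltW.
  rewrite ge0_ler_powR ?nnegrE ?divr_ge0 ?(ltW p0) ?(ltW r0)//.
  - by apply: sumr_ge0 => k _; rewrite powR_ge0.
  - by apply: le_trans HB; apply: sumr_ge0 => k _; rewrite mulr_ge0 ?powR_ge0.
  apply: le_trans HB; rewrite le_eqVlt; apply/orP; left; apply/eqP.
  apply: eq_bigr => k _; rewrite powRM ?powR_ge0// -!powRrM.
  congr (_ `^ _ * _ `^ _)%R; field; rewrite !gt_eqF//.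
rewrite mulrC EFinM lee_wpmul2l ?lee_fin ?powR_ge0// -poweR_EFin.
apply: le_poweR; last exact: sum_outer_le_hardy_rhs.
  by rewrite divr_ge0// ltW.
by rewrite lee_fin.
Qed.

End upper.

Lemma radial_upper_le (Q : R) (g : X -> \bar R) : (theta <= p)%R -> (0 <= Q)%R ->
  measurable_fun setT g -> (forall t : R, (0 < t)%R -> outer_integral g t < +oo) ->
  (forall s, (0 < s)%R -> N (rball s) <= (Q * M s `^ theta^-1)%:E) ->
  \int[mu]_x `|g x * u x| `^ p <= (Q `^ p)%:E * (4%:E * hardy_rhs g) `^ (p / theta).
Proof.
move=> thetap Q0 mg gfin HQ.
have Nfin s : (0 < s)%R -> N (rball s) < +oo by move=> /HQ /le_lt_trans; apply; exact: ltry.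
apply: integral_le_shells => //; first by rewrite mule_ge0 ?lee_fin ?powR_ge0 ?poweR_ge0.
move=> T e e0 eT; have T0 := lt_trans e0 eT.
have [t [t_0 tpos tdec Mt /(_ _ e0)[K tK]]] := primitive_geometric mh h0 hfin T0 (ltr1n R 2).
apply: le_trans (shell_bound_le mg gfin Nfin t_0 tpos tdec Mt K thetap Q0 HQ).
apply: ge0_subset_integral.
- by apply: measurableD; exact: measurable_rball.
- by apply: measurableD; exact: measurable_rball.
- by apply: measurable_funTS; apply: mpow; exact: emeasurable_funM.
- by move=> x _; exact: poweR_ge0.
- by apply: setDS; apply: rball_subset; exact: ltW.
Qed.

Lemma radial_upper_gt (r B : R) (g : X -> \bar R) : (p < theta)%R ->
  r = ((p^-1 - theta^-1)^-1)%R ->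
  measurable_fun setT g -> (forall t : R, (0 < t)%R -> outer_integral g t < +oo) ->
  (forall s, (0 < s)%R -> N (rball s) < +oo) ->
  (forall (t : nat -> R) (K : nat), (forall k, 0 < t k)%R -> (forall k, t k.+1 < t k)%R ->
    (forall k, M (t k) = M (t 0%N) / 2 ^+ k)%R ->
    (\sum_(k < K) M (t k) `^ (- (r / theta)) * fine (N (rball (t k))) `^ r <= B)%R) ->
  \int[mu]_x `|g x * u x| `^ p <=
  (B `^ (p / r))%:E * (4%:E * hardy_rhs g) `^ (p / theta).
Proof.
move=> ptheta rE mg gfin Nfin HB.
apply: integral_le_shells => //; first by rewrite mule_ge0 ?lee_fin ?powR_ge0 ?poweR_ge0.
move=> T e e0 eT; have T0 := lt_trans e0 eT.
have [t [t_0 tpos tdec Mt /(_ _ e0)[K tK]]] := primitive_geometric mh h0 hfin T0 (ltr1n R 2).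
have HBt : (\sum_(k < K) M (t k) `^ (- (r / theta)) * fine (N (rball (t k))) `^ r <= B)%R.
  by apply: HB => //; rewrite t_0.
apply: le_trans (shell_bound_gt mg gfin Nfin t_0 tpos tdec Mt ptheta rE HBt).
apply: ge0_subset_integral.
- by apply: measurableD; exact: measurable_rball.
- by apply: measurableD; exact: measurable_rball.
- by apply: measurable_funTS; apply: mpow; exact: emeasurable_funM.
- by move=> x _; exact: poweR_ge0.
- by apply: setDS; apply: rball_subset; exact: ltW.
Qed.

(** * The Hardy-type inequality: necessity *)

Lemma hardy_rhs_support (g : X -> \bar R) (T : R) : measurable_fun setT g ->
  (forall x, ~ rball T x -> g x = 0) ->
  hardy_rhs g = \int[leb]_(s in (`]0%R, T[%classic : set (Rline R)))
    (outer_integral g s `^ (theta / P) * h s).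
Proof.
move=> mg gT; rewrite /hardy_rhs.
have -> : (`]0%R, T[%classic : set (Rline R)) = half_line `&` `]0%R, T[.
  apply/seteqP; split => x; rewrite /half_line/= !in_itv/= andbT; last by case.
  by move=> /andP[-> ->].
rewrite integral_mkcondr; apply: eq_integral => s; rewrite inE /half_line/= in_itv/= andbT => s0.
rewrite patchE; case: ifPn => //; rewrite notin_setE/= in_itv/= s0/= => /negP sT.
rewrite (_ : outer_integral g s = 0) ?poweR0r ?mul0e ?gt_eqF ?divr_gt0//.
apply: integral0_eq => x /= xs; rewrite gT ?abse0 ?poweR0r ?gt_eqF//.
have Ts : (T <= s)%R by rewrite leNgt.
by apply: contra_not xs => /(rball_subset Ts).
Qed.

Section lower.
Variables (c : R) (c0 : (0 <= c)%R).
Hypothesis Hc : forall g : X -> R, measurable_fun setT g -> (forall x, 0 <= g x)%R ->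
  \int[mu]_x ((g x)%:E `^ P) < +oo -> hardy_rhs (EFin \o g) < +oo ->
  \int[mu]_x (((g x)%:E * `|u x|) `^ p) <=
    (c `^ p)%:E * hardy_rhs (EFin \o g) `^ (p / theta).

(** Test with one nearly extremal function on the ball of radius t: its outer integral is at most 1
    and vanishes beyond [t], so [hardy_rhs] is at most [M t]. *)
Lemma radial_lower (t : R) : (0 < t)%R -> N (rball t) <= (c * M t `^ theta^-1)%:E.
Proof.
move=> t0; set y := (c * _)%R.
have y0 : (0 <= y)%R by rewrite mulr_ge0 ?powR_ge0.
(* Saturation needs a finite level strictly below the norm, and the norm might still be infinite; so
   each level is bounded on its own. *)
have Hy (z : R) : (0 <= z)%R -> z%:E < N (rball t) -> (z <= y)%R.
  move=> z0 zN.
  have [g [mg g0 gout gP gV]] :=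
    norm_exp_to_saturate p0 pP mu_u (measurable_rball t) z0 zN.
  have mg' : measurable_fun setT (EFin \o g) by exact/measurable_EFinP.
  have W : hardy_rhs (EFin \o g) <= (M t)%:E.
    rewrite (@hardy_rhs_support _ t)//; last by move=> x /gout /= ->.
    rewrite -primitiveE//; have St : `]0%R, t[%classic `<=` @half_line R.
      by move=> x /=; rewrite /half_line/= !in_itv/= andbT => /andP[].
    apply: ge0_le_integral.
    - exact: measurable_Rline_itv.
    - by move=> s /St /h0 ?; rewrite mule_ge0 ?poweR_ge0.
    - apply: emeasurable_funM.
        apply: measurable_funS (outer_integral_measurable _ mg') => //.
        exact: measurable_half_line.
      by apply: measurable_funS mh => //; exact: measurable_half_line.
    - by apply: measurable_funS mh => //; exact: measurable_half_line.
    move=> s /St /h0 hs; rewrite -[leRHS]mul1e lee_wpmul2r//.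
    rewrite -(poweR1r (theta / P)); apply: le_poweR.
    + by rewrite divr_ge0// ltW.
    + exact: outer_integral_ge0.
    apply: le_trans gP; rewrite /outer_integral.
    rewrite (eq_integral (fun x => (g x)%:E `^ P)); last first.
      by move=> x _; rewrite gee0_abs// lee_fin.
    apply: ge0_subset_integral => //.
    - by apply: measurableC; exact: measurable_rball.
    - exact: (measurableT_comp (measurable_poweR _)).
    - by move=> x _; exact: poweR_ge0.
  have := Hc mg g0 (le_lt_trans gP (ltry _)) (le_lt_trans W (ltry _)).
  move=> /(le_trans gV) H.
  rewrite leNgt; apply/negP => yz.
  have : (z `^ p <= y `^ p)%R.
    rewrite -lee_fin; apply: le_trans H _.
    rewrite /y powRM ?powR_ge0// EFinM lee_wpmul2l ?lee_fin ?powR_ge0//.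
    rewrite -powRrM [(theta^-1 * p)%R]mulrC -poweR_EFin; apply: le_poweR => //.
      by rewrite divr_ge0// ltW.
    exact: hardy_rhs_ge0.
  by rewrite leNgt gt0_ltr_powR// ?nnegrE.
rewrite leNgt; apply/negP => yN.
case E : (N (rball t)) Hy yN => [n| |] // Hy yN.
  rewrite lte_fin in yN.
  have : ((y + n) / 2 <= y)%R by apply: Hy; [lra|rewrite lte_fin; lra].
  by lra.
by have := Hy (y + 1)%R; rewrite addr_ge0// ltry => /(_ isT isT); lra.
Qed.


(** * Test functions layered over the rings *)

Section layers.
Variables (t : nat -> R) (K : nat).
Hypotheses (tpos : forall k, (0 < t k)%R) (tdec : forall k, (t k.+1 < t k)%R).

Let ring k := rball (t k) `\` rball (t k.+1).

Let tle i j : (i <= j)%N -> (t j <= t i)%R.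
Proof.
move=> /subnK <-; elim: (j - i)%N => [//|m ih]; rewrite addSn.
by apply: le_trans ih; exact: ltW.
Qed.

Let mring k : measurable (ring k).
Proof. by apply: measurableD; exact: measurable_rball. Qed.

Let tring : trivIset setT ring.
Proof. by apply: trivIset_rings => k; apply: rball_subset; exact: ltW. Qed.

Variables (gk : nat -> X -> R) (a : nat -> R).
Hypotheses (mgk : forall k, measurable_fun setT (gk k))
  (gk0 : forall k x, (0 <= gk k x)%R)
  (gkout : forall k x, ~ ring k x -> gk k x = 0%R)
  (gkP : forall k, \int[mu]_x ((gk k x)%:E `^ P) <= 1)
  (a0 : forall k, (0 <= a k)%R).

Definition layered x : R := (\sum_(k < K) a k * gk k x)%R.

Let layered0 x : (0 <= layered x)%R.
Proof. by apply: sumr_ge0 => k _; rewrite mulr_ge0. Qed.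

Let mlayered : measurable_fun setT layered.
Proof.
by apply: measurable_sum => k; apply: measurable_funM => //; exact: measurable_cst.
Qed.

Lemma layered_ring k x : (k < K)%N -> ring k x -> layered x = (a k * gk k x)%R.
Proof.
move=> kK kx; rewrite /layered (bigD1 (Ordinal kK))//= big1 ?addr0// => j jk.
rewrite gkout ?mulr0// => jx; move/trivIsetP : tring => /(_ j k I I) H.
have : (ring j `&` ring k) x by split.
by rewrite H//; apply: contra_neq jk => jk; exact/val_inj.
Qed.

Lemma layered_out x : (forall k, (k < K)%N -> ~ ring k x) -> layered x = 0%R.
Proof.
by move=> nx; rewrite /layered big1// => k _; rewrite gkout ?mulr0//; exact: nx.
Qed.

(** Bounds the outer integral at every radius from t_(k+1) on, since only layers 0 to k reach
    outside that ball and each has norm at most 1. Once [K <= k] all layers are counted and the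
    radius is arbitrary, hence the disjunctions below. *)
Let H k : R := (\sum_(j < k.+1) a j `^ P)%R.

Let layered_le k x : (~ rball (t k.+1) x \/ (K <= k)%N) ->
  (layered x)%:E `^ P <= \sum_(j < k.+1) (a j `^ P)%:E * (gk j x)%:E `^ P.
Proof.
move=> Hk.
have S0 : 0 <= \sum_(j < k.+1) (a j `^ P)%:E * (gk j x)%:E `^ P.
  by apply: sume_ge0 => j _; rewrite mule_ge0 ?poweR_ge0// lee_fin powR_ge0.
have [[j [jK jx]]|nx] := pselect (exists j, (j < K)%N /\ ring j x); last first.
  rewrite layered_out ?poweR0r ?gt_eqF// => j jK jx; apply: nx; by exists j.
rewrite (layered_ring jK jx).
have jk : (j < k.+1)%N.
  case: Hk => [nx|Kk]; last by rewrite ltnS (leq_trans (ltnW jK)).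
  rewrite ltnNge; apply/negP => kj; apply: nx; apply: (rball_subset (tle kj)).
  by case: jx.
rewrite (bigD1 (Ordinal jk))//= powRM// EFinM leeDl//.
by apply: sume_ge0 => i _; rewrite mule_ge0 ?lee_fin ?powR_ge0.
Qed.

Let outer_layered k s : ((t k.+1 <= s)%R \/ (K <= k)%N) ->
  outer_integral (EFin \o layered) s <= (H k)%:E.
Proof.
move=> Hk; rewrite /outer_integral.
have mS : measurable_fun setT (fun x => \sum_(j < k.+1) (a j `^ P)%:E * (gk j x)%:E `^ P).
  apply: emeasurable_sum => j; apply: emeasurable_funM; first exact: measurable_cst.
  by apply: (measurableT_comp (measurable_poweR _)); exact/measurable_EFinP.
have S0 x : 0 <= \sum_(j < k.+1) (a j `^ P)%:E * (gk j x)%:E `^ P.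
  by apply: sume_ge0 => j _; rewrite mule_ge0 ?poweR_ge0// lee_fin powR_ge0.
have mC : measurable (~` rball s) by apply: measurableC; exact: measurable_rball.
apply: (@le_trans _ _ (\int[mu]_(x in ~` rball s) \sum_(j < k.+1) (a j `^ P)%:E * (gk j x)%:E `^ P)).
  apply: ge0_le_integral => //.
  - by move=> x _; exact: poweR_ge0.
  - by apply: measurable_funTS; apply: mpow; exact/measurable_EFinP.
  - exact: measurable_funTS.
  move=> x nx; rewrite gee0_abs ?lee_fin//; apply: layered_le.
  by case: Hk => [ts|]; [left=> /(rball_subset ts)/nx|right].
apply: (@le_trans _ _ (\int[mu]_x \sum_(j < k.+1) (a j `^ P)%:E * (gk j x)%:E `^ P)).
  exact: ge0_subset_integral.
rewrite ge0_integral_sum//; last 2 first.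
- move=> j; apply: emeasurable_funM; first exact: measurable_cst.
  by apply: (measurableT_comp (measurable_poweR _)); exact/measurable_EFinP.
- by move=> j x _; rewrite mule_ge0 ?poweR_ge0// lee_fin powR_ge0.
rewrite -sumEFin; apply: lee_sum => j _.
rewrite ge0_integralZl//; last 3 first.
- by apply: (measurableT_comp (measurable_poweR _)); exact/measurable_EFinP.
- by move=> x _; exact: poweR_ge0.
- by rewrite lee_fin powR_ge0.
by rewrite -[leRHS]mule1 lee_wpmul2l ?lee_fin ?powR_ge0.
Qed.

Lemma hardy_rhs_layered : hardy_rhs (EFin \o layered) <=
  (\sum_(k < K.+1) H k `^ (theta / P) * M (t k))%:E.
Proof.
have ml : measurable_fun setT (EFin \o layered) by exact/measurable_EFinP.
rewrite (@hardy_rhs_support _ (t 0%N))//; last first.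
  move=> x nx /=; rewrite layered_out// => k kK [kx _]; apply: nx.
  exact: rball_subset (tle (leq0n k)) _ kx.
(* Emptying [B] beyond K makes the last piece all of ]0, t_K[, so that K + 1 pieces tile ]0,
   t_0[. *)
pose B k : set (Rline R) := if (k <= K)%N then `]0%R, t k[%classic else set0.
have Bn k : B k.+1 `<=` B k.
  rewrite /B; case: ifPn => [kK|_]; last exact: sub0set.
  by rewrite ltnW// => x /=; rewrite !in_itv/= => /andP[->/=] /lt_trans; apply.
pose F k := B k `\` B k.+1.
have mB k : measurable (B k) by rewrite /B; case: ifPn => _ //; exact: measurable_Rline_itv.
have FB k : (k <= K)%N -> F k `<=` `]0%R, t k[%classic by rewrite /F /B => -> x [].
have St k : `]0%R, t k[%classic `<=` @half_line R.
  by move=> x /=; rewrite /half_line/= !in_itv/= andbT => /andP[].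
have mhk k : measurable_fun (`]0%R, t k[%classic : set (Rline R)) h.
  by apply: measurable_funS mh => //; exact: measurable_half_line.
have H0 k : (0 <= H k)%R by apply: sumr_ge0 => j _; exact: powR_ge0.
have := @integral_le_sum _ _ _ leb `]0%R, t 0%N[%classic F
  (fun s => outer_integral (EFin \o layered) s `^ (theta / P)) h
  (fun k => (H k `^ (theta / P))%:E) K.+1.
move=> /(_ (fun k => measurableD (mB _) (mB _)) (trivIset_rings Bn)) H1.
apply: (@le_trans _ _ (\sum_(k < K.+1) (H k `^ (theta / P))%:E * \int[leb]_(s in F k) h s)).
  apply: H1.
  - by rewrite -bigsetU_rings// /B leq0n ltnn setD0.
  - by apply: measurable_funS (outer_integral_measurable _ ml) => //; exact: measurable_half_line.
  - exact: mhk.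
  - by move=> s _; exact: poweR_ge0.
  - by move=> s /St; exact: h0.
  - by move=> k; rewrite lee_fin powR_ge0.
  move=> k s kK Fs; rewrite -poweR_EFin; apply: le_poweR.
  + by rewrite divr_ge0// ltW.
  + exact: outer_integral_ge0.
  apply: outer_layered; move: Fs; rewrite /F /B -ltnS kK.
  case: ifPn => [kK' [/= /[1!in_itv]/= /andP[s0 _] /negP]|]; last by rewrite -leqNgt; right.
  by rewrite in_itv/= s0/= -leNgt; left.
rewrite -sumEFin; apply: lee_sum => -[k kK] _ /=.
rewrite EFinM lee_wpmul2l ?lee_fin ?powR_ge0//.
rewrite -(primitiveE hfin)//; apply: ge0_subset_integral.
- exact: measurableD.
- exact: measurable_Rline_itv.
- exact: mhk.
- by move=> s /St; exact: h0.
- exact: FB.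
Qed.

Lemma layered_integral : \int[mu]_x ((layered x)%:E `^ P) < +oo.
Proof.
apply: le_lt_trans (ltry (H K)).
(* The ball of radius 0 is empty, so the outer integral at 0 is the full one. *)
apply: le_trans (@outer_layered K 0%R (or_intror (leqnn K))).
rewrite /outer_integral (_ : ~` rball 0 = setT).
  by rewrite le_eqVlt; apply/orP; left; apply/eqP/eq_integral => x _; rewrite gee0_abs ?lee_fin.
by rewrite -setC0; congr (~` _); rewrite -subset0 => x; rewrite /rball/= ltNge rho0.
Qed.

Lemma layered_lower (y : nat -> R) : (forall k, 0 <= y k)%R ->
  (forall k, (y k `^ p)%:E <= \int[mu]_x (((gk k x)%:E * `|u x|) `^ p)) ->
  (\sum_(k < K) (a k * y k) `^ p)%:E <= \int[mu]_x (((layered x)%:E * `|u x|) `^ p).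
Proof.
move=> y0 yg.
have mF (f : X -> R) : measurable_fun setT f -> measurable_fun setT (fun x => ((f x)%:E * `|u x|) `^ p).
  move=> mf; apply: (measurableT_comp (measurable_poweR _)).
  by apply: emeasurable_funM; [exact/measurable_EFinP|exact: measurableT_comp].
apply: (@le_trans _ _ (\int[mu]_(x in \big[setU/set0]_(k < K) ring k) (((layered x)%:E * `|u x|) `^ p))); last first.
  apply: ge0_subset_integral => //; first exact: bigsetU_measurable.
    exact: mF.
  by move=> x _; exact: poweR_ge0.
rewrite (integral_sum_pieces mu mring tring erefl); last 2 first.
- by apply: measurable_funTS; exact: mF.
- by move=> x _; exact: poweR_ge0.
rewrite -sumEFin; apply: lee_sum => -[k kK] _ /=.
rewrite (eq_integral (fun x => (a k `^ p)%:E * ((gk k x)%:E * `|u x|) `^ p)); last first.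
  move=> x; rewrite inE => /(layered_ring kK) ->.
  by rewrite -poweR_EFin -poweRM ?lee_fin ?mule_ge0 ?lee_fin// EFinM muleA.
rewrite ge0_integralZl//; last 3 first.
- by apply: measurable_funTS; exact: mF.
- by move=> x _; exact: poweR_ge0.
- by rewrite lee_fin powR_ge0.
rewrite powRM// EFinM lee_wpmul2l ?lee_fin ?powR_ge0//; apply: le_trans (yg k) _.
rewrite [leRHS]integral_mkcond le_eqVlt; apply/orP; left; apply/eqP/eq_integral => x _.
rewrite patchE; case: ifPn => //; rewrite notin_setE => /gkout ->.
by rewrite mul0e poweR0r// gt_eqF.
Qed.

End layers.

Section geometric_layers.
Variables (t : nat -> R) (q r : R) (K : nat).
Hypotheses (ptheta : (p < theta)%R) (rE : r = ((p^-1 - theta^-1)^-1)%R).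
Hypotheses (q1 : (1 < q)%R) (q_growth : (2 `^ (theta / P) / q <= 2^-1)%R)
  (q_decay : (2 `^ (r * (p^-1 - P^-1)) * q `^ (- (r / theta)) <= 2^-1)%R).
Hypotheses (tpos : forall k, (0 < t k)%R)
  (tdec : forall k, (t k.+1 < t k)%R) (Mt : forall k, M (t k) = (M (t 0%N) / q ^+ k)%R).

Let ring k := rball (t k) `\` rball (t k.+1).
Let n k : R := fine (N (rball (t k))).
Let v k : R := fine (N (ring k)).

Let r0 : (0 < r)%R. Proof. by rewrite rE; exact: exp_to_pos. Qed.

Let prE : (p / theta + p / r = 1)%R.
Proof. by rewrite rE invrK; field; rewrite !gt_eqF. Qed.

Let mring k : measurable (ring k).
Proof. by apply: measurableD; exact: measurable_rball. Qed.

Let Mpos k : (0 < M (t k))%R. Proof. exact: primitive_gt0. Qed.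

Let nE k : N (rball (t k)) = (n k)%:E.
Proof.
rewrite fineK// ge0_fin_numE ?norm_on_ge0//.
exact: le_lt_trans (radial_lower (tpos k)) (ltry _).
Qed.

Let vle k : N (ring k) <= N (rball (t k)).
Proof.
by apply: (norm_exp_to_le mu p0 pP mu_u); [exact: mring|exact: measurable_rball|move=> x []].
Qed.

Let vE k : N (ring k) = (v k)%:E.
Proof.
rewrite fineK// ge0_fin_numE ?norm_on_ge0//.
by apply: le_lt_trans (vle k) _; rewrite nE ltry.
Qed.

Let n0 k : (0 <= n k)%R. Proof. by rewrite -lee_fin -nE norm_on_ge0. Qed.
Let v0 k : (0 <= v k)%R. Proof. by rewrite -lee_fin -vE norm_on_ge0. Qed.

(** The coefficients satisfy M a^theta = b = (a v/2)^p, the equality case of Hoelder for sums. Up to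
    constants, both sides of the tested inequality are then powers of the single sum [S], and S <=
    c^p (D S)^(p/theta) can be solved for [S]. *)
Lemma sum_rings_le :
  (\sum_(k < K) M (t k) `^ (- (r / theta)) * v k `^ r <=
   2 `^ r * ((2 * 2 `^ (theta / P)) `^ (r / theta) * c `^ r))%R.
Proof.
have /choice[gk gkP] : forall k, exists g : X -> R, [/\ measurable_fun setT g,
    (forall x, 0 <= g x)%R, (forall x, ~ ring k x -> g x = 0%R),
    \int[mu]_x ((g x)%:E `^ P) <= 1 &
    ((v k / 2) `^ p)%:E <= \int[mu]_x (((g x)%:E * `|u x|) `^ p)].
  (* Half the norm is a level strictly below it, unless the norm is 0; then the zero function
     serves. *)
  move=> k; have [vk0|vk0] := eqVneq (v k) 0%R.
    exists (fun=> 0%R); split => //.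
    - under eq_integral do rewrite poweR0r ?gt_eqF//.
      by rewrite integral0.
    - rewrite vk0 mul0r powR0 ?gt_eqF//.
      by apply: integral_ge0 => x _; exact: poweR_ge0.
  have vk : (0 < v k)%R by rewrite lt_def vk0 v0.
  have v2 : (v k / 2)%:E < N (ring k) by rewrite vE lte_fin; lra.
  by apply: (norm_exp_to_saturate p0 pP mu_u (mring k) _ v2); rewrite divr_ge0// ltW.
pose b k := (M (t k) `^ (- (r / theta)) * (v k / 2) `^ r)%R.
have b0 k : (0 <= b k)%R by rewrite mulr_ge0 ?powR_ge0.
pose a k := (if (k < K)%N then (b k / M (t k)) `^ theta^-1 else 0)%R.
have a0 k : (0 <= a k)%R by rewrite /a; case: ifPn => // _; exact: powR_ge0.
have aK k : (K <= k)%N -> a k = 0%R by rewrite /a ltnNge => ->.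
have aM k : (k < K)%N -> (M (t k) * a k `^ theta = b k)%R.
  move=> kK; rewrite /a kK -powRrM mulVf ?gt_eqF// powRr1 ?divr_ge0 ?(ltW (Mpos k))//.
  by rewrite mulrCA divff ?mulr1// gt_eqF.
pose S := (\sum_(k < K) b k)%R.
have S0 : (0 <= S)%R by exact: sumr_ge0.
pose gl := layered K gk a.
have mgk k : measurable_fun setT (gk k) by case: (gkP k).
have gk0 k x : (0 <= gk k x)%R by case: (gkP k).
have gkout k x : ~ ring k x -> gk k x = 0%R by case: (gkP k) => _ _ + _ _; apply.
have gkPP k : \int[mu]_x ((gk k x)%:E `^ P) <= 1 by case: (gkP k).
have mgl : measurable_fun setT gl.
  by apply: measurable_sum => k; apply: measurable_funM => //; exact: measurable_cst.
have gl0 x : (0 <= gl x)%R by apply: sumr_ge0 => k _; rewrite mulr_ge0.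
have W : hardy_rhs (EFin \o gl) <= (2 * 2 `^ (theta / P) * S)%:E.
  apply: le_trans (hardy_rhs_layered K tpos tdec mgk gk0 gkout gkPP a0) _.
  rewrite lee_fin.
  pose H k : R := (\sum_(j < k.+1) a j `^ P)%R.
  have H0 k : (0 <= H k)%R by apply: sumr_ge0 => j _; exact: powR_ge0.
  have tP0 : (0 <= theta / P)%R by rewrite divr_ge0// ltW.
  have aPtheta k : ((a k `^ P) `^ (theta / P) = a k `^ theta)%R.
    by rewrite -powRrM mulrCA divff ?mulr1// gt_eqF.
  have two1 : (1 <= 2 `^ (theta / P) :> R)%R.
    by rewrite -[leLHS](powRr0 (2 : R)) ler_powR// ler1n.
  (* H_(k+1)^(theta/P) is at most 2^(theta/P) times the sum of H_k^(theta/P) and a_(k+1)^theta. As M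
     drops by the factor [q], [q_growth] makes the old part at most half of the previous term. *)
  have := @sum_absorb_prev R (fun k => M (t k) * H k `^ (theta / P))%R
    (fun k => 2 `^ (theta / P) * (M (t k) * a k `^ theta))%R K.
  move=> /(_ (fun k => mulr_ge0 (ltW (Mpos k)) (powR_ge0 _ _))) abs.
  rewrite (eq_bigr (fun k : 'I_K.+1 => M (t k) * H k `^ (theta / P))%R); last first.
    by move=> k _; rewrite mulrC.
  apply: le_trans (abs _ _) _.
  - rewrite /H big_ord1 aPtheta ler_peMl// mulr_ge0 ?powR_ge0// ltW//.
  - move=> k; rewrite /H big_ord_recr/= -/(H k).
    apply: (@le_trans _ _ (M (t k.+1) * (2 `^ (theta / P) * (H k `^ (theta / P) + a k.+1 `^ theta))))%R.
      by rewrite ler_wpM2l ?(ltW (Mpos _))// -aPtheta powRD_le// powR_ge0.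
    rewrite mulrDr mulrDr addrC lerD//; first by rewrite mulrCA.
    have -> : M (t k.+1) = (M (t k) / q)%R by rewrite (Mt k.+1) (Mt k) exprSr invfM mulrA.
    have aux (m e z : R) : (m / q * (e * z) = m * z * (e / q))%R by ring.
    rewrite aux.
    by rewrite ler_wpM2l// mulr_ge0 ?powR_ge0// ltW.
  rewrite -mulr_sumr -mulrA !ler_wpM2l ?powR_ge0//.
  (* The extra term comes from ]0, t_K[, which carries no new layer: [a K] is 0. *)
  rewrite big_ord_recr/= (aK K)// powR0 ?gt_eqF// mulr0 addr0 /S.
  by rewrite (eq_bigr (fun k : 'I_K => b k))// => k _; exact: aM.
have V : (S%:E <= \int[mu]_x (((gl x)%:E * `|u x|) `^ p)).
  have y0 k : (0 <= v k / 2)%R by rewrite divr_ge0.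
  have gV k : ((v k / 2) `^ p)%:E <= \int[mu]_x (((gk k x)%:E * `|u x|) `^ p).
    by case: (gkP k).
  apply: le_trans (layered_lower K tdec mgk gk0 gkout a0 y0 gV).
  rewrite lee_fin le_eqVlt; apply/orP; left; apply/eqP; apply: eq_bigr => -[k kK] _ /=.
  rewrite powRM// /a kK -powRrM [(theta^-1 * p)%R]mulrC powRM ?invr_ge0 ?(ltW (Mpos k))//.
  have bpr : (b k `^ (p / r) = (M (t k))^-1 `^ (p / theta) * (v k / 2) `^ p)%R.
    rewrite /b powRM ?powR_ge0// -!powRrM -[((M (t k))^-1)%R]powR_inv1 ?(ltW (Mpos k))//.
    rewrite -powRrM; congr (_ `^ _ * _ `^ _)%R; field; rewrite ?gt_eqF//.
  by rewrite -mulrA -bpr -powRD prE ?oner_eq0// powRr1.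
have HS : (S <= c `^ p * (2 * 2 `^ (theta / P) * S) `^ (p / theta))%R.
  rewrite -lee_fin; apply: le_trans V _.
  apply: le_trans (Hc mgl gl0 _ _) _.
  - exact: (layered_integral K tdec mgk gk0 gkout gkPP a0).
  - exact: le_lt_trans W (ltry _).
  rewrite EFinM lee_wpmul2l ?lee_fin ?powR_ge0// -poweR_EFin le_poweR//.
    by rewrite divr_ge0// ltW.
  exact: hardy_rhs_ge0.
have -> : (\sum_(k < K) M (t k) `^ (- (r / theta)) * v k `^ r = 2 `^ r * S)%R.
  rewrite mulr_sumr; apply: eq_bigr => k _; rewrite /b mulrCA; congr (_ * _)%R.
  by rewrite -powRM ?divr_ge0//; congr (_ `^ _)%R; field.
rewrite ler_wpM2l ?powR_ge0//.
set D := (2 * 2 `^ (theta / P))%R in HS *.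
have D0 : (0 <= D)%R by rewrite mulr_ge0 ?powR_ge0.
have [S_eq0|Sn0] := eqVneq S 0%R; first by rewrite S_eq0 mulr_ge0 ?powR_ge0.
have Spos : (0 < S)%R by rewrite lt_def Sn0.
(* [S] is a positive real, so S^(p/theta) cancels and 1 - p/theta = p/r remains. *)
have Spr : (S `^ (p / r) <= D `^ (p / theta) * c `^ p)%R.
  rewrite -(ler_pM2l (powR_gt0 (p / theta) Spos)) -powRD ?prE ?oner_eq0// powRr1//.
  by apply: le_trans HS _; rewrite powRM// mulrC -mulrA mulrCA.
have Srp : (S = (S `^ (p / r)) `^ (r / p))%R.
  by rewrite -powRrM mulrA divfK ?gt_eqF// divff ?gt_eqF// powRr1.
have -> : (D `^ (r / theta) * c `^ r = (D `^ (p / theta) * c `^ p) `^ (r / p))%R.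
  rewrite powRM ?powR_ge0// -!powRrM; congr (_ `^ _ * _ `^ _)%R; field; rewrite ?gt_eqF//.
have rp0 : (0 <= r / p)%R by rewrite divr_ge0// ltW.
by rewrite [leLHS]Srp; apply: ge0_ler_powR => //; rewrite nnegrE ?mulr_ge0 ?powR_ge0.
Qed.

(** Splitting ball k into ring k and ball k + 1 refers each term to the next one; [q_decay] makes
    that reference at most one half. The ring terms are bounded by [sum_rings_le]. *)
Lemma radial_lower_gt :
  (\sum_(k < K) M (t k) `^ (- (r / theta)) * n k `^ r <=
   (2 * (2 `^ (r * (p^-1 - P^-1)) * (2 `^ r * (2 * 2 `^ (theta / P)) `^ (r / theta))) + 1)
     * c `^ r)%R.
Proof.
have decay := q_decay; set C1 := (2 `^ (r * (p^-1 - P^-1)))%R in decay *.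
have C10 : (0 <= C1)%R by exact: powR_ge0.
have nv k : (n k `^ r <= C1 * (v k `^ r + n k.+1 `^ r))%R.
  have E : rball (t k) = ring k `|` rball (t k.+1).
    by rewrite /ring setDKU//; apply: rball_subset; exact: ltW.
  have := @norm_exp_toU _ _ _ mu _ _ p0 pP _ mu_u (ring k) (rball (t k.+1)) r (mring k)
    (measurable_rball _).
  rewrite -E nE vE nE !poweR_EFin -EFinD -EFinM lee_fin; apply; last exact: ltW.
  by apply/eqP; rewrite -subset0 => x [[_ /=]].
have q0 : (0 < q)%R by exact: lt_trans q1.
have := @sum_absorb_next R (fun k => M (t k) `^ (- (r / theta)) * n k `^ r)%R
  (fun k => C1 * (M (t k) `^ (- (r / theta)) * v k `^ r))%R K.
move=> /(_ (mulr_ge0 (powR_ge0 _ _) (powR_ge0 _ _))) abs.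
apply: le_trans (abs _) _.
  move=> k; apply: (@le_trans _ _ (M (t k) `^ (- (r / theta)) * (C1 * (v k `^ r + n k.+1 `^ r))))%R.
    by rewrite ler_wpM2l ?powR_ge0.
  rewrite [in leLHS]mulrDr [in leLHS]mulrDr; apply: lerD; first by rewrite [leLHS]mulrCA lexx.
  have -> : M (t k) = (M (t k.+1) * q)%R.
    by rewrite (Mt k.+1) (Mt k) exprSr invfM mulrA divfK// gt_eqF.
  rewrite powRM ?(ltW (Mpos _)) ?(ltW q0)//.
  have aux (m s e z : R) : (m * s * (e * z) = m * z * (e * s))%R by ring.
  rewrite aux.
  by rewrite ler_wpM2l ?mulr_ge0 ?powR_ge0.
rewrite [leRHS]mulrDl mul1r lerD//.
  rewrite -mulr_sumr -!mulrA !ler_wpM2l//.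
  by apply: le_trans sum_rings_le _; rewrite !mulrA.
(* The boundary term: the single-ball estimate bounds it by c^r, the powers of M(t_K) cancelling. It
   is the [+ 1] in the constant. *)
have Nc : (n K <= c * M (t K) `^ theta^-1)%R.
  by rewrite -lee_fin -nE; exact: radial_lower.
apply: (@le_trans _ _ (M (t K) `^ (- (r / theta)) * (c * M (t K) `^ theta^-1) `^ r)%R).
  rewrite ler_wpM2l ?powR_ge0// ge0_ler_powR ?nnegrE ?mulr_ge0 ?powR_ge0// ltW//.
rewrite powRM ?powR_ge0// mulrCA -powRrM -powRD; last by rewrite (gt_eqF (Mpos K)) implybT.
by rewrite [(theta^-1 * r)%R]mulrC addNr powRr0 mulr1.
Qed.

End geometric_layers.
End lower.
End radial_hardy.

(** * Local Morrey-type norms *)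

Lemma measurable_invr (R : realType) : measurable_fun setT (fun x : R => x^-1)%R.
Proof.
(* Real powers are measurable on the whole line, and at 0 both expressions vanish. *)
rewrite (_ : (fun x : R => x^-1)%R = (fun x => x * (x ^+ 2) `^ (-1))%R).
  apply: measurable_funM => //; apply: (measurableT_comp (measurable_powR _)).
  exact: measurable_funX.
apply/funext => x; rewrite powR_inv1 ?sqr_ge0// expr2 invfM mulrA.
by have [->|x0] := eqVneq x 0%R; [rewrite invr0 !mulr0|rewrite divff// mul1r].
Qed.

Lemma measurable_inve (R : realType) : measurable_fun setT (fun x : \bar R => x^-1).
Proof.
rewrite (_ : (fun x : \bar R => x^-1) = fun x => if x == 0 then +oo else
    if x == -oo then -oo else ((fine x)^-1)%:E).
  have meq (a : \bar R) : measurable_fun setT (fun x : \bar R => x == a).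
    apply: (measurable_fun_bool true); rewrite setTI.
    rewrite (_ : _ @^-1` _ = [set a]); first exact: emeasurable_set1.
    by apply/seteqP; split => x /= /eqP.
  apply: measurable_fun_ifT => //; apply: measurable_fun_ifT => //.
  apply/measurable_EFinP; apply: (measurableT_comp (@measurable_invr R)).
  exact: fine_measurable.
apply/funext => x; case: x => [r| |] //=.
by rewrite invey invr0.
Qed.

Section morrey_norms.
Context (R : realType) (n : nat).
Local Notation leb := (@completed_lebesgue_measure R).
Local Notation mu := (@lebesgue_Rn R n).
Local Notation rho := (@eucl_norm R n).

Lemma eucl_norm_ge0 x : (0 <= rho x)%R.
Proof. exact: sqrtr_ge0. Qed.

Lemma cLM_normE (P theta : R) (omega : Rline R -> \bar R) (v f : Rn R n -> \bar R) :
  (0 < P)%R -> (0 < theta)%R ->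
  cLM_norm P%:E theta%:E omega v f =
  hardy_rhs mu rho P theta (fun t => `|omega t| `^ theta) (f \* v) `^ theta^-1.
Proof.
move=> P0 theta0; rewrite /cLM_norm /wnorm_on norm_onE//; last exact: measurable_half_line.
congr (_ `^ _); apply: eq_integral => t _.
rewrite abseM poweRM// gee0_abs ?norm_on_ge0// norm_onE//; last first.
  by apply: measurableC; exact: measurable_eball.
by rewrite -poweRrM mulrC.
Qed.

Lemma measurable_omega_tail (p : R) (omega : Rline R -> \bar R) : (0 < p)%R ->
  measurable_fun half_line omega -> measurable_fun setT (@omega_tail R n p%:E omega).
Proof.
move=> p0 mo.
(* Clamping at 0 makes a function monotone on the whole line while staying inside the half-line,
   where [omega] is measurable. *)
pose F (s : R) := norm_on leb p%:E (`]Num.max s 0%R, +oo[%classic : set (Rline R)) omega.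
rewrite (_ : omega_tail _ _ = F \o rho).
  apply: measurableT_comp; last exact: measurable_eucl_norm.
  apply: nonincreasing_measurable_ereal => s t st; apply: le_norm_on => //.
  - exact: measurable_Rline_itv.
  - exact: measurable_Rline_itv.
  - move=> x /=; rewrite !in_itv/= !andbT; apply: le_lt_trans.
    by rewrite ge_max !le_max st lexx !orbT.
  - apply: measurable_funS mo; first exact: measurable_half_line.
    move=> x; rewrite /half_line/= !in_itv/= !andbT; apply: le_lt_trans.
    by rewrite le_max lexx orbT.
by apply/funext => x /=; rewrite /omega_tail /F max_l// eucl_norm_ge0.
Qed.

Lemma LM_normE (p : R) (omega : Rline R -> \bar R) (v f : Rn R n -> \bar R) :
  (0 < p)%R -> measurable_fun half_line omega -> measurable_fun setT f ->
  measurable_fun setT v ->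
  LM_norm p%:E p%:E omega v f =
  (\int[mu]_x `|f x * v x * omega_tail p%:E omega x| `^ p) `^ p^-1.
Proof.
move=> p0 mo mf mv; rewrite /LM_norm /wnorm_on norm_onE//; last exact: measurable_half_line.
congr (_ `^ _).
pose A x := `|f x * v x| `^ p.
(* Extended by zero, so that Tonelli applies on the full product space to the region |x| < t. *)
pose W := (fun t => `|omega t| `^ p) \_ (@half_line R).
pose F (z : Rline R * Rn R n) := if (rho z.2 < z.1)%R then A z.2 * W z.1 else 0.
have A0 x : 0 <= A x by exact: poweR_ge0.
have W0 t : 0 <= W t by apply: erestrict_ge0 => ? _; exact: poweR_ge0.
have mA : measurable_fun setT A.
  apply: (@measurable_abse_poweR _ _ _ (fun x => f x * v x)).
  by apply: emeasurable_funM; [exact: mf|exact: mv].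
have mW : measurable_fun setT W.
  apply/(measurable_restrictT _ (@measurable_half_line R)).
  by apply: (measurableT_comp (measurable_poweR _)); exact: measurableT_comp.
have mF : measurable_fun setT F.
  apply: measurable_fun_ifT => //.
    apply: measurable_fun_ltr.
      exact: (measurableT_comp (@measurable_eucl_norm R n) measurable_snd).
    exact: (measurableT_comp (@measurable_Rline_id R) measurable_fst).
  apply: emeasurable_funM.
    exact: (measurableT_comp mA measurable_snd).
  exact: (measurableT_comp mW measurable_fst).
have F0 z : 0 <= F z by rewrite /F; case: ifPn => // _; rewrite mule_ge0.
transitivity (\int[leb]_t \int[mu]_x F (t, x)).
  rewrite [LHS]integral_mkcond; apply: eq_integral => t _.
  rewrite patchE; case: ifPn => [th|tNh]; last first.
    rewrite integral0_eq// => x _; rewrite /F/=; case: ifPn => // _.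
    by rewrite /W patchE (negbTE tNh) mule0.
  rewrite abseM poweRM// gee0_abs ?norm_on_ge0// norm_on_poweR//; last exact: measurable_eball.
  transitivity (\int[mu]_x ((A \_ (eball t)) x * W t)).
    rewrite ge0_integralZr//; last 2 first.
    - by apply/(measurable_restrictT _ (@measurable_eball R n t)); exact: measurable_funTS.
    - by move=> x _; apply: erestrict_ge0.
    by rewrite -integral_mkcond; congr (_ * _); rewrite /W patchE th.
  apply: eq_integral => x _; rewrite /F/= patchE.
  case: ifPn => [/set_mem|]; first by rewrite /eball/= => ->.
  by rewrite notin_setE/eball/= => /negP/negbTE ->; rewrite mul0e.
rewrite (@fubini_tonelli _ _ _ _ _ leb mu F mF F0); apply: eq_integral => x _.
rewrite [in RHS]abseM poweRM// -/(A x) [X in A x * X `^ p]gee0_abs ?norm_on_ge0//.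
rewrite /omega_tail norm_on_poweR//; last exact: measurable_Rline_itv.
have mI : measurable (`](rho x), +oo[%classic : set (Rline R)) by exact: measurable_Rline_itv.
transitivity (\int[leb]_t (A x * (W \_ (`](rho x), +oo[%classic : set (Rline R))) t)).
  apply: eq_integral => t _; rewrite /F/= patchE.
  case: ifPn => [xt|]; first by rewrite mem_set//= in_itv/= xt.
  by move=> xt; rewrite memNset ?mule0//= in_itv/= andbT; exact/negP.
rewrite ge0_integralZl//; last 2 first.
- by apply/(measurable_restrictT _ mI); exact: measurable_funTS.
- by move=> t _; exact: erestrict_ge0.
rewrite -integral_mkcond; congr (_ * _); apply: eq_integral => t; rewrite inE/= in_itv/= andbT => xt.
by rewrite /W patchE mem_set// /half_line/= in_itv/= andbT (le_lt_trans _ xt)// eucl_norm_ge0.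
Qed.

End morrey_norms.

(** * Lower and upper sums for the Stieltjes integral *)

Section stieltjes_sums.
Context (R : realType) (theta q : R).
Hypotheses (theta0 : (0 < theta)%R) (q0 : (0 < q)%R) (qtheta : (q < theta)%R).
Variable omega : Rline R -> \bar R.
Hypothesis homega : cOmega theta%:E omega.
Local Notation M := (primitive (fun t => `|omega t| `^ theta)).
Local Notation r := ((q^-1 - theta^-1)^-1)%R.
Local Notation S := (stieltjes_measure (neg_pow_nd theta0 q0 homega)).
Variable phi : R -> \bar R.
Hypotheses (phi0 : forall t, 0 <= phi t)
  (phi_nd : {homo phi : s t / (s <= t)%R >-> s <= t}).
Variables (t : nat -> R) (K : nat).
Hypotheses (tpos : forall k, (0 < t k)%R) (tdec : forall k, (t k.+1 < t k)%R).

Let B k : set R := `]0%R, t k]%classic.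

Let Bn k : B k.+1 `<=` B k.
Proof.
move=> x; rewrite /B/= !in_itv/= => /andP[->/=] /le_trans; apply; exact: ltW.
Qed.

Let FE k : B k `\` B k.+1 = `]t k.+1, t k]%classic.
Proof.
apply/seteqP; split => x /=; rewrite /B/= !in_itv/=.
  by move=> [/andP[-> ->] /negP]; rewrite /= -ltNge andbT.
move=> /andP[tx ->]; rewrite (lt_trans (tpos _) tx); split => //.
by apply/negP; rewrite /= -ltNge.
Qed.

Let mF k : measurable (B k `\` B k.+1).
Proof. by rewrite FE; exact: measurable_itv. Qed.

Let SF k : \int[S]_(x in B k `\` B k.+1) (cst 1 x) =
  (M (t k.+1) `^ (- (r / theta)) - M (t k) `^ (- (r / theta)))%:E.
Proof.
rewrite integral_cst// mul1e FE; apply: (stieltjes_neg_pow theta0 q0 qtheta homega) => //.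
exact: ltW.
Qed.

Lemma sum_le_stieltjes :
  \sum_(k < K) phi (t k.+1) *
    (M (t k.+1) `^ (- (r / theta)) - M (t k) `^ (- (r / theta)))%:E
  <= \int[S]_(x in `]0%R, +oo[) phi x.
Proof.
under eq_bigr do rewrite -SF.
rewrite [leRHS](eq_integral (fun x => phi x * cst 1 x)); last by move=> x _; rewrite mule1.
apply: (@sum_le_integral _ _ _ S `]0%R, +oo[%classic (fun k => B k `\` B k.+1) phi (cst 1)
  (fun k => phi (t k.+1)) K) => //.
- exact: trivIset_rings.
- by move=> k _ x [+ _]; rewrite /B/= !in_itv/= => /andP[->].
- by apply: measurable_funTS; exact: nondecreasing_measurable_ereal.
- by move=> k x _; rewrite FE/= in_itv/= => /andP[/ltW tx _]; exact: phi_nd.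
Qed.

Lemma stieltjes_le_sum :
  \int[S]_(x in `](t K), (t 0%N)]) phi x <=
  \sum_(k < K) phi (t k) *
    (M (t k.+1) `^ (- (r / theta)) - M (t k) `^ (- (r / theta)))%:E.
Proof.
under [leRHS]eq_bigr do rewrite -SF.
rewrite (eq_integral (fun x => phi x * cst 1 x)); last by move=> x _; rewrite mule1.
apply: (@integral_le_sum _ _ _ S `](t K), (t 0%N)]%classic (fun k => B k `\` B k.+1) phi (cst 1)
  (fun k => phi (t k)) K) => //.
- exact: trivIset_rings.
- rewrite -bigsetU_rings//; apply/seteqP; split => x /=; rewrite /B/= !in_itv/=.
    move=> /andP[tx ->]; rewrite (lt_trans (tpos _) tx); split => //.
    by apply/negP; rewrite /= -ltNge.
  by move=> [/andP[-> ->] /negP]; rewrite /= -ltNge andbT.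
- by apply: measurable_funTS; exact: nondecreasing_measurable_ereal.
- by move=> k x _; rewrite FE/= in_itv/= => /andP[_ tx]; exact: phi_nd.
Qed.

End stieltjes_sums.

(** * The embedding as a weighted inequality *)

Section embedding.
Context (R : realType) (n : nat).
Variables (P p theta : R) (P0 : (0 < P)%R) (p0 : (0 < p)%R) (theta0 : (0 < theta)%R).
Variables (v1 v2 : Rn R n -> \bar R) (omega1 omega2 : Rline R -> \bar R).
Hypotheses (hv1 : weight lebesgue_Rn setT v1) (hv2 : weight lebesgue_Rn setT v2)
  (homega1 : cOmega theta%:E omega1) (homega2 : Omega p%:E omega2).
Local Notation leb := (@completed_lebesgue_measure R).
Local Notation mu := (@lebesgue_Rn R n).
Local Notation rho := (@eucl_norm R n).
Local Notation w := (fun x => (v1 x)^-1 * v2 x).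
Local Notation u := (omega_tail p%:E omega2 \* w).
Local Notation h := (fun t => `|omega1 t| `^ theta).
Local Notation X := (cLM P%:E theta%:E omega1 v1).
Local Notation Y := (LM p%:E p%:E omega2 v2).

Let mpow := @measurable_abse_poweR _ (Rn R n) R.

Lemma measurable_density : measurable_fun setT u.
Proof.
apply: emeasurable_funM; first by apply: measurable_omega_tail => //; exact: homega2.1.1.
apply: emeasurable_funM; last exact: hv2.1.
by apply: (measurableT_comp (@measurable_inve R)); exact: hv1.1.
Qed.

Lemma weight_mulV : {ae mu, forall x, v1 x * (v1 x)^-1 = 1}.
Proof.
apply: filterS hv1.2 => x /(_ I); case: (v1 x) => [r| |]; rewrite ?ltxx ?andbF//.
by rewrite lte_fin => /andP[r0 _]; rewrite inver gt_eqF// -EFinM divff// gt_eqF.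
Qed.

Let integral_density (f tl : Rn R n -> \bar R) :
  measurable_fun setT f -> measurable_fun setT tl ->
  \int[mu]_x `|f x * v2 x * tl x| `^ p =
  \int[mu]_x `|(f x * v1 x) * (tl x * ((v1 x)^-1 * v2 x))| `^ p.
Proof.
move=> mf mt; have mv1 := hv1.1; have mv2 := hv2.1.
have mv1V : measurable_fun setT (fun x => (v1 x)^-1).
  by apply: (measurableT_comp (@measurable_inve R)).
apply: ge0_ae_eq_integral; [exact: measurableT| | | | |].
- apply: mpow; apply: emeasurable_funM; last exact: mt.
  by apply: emeasurable_funM; [exact: mf|exact: mv2].
- apply: mpow; apply: emeasurable_funM.
    by apply: emeasurable_funM; [exact: mf|exact: mv1].
  apply: emeasurable_funM; first exact: mt.
  by apply: emeasurable_funM; [exact: mv1V|exact: mv2].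
- by move=> x _; exact: poweR_ge0.
- by move=> x _; exact: poweR_ge0.
apply: filterS weight_mulV => x vV _.
rewrite [X in _ = `|_ * X| `^ _]muleCA -[X in _ = `|X| `^ _]muleA.
by rewrite [X in _ = `|_ * X| `^ _]muleA vV mul1e -[X in `|X| `^ _ = _]muleA [v2 x * _]muleC.
Qed.

Lemma LM_norm_density f : measurable_fun setT f ->
  LM_norm p%:E p%:E omega2 v2 f =
  (\int[mu]_x `|(f \* v1) x * u x| `^ p) `^ p^-1.
Proof.
move=> mf; rewrite LM_normE; [|exact: p0|exact: homega2.1.1|exact: mf|exact: hv2.1].
by rewrite (integral_density mf (@measurable_omega_tail R n p omega2 p0 homega2.1.1)).
Qed.

Lemma id_norm_le (L : R) : (0 <= L)%R ->
  (forall g : Rn R n -> \bar R, measurable_fun setT g ->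
    (forall t : R, (0 < t)%R -> outer_integral mu rho P g t < +oo) ->
    \int[mu]_x `|g x * u x| `^ p <=
      (L `^ p)%:E * hardy_rhs mu rho P theta h g `^ (p / theta)) ->
  id_norm X Y <= L%:E.
Proof.
move=> L0 HL; apply: ereal_inf_lbound; exists L => //; split => // f [mf fout _].
rewrite [qnorm _ _](LM_norm_density mf) [qnorm _ _](cLM_normE _ _ _ P0 theta0).
have W0 := hardy_rhs_ge0 mu rho P theta (@cOmega_ge0 R theta omega1) (f \* v1).
apply: (@le_trans _ _ (((L `^ p)%:E * hardy_rhs mu rho P theta h (f \* v1) `^ (p / theta)) `^ p^-1)).
  apply: le_poweR; first by rewrite invr_ge0 ltW.
    by apply: integral_ge0 => x _; exact: poweR_ge0.
  apply: (HL (f \* v1)); first by apply: emeasurable_funM; [exact: mf|exact: hv1.1].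
  move=> t t0; have := fout t t0.
  rewrite /wnorm_on norm_onE; [|exact: P0|by apply: measurableC; exact: measurable_eball].
  by apply: lty_poweRy; rewrite invr_eq0 gt_eqF.
rewrite poweRM ?lee_fin ?powR_ge0 ?poweR_ge0// -poweR_EFin -!poweRrM divff ?gt_eqF// poweRe1 ?lee_fin//.
by rewrite mulrAC divff ?gt_eqF// mul1r.
Qed.

(** The test function is f = g / v1. The finiteness hypotheses on [g] place it in the source space:
    the integral of g^P bounds the norms off balls, and [hardy_rhs] is a power of the source
    norm. *)
Lemma id_norm_bound_hardy (c : R) : (0 <= c)%R ->
  (forall f, carrier X f -> qnorm Y f <= c%:E * qnorm X f) ->
  forall g : Rn R n -> R, measurable_fun setT g -> (forall x, 0 <= g x)%R ->
  \int[mu]_x ((g x)%:E `^ P) < +oo ->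
  hardy_rhs mu rho P theta h (EFin \o g) < +oo ->
  \int[mu]_x (((g x)%:E * `|u x|) `^ p) <=
    (c `^ p)%:E * hardy_rhs mu rho P theta h (EFin \o g) `^ (p / theta).
Proof.
move=> c0 Hc g mg g0 gP Wg.
pose f x := (g x)%:E * (v1 x)^-1.
have mg' : measurable_fun setT (EFin \o g) by exact/measurable_EFinP.
have mf : measurable_fun setT f.
  apply: emeasurable_funM; first exact: mg'.
  by apply: (measurableT_comp (@measurable_inve R)); exact: hv1.1.
have mfv : measurable_fun setT (f \* v1).
  by apply: emeasurable_funM; [exact: mf|exact: hv1.1].
have fg : {ae mu, forall x, (f \* v1) x = (g x)%:E}.
  by apply: filterS weight_mulV => x vV /=; rewrite /f -muleA [X in _ * X]muleC vV mule1.
have outE t : outer_integral mu rho P (f \* v1) t = outer_integral mu rho P (EFin \o g) t.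
  apply: ge0_ae_eq_integral.
  - by apply: measurableC; exact: measurable_eball.
  - by apply: measurable_funTS; exact: mpow.
  - by apply: measurable_funTS; exact: mpow.
  - by move=> x _; exact: poweR_ge0.
  - by move=> x _; exact: poweR_ge0.
  - by apply: filterS fg => x fgx _; rewrite fgx.
have WE : hardy_rhs mu rho P theta h (f \* v1) = hardy_rhs mu rho P theta h (EFin \o g).
  by apply: eq_integral => t _; rewrite outE.
have Xf : carrier X f.
  split; [exact: mf| |].
  - move=> t t0; rewrite /wnorm_on norm_onE; [|exact: P0|by apply: measurableC; exact: measurable_eball].
    apply: poweR_lty; rewrite -[ltLHS]/(outer_integral mu rho P (f \* v1) t) outE.
    apply: le_lt_trans gP.
    rewrite [leRHS](eq_integral (fun x => `|(EFin \o g) x| `^ P)); last first.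
      by move=> x _; rewrite gee0_abs ?lee_fin.
    apply: ge0_subset_integral; [|exact: measurableT| | |exact: subsetT].
    - by apply: measurableC; exact: measurable_eball.
    - exact: mpow.
    - by move=> x _; exact: poweR_ge0.
  - by rewrite -[ltLHS]/(cLM_norm _ _ _ _ _) (cLM_normE _ _ _ P0 theta0) WE; exact: poweR_lty.
have := Hc f Xf; rewrite [qnorm _ _](LM_norm_density mf) [qnorm _ _](cLM_normE _ _ _ P0 theta0) WE.
set V := \int[mu]_x _; move=> HV.
have V0 : 0 <= V by apply: integral_ge0 => x _; exact: poweR_ge0.
have -> : \int[mu]_x (((g x)%:E * `|u x|) `^ p) = V.
  apply: ge0_ae_eq_integral; [exact: measurableT| | | | |].
  - apply: (measurableT_comp (measurable_poweR _)).
    apply: emeasurable_funM; first exact: mg'.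
    by apply: measurableT_comp; [exact: abse_measurable|exact: measurable_density].
  - apply: (@mpow (fun x => (f \* v1) x * u x)).
    by apply: emeasurable_funM; [exact: mfv|exact: measurable_density].
  - by move=> x _; exact: poweR_ge0.
  - by move=> x _; exact: poweR_ge0.
  apply: filterS fg => x fgx _.
  rewrite fgx [X in _ = X `^ _]abseM [X in _ = (X * _) `^ _]gee0_abs; first by [].
  by rewrite lee_fin.
rewrite -(poweRVK p0 V0).
have W0 := hardy_rhs_ge0 mu rho P theta (@cOmega_ge0 R theta omega1) (EFin \o g).
apply: le_trans (le_poweR (ltW p0) (poweR_ge0 _ _) HV) _.
by rewrite poweRM ?lee_fin ?poweR_ge0// poweR_EFin -poweRrM [(theta^-1 * p)%R]mulrC.
Qed.

End embedding.

(** * Comparison of the best constant with the conditions *)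

Lemma powRN_le (R : realType) (a b e : R) : (0 < a -> a <= b -> 0 <= e ->
  b `^ (- e) <= a `^ (- e))%R.
Proof.
move=> a0 ab e0; have b0 := lt_le_trans a0 ab.
rewrite !powRN lef_pV2 ?posrE ?powR_gt0//.
by apply: ge0_ler_powR; rewrite ?nnegrE// ltW.
Qed.

Section characterization.
Context d (X : measurableType d) (R : realType).
Variable mu : {sigma_finite_measure set X -> \bar R}.
Variables (rho : X -> R) (mrho : measurable_fun setT rho).
Hypothesis rho0 : forall x, (0 <= rho x)%R.
Hypothesis rho_null : mu [set x | rho x = 0%R] = 0.
Variables (P p theta : R) (p0 : (0 < p)%R) (pP : (p <= P)%R) (theta0 : (0 < theta)%R).
Variables (u : X -> \bar R) (mu_u : measurable_fun setT u).
Variable omega : Rline R -> \bar R.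
Hypothesis homega : cOmega theta%:E omega.
Local Notation leb := (@completed_lebesgue_measure R).
Local Notation h := (fun t => `|omega t| `^ theta).
Local Notation ball := (rball rho).
Local Notation N A := (norm_on mu (exp_to P%:E p%:E) A u).
Local Notation N1 A := (norm_on leb theta%:E A omega).
Local Notation M := (primitive h).

Let mh := cOmega_measurable homega.
Let h0 := @cOmega_ge0 R theta omega.
Let hfin := cOmega_integral theta0 homega.

(** The two inequalities range over different functions on purpose: this one over all that f v1 can
    be for f in the source space, [hardy_admissible] over real functions whose quotient by v1 surely
    lies in it. *)
Definition hardy_upper (L : R) := forall g : X -> \bar R, measurable_fun setT g ->
  (forall t : R, (0 < t)%R -> outer_integral mu rho P g t < +oo) ->
  \int[mu]_x `|g x * u x| `^ p <=
    (L `^ p)%:E * hardy_rhs mu rho P theta h g `^ (p / theta).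

Definition hardy_admissible (c : R) := forall g : X -> R, measurable_fun setT g ->
  (forall x, 0 <= g x)%R -> \int[mu]_x ((g x)%:E `^ P) < +oo ->
  hardy_rhs mu rho P theta h (EFin \o g) < +oo ->
  \int[mu]_x (((g x)%:E * `|u x|) `^ p) <=
    (c `^ p)%:E * hardy_rhs mu rho P theta h (EFin \o g) `^ (p / theta).

Let Mpos (t : R) : (0 < t)%R -> (0 < M t)%R.
Proof. exact: primitive_gt0. Qed.

Let hardy_admissible_ball c t : (0 <= c)%R -> hardy_admissible c -> (0 < t)%R ->
  N (ball t) <= (c * M t `^ theta^-1)%:E.
Proof. by move=> c0 Hc; exact: (radial_lower mrho p0 pP theta0 mu_u mh h0 hfin c0 Hc). Qed.

(** * The case theta <= p *)

Section small_theta.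
Hypothesis thetap : (theta <= p)%R.
Let Q := ereal_sup [set (N1 `]0%R, t[%classic)^-1 * N (ball t) | t in `]0%R, +oo[%classic].

Lemma sup_condition_ge0 : 0 <= Q.
Proof.
apply: (@le_trans _ _ ((N1 `]0%R, 1%R[%classic)^-1 * N (ball 1))).
  by rewrite mule_ge0 ?inve_ge0 ?norm_on_ge0.
by apply: ereal_sup_ubound; exists 1%R => //=; rewrite in_itv/= ltr01.
Qed.

Lemma hardy_upper_sup : Q \is a fin_num -> hardy_upper (4 `^ theta^-1 * fine Q).
Proof.
move=> Qfin g mg gout.
have c4 : (0 < 4 `^ theta^-1 :> R)%R by rewrite powR_gt0.
have Q0 : (0 <= fine Q)%R by rewrite fine_ge0 ?sup_condition_ge0.
have NQ s : (0 < s)%R -> N (ball s) <= (fine Q * M s `^ theta^-1)%:E.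
  move=> s0; have Ms : (0 < M s `^ theta^-1)%R by rewrite powR_gt0 ?Mpos.
  have : (N1 `]0%R, s[%classic)^-1 * N (ball s) <= Q.
    by apply: ereal_sup_ubound; exists s => //=; rewrite in_itv/= s0.
  rewrite (cOmega_norm theta0 homega s0) inver gt_eqF// -{1}(fineK Qfin) => H.
  have NE : N (ball s) = (M s `^ theta^-1)%:E * ((M s `^ theta^-1)^-1%R%:E * N (ball s)).
    by rewrite muleA -EFinM divff ?mul1e// gt_eqF.
  by rewrite NE mulrC EFinM lee_wpmul2l ?lee_fin// ltW.
apply: le_trans (radial_upper_le mrho rho0 rho_null
  p0 pP theta0 mu_u mh h0 hfin thetap Q0 mg gout NQ) _.
rewrite poweRM ?hardy_rhs_ge0// muleA poweR_EFin -EFinM powRM ?(ltW c4)// -powRrM.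
by rewrite [(theta^-1 * p)%R]mulrC [(_ * fine Q `^ p)%R]mulrC.
Qed.

Lemma sup_le_admissible c : (0 <= c)%R -> hardy_admissible c -> Q <= c%:E.
Proof.
move=> c0 Hc; apply: ge_ereal_sup => _ [t /= + <-]; rewrite in_itv/= andbT => t0.
have Mt : (0 < M t `^ theta^-1)%R by rewrite powR_gt0 ?Mpos.
rewrite (cOmega_norm theta0 homega t0) inver gt_eqF//.
apply: (@le_trans _ _ (((M t `^ theta^-1)^-1)%:E * (c * M t `^ theta^-1)%:E)).
  by rewrite lee_wpmul2l ?lee_fin ?invr_ge0 ?(ltW Mt)//; exact: hardy_admissible_ball.
by rewrite -EFinM mulrCA mulVf ?gt_eqF// mulr1.
Qed.

End small_theta.

(** * The case p < theta *)

Section large_theta.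
Hypothesis ptheta : (p < theta)%R.
Local Notation r := ((p^-1 - theta^-1)^-1)%R.
Local Notation S := (stieltjes_measure (neg_pow_nd theta0 p0 homega)).
Let rhoe : R := (r / theta)%R.
Let phi (t : R) : \bar R := N (ball t) `^ r.
Let I := \int[S]_(t in `]0%R, +oo[%classic) phi t.
Let J := (N1 `]0%R, +oo[%classic)^-1 * N setT.

Let r0 : (0 < r)%R. Proof. exact: exp_to_pos. Qed.
Let rhoe0 : (0 < rhoe)%R. Proof. by rewrite divr_gt0. Qed.

Let phi0 t : 0 <= phi t. Proof. exact: poweR_ge0. Qed.

Let phi_nd : {homo phi : s t / (s <= t)%R >-> s <= t}.
Proof.
move=> s t st; apply: le_poweR; [exact: ltW|exact: norm_on_ge0|].
apply: (norm_exp_to_le mu p0 pP mu_u); [exact: measurable_rball|exact: measurable_rball|].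
exact: rball_subset.
Qed.

Let I0 : 0 <= I. Proof. by apply: integral_ge0 => t _; exact: phi0. Qed.

Let J0 : 0 <= J. Proof. by rewrite mule_ge0 ?inve_ge0 ?norm_on_ge0. Qed.

Lemma integral_condition_ge0 : 0 <= I `^ r^-1 + J.
Proof. by apply: adde_ge0; [exact: poweR_ge0|exact: J0]. Qed.

(** When M doubles from s to t, the decrease of M^(-rhoe) is the fraction 1 - 2^(-rhoe) of its value
    at s. So a single value is [kappa] times the Stieltjes mass of ]s, t]. *)
Let kappa : R := ((1 - 2 `^ (- rhoe))^-1)%R.

Let two_decay : (2 `^ (- rhoe) < 1 :> R)%R.
Proof.
have one : (1 `^ rhoe = 1 :> R)%R by rewrite powR1.
rewrite powRN invf_lt1 ?powR_gt0// -[ltLHS]one.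
by apply: gt0_ltr_powR => //; rewrite ?nnegrE// ltr1n.
Qed.

Let kappa0 : (0 < kappa)%R. Proof. by rewrite invr_gt0 subr_gt0. Qed.

Let decay_step (s t : R) : (0 < s)%R -> M t = (2 * M s)%R ->
  (M s `^ (- rhoe) = kappa * (M s `^ (- rhoe) - M t `^ (- rhoe)))%R.
Proof.
move=> s0 ->; rewrite powRM ?(ltW (Mpos s0))//.
have -> (m e : R) : (m - e * m = (1 - e) * m)%R by ring.
by rewrite mulrA mulVf ?mul1r// gt_eqF// subr_gt0.
Qed.

(** If M never doubles above [s], no Stieltjes mass of the right size is available there; but then
    omega1 has finite total norm, comparable to M(s)^(1/theta), and the term at infinity takes
    over. *)
Let double_above s : (0 < s)%R -> (exists T, (s < T)%R /\ M T = (2 * M s)%R) \/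
  (forall T, (0 < T)%R -> M T <= 2 * M s)%R.
Proof.
move=> s0; have [[T [T0 MT]]|] := pselect (exists T, (0 < T)%R /\ (2 * M s < M T)%R).
  left; have Ms := Mpos s0.
  have [|t [/andP[t0 tT] Mt]] := @primitive_ivt R h mh h0 hfin (2 * M s) T T0.
    by rewrite MT andbT mulr_gt0.
  exists t; split => //; apply: (primitive_lt mh h0 hfin) => //.
  by rewrite Mt ltr_pMl// ltr1n.
move=> /forallNP H; right => T T0; rewrite leNgt; apply/negP => MT.
by apply: (H T).
Qed.

Let N1y_le (B : R) : (forall T, (0 < T)%R -> M T <= B)%R ->
  N1 `]0%R, +oo[%classic <= (B `^ theta^-1)%:E.
Proof.
move=> HB; rewrite norm_onE//; last exact: measurable_half_line.
rewrite -poweR_EFin; apply: le_poweR; first by rewrite invr_ge0 ltW.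
  by apply: integral_ge0 => t _; exact: poweR_ge0.
rewrite leNgt; apply/negP => HI.
pose F k : set (Rline R) := `]0%R, k.+1%:R[%classic.
have UF : \bigcup_k F k = half_line.
  apply/seteqP; split => x; rewrite /half_line/= ?in_itv/= ?andbT.
    by move=> [k _]; rewrite /F/= in_itv/= => /andP[].
  by move=> x0; exists (Num.truncn x) => //; rewrite /F/= in_itv/= x0 truncnS_gt.
have [] := @lt_integral_nondecreasing_set _ _ _ leb F h B%:E.
- move=> i j ij; apply/subsetPset => x; rewrite /F/= !in_itv/= => /andP[->/=] /lt_le_trans; apply.
  by rewrite ler_nat.
- by move=> k; exact: measurable_Rline_itv.
- by rewrite UF; exact: mh.
- by rewrite UF; exact: h0.
- by rewrite UF.
move=> k; rewrite (primitiveE hfin)// lte_fin ltNge => /negP; apply; exact: HB.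
Qed.

Let N1_le t : (0 < t)%R -> (M t `^ theta^-1)%:E <= N1 `]0%R, +oo[%classic.
Proof.
move=> t0; rewrite -(cOmega_norm theta0 homega t0); apply: le_norm_on => //.
- exact: measurable_Rline_itv.
- exact: measurable_half_line.
- by move=> x /=; rewrite !in_itv/= => /andP[->].
- exact: homega.1.1.
Qed.

Let N1y_gt0 : 0 < N1 `]0%R, +oo[%classic.
Proof. by apply: lt_le_trans (N1_le ltr01); rewrite lte_fin powR_gt0 ?Mpos. Qed.

(** The estimate for the outermost term. If M doubles at T, the mass of ]s, T] yields [kappa * i];
    otherwise N on the ball is at most N on the whole space, that is [j] times the total norm of
    omega1, which is at most (2 M s)^(1/theta). *)
Let ball_term_le (i j s : R) : I = i%:E -> J = j%:E -> (0 < s)%R ->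
  (M s `^ (- rhoe))%:E * phi s <= (kappa * i + 2 `^ rhoe * j `^ r)%:E.
Proof.
move=> Ii Jj s0; have Ms := Mpos s0.
have i0 : (0 <= i)%R by rewrite -lee_fin -Ii.
have j0 : (0 <= j)%R by rewrite -lee_fin -Jj.
have [[T [sT MT]]|HT] := double_above s0.
  apply: (@le_trans _ _ (kappa * i)%:E); last first.
    by rewrite lee_fin lerDl mulr_ge0 ?powR_ge0.
  (* Only the interval from [s] to [T] is used; the later radii merely continue a decreasing
     positive sequence. *)
  pose t k : R := if k is k'.+1 then (s / 2 ^+ k')%R else T.
  have tpos k : (0 < t k)%R.
    by case: k => [|k] /=; [exact: lt_trans sT|rewrite divr_gt0 ?exprn_gt0].
  have tdec k : (t k.+1 < t k)%R.
    case: k => [|k] /=; first by rewrite expr0 divr1.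
    by rewrite ltr_pM2l// ltf_pV2 ?posrE ?exprn_gt0// exprS ltr_pMl ?exprn_gt0// ltr1n.
  have := sum_le_stieltjes theta0 p0 ptheta homega phi0 phi_nd 1 tpos tdec.
  rewrite big_ord1 /= expr0 divr1 -/I Ii => H.
  rewrite (decay_step s0 MT) !EFinM -muleA lee_wpmul2l ?lee_fin ?(ltW kappa0)//.
  by rewrite muleC.
apply: (@le_trans _ _ (2 `^ rhoe * j `^ r)%:E); last first.
  by rewrite lee_fin lerDr mulr_ge0// ltW.
have N1le := N1y_le HT.
have N1fin : N1 `]0%R, +oo[%classic \is a fin_num.
  by rewrite ge0_fin_numE ?norm_on_ge0// (le_lt_trans N1le)// ltry.
set m := fine (N1 `]0%R, +oo[%classic).
have mE : N1 `]0%R, +oo[%classic = m%:E by rewrite fineK.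
have m0 : (0 < m)%R by rewrite -lte_fin -mE.
have NT : N setT = (m * j)%:E.
  by rewrite EFinM -Jj /J mE inver gt_eqF// muleA -EFinM divff ?gt_eqF// mul1e.
have Nle : N (ball s) <= ((2 * M s) `^ theta^-1 * j)%:E.
  apply: le_trans (_ : N setT <= _).
    by apply: (norm_exp_to_le mu p0 pP mu_u) => //; exact: measurable_rball.
  by rewrite NT lee_fin ler_wpM2r// -lee_fin -mE.
apply: (@le_trans _ _ ((M s `^ (- rhoe))%:E * ((2 * M s) `^ theta^-1 * j)%:E `^ r)).
  rewrite lee_wpmul2l ?lee_fin ?powR_ge0//; apply: le_poweR => //; first exact: ltW.
  exact: norm_on_ge0.
rewrite poweR_EFin -EFinM lee_fin.
have -> : (((2 * M s) `^ theta^-1 * j) `^ r = M s `^ rhoe * (2 `^ rhoe * j `^ r))%R.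
  rewrite powRM ?powR_ge0// -powRrM [(theta^-1 * r)%R]mulrC -/rhoe powRM ?(ltW Ms)//.
  by rewrite [(2 `^ _ * _)%R]mulrC mulrA.
rewrite [leLHS]mulrA -powRD; last by rewrite (gt_eqF Ms) implybT.
by rewrite addNr powRr0 mul1r.
Qed.

Let ball_fin (i j s : R) : I = i%:E -> J = j%:E -> (0 < s)%R -> N (ball s) < +oo.
Proof.
move=> Ii Jj s0; have := ball_term_le Ii Jj s0.
rewrite /phi; have := norm_on_ge0 mu (exp_to P%:E p%:E) (ball s) u.
case: (N (ball s)) => [x| |] // _ + ; first by rewrite ltry.
rewrite poweRyr ?gt_eqF// gt0_muley; first by rewrite leye_eq.
by rewrite lte_fin powR_gt0 ?Mpos.
Qed.

(** One [kappa] comes from the outermost term and one from the others, 2^rhoe from the term at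
    infinity, and 4^(1/theta) from [sum_outer_le_hardy_rhs]. *)
Definition upper_const : R := ((2 * kappa + 2 `^ rhoe) `^ r^-1 * 4 `^ theta^-1)%R.

Lemma upper_const_ge0 : (0 <= upper_const)%R.
Proof. by rewrite mulr_ge0 ?powR_ge0. Qed.

Lemma hardy_upper_integral : I `^ r^-1 + J \is a fin_num ->
  hardy_upper (upper_const * fine (I `^ r^-1 + J)).
Proof.
move=> Qfin g mg gout.
move: (Qfin); rewrite fin_numD => /andP[Ifin Jfin].
have [i Ii] : exists i, I = i%:E.
  exists (fine I); rewrite fineK// ge0_fin_numE//.
  apply: (@lty_poweRy _ _ r^-1); first by rewrite invr_eq0 gt_eqF.
  by rewrite ltey_eq Ifin.
have [j Jj] : exists j, J = j%:E by exists (fine J); rewrite fineK.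
have i0 : (0 <= i)%R by rewrite -lee_fin -Ii.
have j0 : (0 <= j)%R by rewrite -lee_fin -Jj.
set Q := fine _; have QE : Q = (i `^ r^-1 + j)%R by rewrite /Q Ii Jj.
have Q0 : (0 <= Q)%R by rewrite QE addr_ge0 ?powR_ge0.
pose C : R := (2 * kappa + 2 `^ rhoe)%R.
have C0 : (0 <= C)%R by rewrite addr_ge0 ?powR_ge0// mulr_ge0// ltW.
have iQ : (i <= Q `^ r)%R.
  rewrite -[leLHS](powRr1 i0) -(mulVf (lt0r_neq0 r0)) powRrM.
  by apply: ge0_ler_powR; rewrite ?nnegrE ?powR_ge0 ?(ltW r0)// QE lerDl.
have jQ : (j `^ r <= Q `^ r)%R.
  by apply: ge0_ler_powR; rewrite ?nnegrE ?(ltW r0)// QE lerDr powR_ge0.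
have HB (t : nat -> R) (K : nat) : (forall k, 0 < t k)%R -> (forall k, t k.+1 < t k)%R ->
    (forall k, M (t k) = M (t 0%N) / 2 ^+ k)%R ->
    (\sum_(k < K) M (t k) `^ (- (r / theta)) * fine (N (ball (t k))) `^ r <= C * Q `^ r)%R.
  move=> tpos tdec Mt.
  have termE k : ((M (t k) `^ (- rhoe) * fine (N (ball (t k))) `^ r)%R)%:E =
      (M (t k) `^ (- rhoe))%:E * phi (t k).
    have Nf : N (ball (t k)) \is a fin_num.
      by rewrite ge0_fin_numE ?norm_on_ge0//; exact: (ball_fin Ii Jj).
    by rewrite /phi -[in RHS](fineK Nf) poweR_EFin EFinM.
  case: K => [|K]; first by rewrite big_ord0 mulr_ge0 ?powR_ge0.
  (* Term k + 1 is charged to the mass of ]t_(k+1), t_k]; the first has no interval above it and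
     goes to [ball_term_le]. *)
  rewrite big_ord_recl.
  have first_le : (M (t 0%N) `^ (- rhoe) * fine (N (ball (t 0%N))) `^ r <=
      kappa * i + 2 `^ rhoe * j `^ r)%R.
    by rewrite -lee_fin termE; exact: (ball_term_le Ii Jj).
  have rest_le : (\sum_(k < K) M (t k.+1) `^ (- rhoe) * fine (N (ball (t k.+1))) `^ r <=
      kappa * i)%R.
    rewrite -lee_fin -sumEFin EFinM -Ii.
    have := sum_le_stieltjes theta0 p0 ptheta homega phi0 phi_nd K tpos tdec.
    rewrite -/I => HI.
    have k0' : 0 <= kappa%:E by rewrite lee_fin ltW.
    apply: le_trans (lee_wpmul2l k0' HI).
    rewrite ge0_sume_distrr; last first.
      move=> k _; apply: mule_ge0; first exact: phi0.
      rewrite lee_fin subr_ge0; apply: powRN_le; [exact: Mpos| |exact: ltW].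
      by apply: (primitive_le mh h0 hfin); [exact: tpos|exact: ltW].
    apply: lee_sum => k _; rewrite termE [X in X%:E * _ <= _](@decay_step _ (t k)) //; last first.
      have half (m e : R) : (e != 0 -> m / e = 2 * (m / (2 * e)))%R by move=> e0; field.
      by rewrite (Mt k.+1) (Mt k) exprS; apply: half; rewrite expf_neq0.
    by rewrite EFinM -muleA [X in _ * X]muleC.
  apply: (@le_trans _ _ ((kappa * i + 2 `^ rhoe * j `^ r) + kappa * i)%R).
    by apply: lerD; [exact: first_le|exact: rest_le].
  apply: (@le_trans _ _ ((kappa * Q `^ r + 2 `^ rhoe * Q `^ r) + kappa * Q `^ r)%R).
    have ki : (kappa * i <= kappa * Q `^ r)%R by rewrite ler_wpM2l// ltW.
    apply: lerD => //; apply: lerD => //.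
    by rewrite ler_wpM2l ?powR_ge0.
  by rewrite /C le_eqVlt; apply/orP; left; apply/eqP; ring.
apply: le_trans (radial_upper_gt mrho rho0 rho_null p0 pP theta0 mu_u mh h0 hfin
  ptheta erefl mg gout (fun s => ball_fin Ii Jj) HB) _.
rewrite poweRM ?hardy_rhs_ge0// muleA poweR_EFin -EFinM.
rewrite lee_wpmul2r ?poweR_ge0// lee_fin.
have -> : (upper_const * Q = C `^ r^-1 * Q * 4 `^ theta^-1)%R.
  by rewrite /upper_const -/C mulrAC.
rewrite !powRM ?mulr_ge0 ?powR_ge0// -!powRrM.
rewrite [(theta^-1 * p)%R]mulrC [(r^-1 * p)%R]mulrC.
by have -> : (r * (p / r) = p)%R by rewrite mulrCA divff ?mulr1// gt_eqF.
Qed.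

Let sigma : R := (p^-1 - P^-1)%R.
(* The ratio M(t_k) / M(t_{k+1}); the exponent is the sum of those needed for
   growth_decay and growth_theta. *)
Let growth : R := (2 `^ ((1 + r * sigma) / rhoe + 1 + theta / P))%R.
Let sum_const : R :=
  (2 * (2 `^ (r * sigma) * (2 `^ r * (2 * 2 `^ (theta / P)) `^ (r / theta))) + 1)%R.
(** [sum_const] is the constant of [radial_lower_gt]; growth^rhoe is the price of an upper Stieltjes
    sum along the radii, and the final 1 belongs to the term at infinity. *)
Definition lower_const : R := ((growth `^ rhoe * sum_const) `^ r^-1 + 1)%R.

Let sigma0 : (0 <= sigma)%R.
Proof. by rewrite subr_ge0 lef_pV2 ?posrE// (lt_le_trans p0). Qed.

Let thetaP0 : (0 <= theta / P)%R.
Proof. by rewrite divr_ge0// ltW// (lt_le_trans p0). Qed.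

Let rs0 : (0 <= (1 + r * sigma) / rhoe)%R.
Proof.
apply: divr_ge0; last exact: ltW rhoe0.
by apply: addr_ge0 => //; apply: mulr_ge0; [exact: ltW r0|exact: sigma0].
Qed.

Let growth1 : (1 < growth)%R.
Proof.
have two1 : (1 < 2 :> R)%R by rewrite ltr1n.
apply: (lt_le_trans two1); rewrite -[leLHS]powRr1// ler_powR ?(ltW two1)//.
by move: rs0 thetaP0; lra.
Qed.

Let two_le (e : R) : (e <= -1)%R -> (2 `^ e <= 2^-1 :> R)%R.
Proof. by move=> e1; rewrite -powR_inv1// ler_powR// ler1n. Qed.

Let growth_theta : (2 `^ (theta / P) / growth <= 2^-1)%R.
Proof.
rewrite /growth -powRN -powRD; last by rewrite pnatr_eq0 implybT.
by apply: two_le; move: rs0; lra.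
Qed.

Let growth_decay : (2 `^ (r * (p^-1 - P^-1)) * growth `^ (- (r / theta)) <= 2^-1)%R.
Proof.
rewrite /growth -powRrM -powRD; last by rewrite pnatr_eq0 implybT.
apply: two_le; rewrite -/sigma -/rhoe.
have -> : (((1 + r * sigma) / rhoe + 1 + theta / P) * - rhoe =
    - (1 + r * sigma) - rhoe - theta / P * rhoe)%R.
  have aux (x y z : R) : (z != 0 -> (x / z + 1 + y) * - z = - x - z - y * z)%R.
    by move=> z0; field.
  by rewrite aux// gt_eqF.
have := mulr_ge0 thetaP0 (ltW rhoe0); have := ltW rhoe0; lra.
Qed.

(** The radii accumulate at 0 but start at a finite one, so the half-line is exhausted by intervals
    and each is covered by its own sequence; the bound is the same for all. *)
Let integral_le_admissible c : (0 <= c)%R -> hardy_admissible c ->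
  I <= (growth `^ rhoe * sum_const * c `^ r)%:E.
Proof.
move=> c0 Hc.
pose F k : set R := `](k.+1%:R^-1)%R, k.+2%:R]%classic.
have UF : `]0%R, +oo[%classic = \bigcup_k F k.
  apply/seteqP; split => x /=; rewrite ?in_itv/= ?andbT; last first.
    by move=> [k _]; rewrite /F/= in_itv/= => /andP[+ _]; apply: lt_trans; rewrite invr_gt0.
  move=> x0; pose k := maxn (Num.truncn x) (Num.truncn x^-1).
  exists k => //; rewrite /F/= in_itv/=; apply/andP; split.
    rewrite -[ltRHS]invrK ltf_pV2 ?posrE ?invr_gt0//.
    apply: lt_le_trans (truncnS_gt _) _.
    by rewrite ler_nat ltnS leq_maxr.
  apply: le_trans (ltW (truncnS_gt _)) _.
  by rewrite ler_nat ltnS ltnW// ltnS leq_maxl.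
have mF k : measurable (F k) by exact: measurable_itv.
have ndF : nondecreasing_seq F.
  move=> i j ij; apply/subsetPset => x; rewrite /F/= !in_itv/= => /andP[ix xi].
  rewrite (le_trans xi) ?ler_nat// andbT; apply: le_lt_trans ix.
  by rewrite lef_pV2 ?posrE// ler_nat.
have mphi : measurable_fun setT phi by exact: nondecreasing_measurable_ereal.
rewrite /I UF; apply: (cvge_to_le (ge0_nondecreasing_set_cvg_integral ndF mF _ _)).
- by move=> k; exact: measurable_funTS.
- by move=> k x _; exact: phi0.
apply: nearW => k; have T0 : (0 < k.+2%:R :> R)%R by [].
have e0 : (0 < k.+1%:R^-1 :> R)%R by rewrite invr_gt0.
have [t [t_0 tpos tdec Mt /(_ _ e0)[K tK]]] := primitive_geometric mh h0 hfin T0 growth1.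
apply: (@le_trans _ _ (\int[S]_(x in `](t K), (t 0%N)]) phi x)).
  apply: ge0_subset_integral; [exact: mF|exact: measurable_itv| | |].
  - exact: measurable_funTS.
  - by move=> x _; exact: phi0.
  - move=> x; rewrite /F t_0/= !in_itv/= => /andP[kx ->]; rewrite andbT.
    exact: lt_trans tK kx.
apply: le_trans (stieltjes_le_sum theta0 p0 ptheta homega phi0 phi_nd K tpos tdec) _.
have Mt0 k' : (M (t k') = M (t 0%N) / growth ^+ k')%R by rewrite t_0 Mt.
have sumle := radial_lower_gt mrho rho0 p0 pP theta0 mu_u mh h0 hfin c0 Hc K ptheta
  erefl growth1 growth_theta growth_decay tpos tdec Mt0.
rewrite -mulrA; apply: (@le_trans _ _ (growth `^ rhoe * \sum_(k < K) M (t k) `^ (- rhoe) * fine (N (ball (t k))) `^ r)%:E); last first.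
  by rewrite lee_fin ler_wpM2l ?powR_ge0.
rewrite mulr_sumr -sumEFin; apply: lee_sum => k' _.
have Nfin : N (ball (t k')) \is a fin_num.
  rewrite ge0_fin_numE ?norm_on_ge0//.
  exact: le_lt_trans (hardy_admissible_ball c0 Hc (tpos _)) (ltry _).
rewrite /phi -(fineK Nfin) poweR_EFin -EFinM lee_fin mulrC mulrA ler_wpM2r ?powR_ge0//.
(* In the upper sum phi(t_k) meets M^(-rhoe) at t_(k+1), one step further in; this costs exactly
   growth^rhoe, and the subtracted term is dropped. *)
apply: (@le_trans _ _ (M (t k'.+1) `^ (- rhoe))%R).
  by rewrite lerBlDr lerDl powR_ge0.
have -> : M (t k') = (M (t k'.+1) * growth)%R.
  by rewrite (Mt k'.+1) (Mt k') exprSr invfM mulrA divfK// gt_eqF// (lt_trans ltr01).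
rewrite powRM ?(ltW (Mpos _)) ?(ltW (lt_trans ltr01 growth1))//.
rewrite mulrCA -powRD; last by rewrite (gt_eqF (lt_trans ltr01 growth1)) implybT.
by rewrite subrr powRr0 mulr1.
Qed.

Lemma integral_condition_le_admissible c : (0 <= c)%R -> hardy_admissible c ->
  I `^ r^-1 + J <= (lower_const * c)%:E.
Proof.
move=> c0 Hc; rewrite /lower_const mulrDl mul1r EFinD; apply: leeD.
  have sum0 : (0 <= sum_const)%R.
    by rewrite addr_ge0// !mulr_ge0 ?powR_ge0.
  have -> : ((growth `^ rhoe * sum_const) `^ r^-1 * c)%R%:E =
      (growth `^ rhoe * sum_const * c `^ r)%:E `^ r^-1.
    have cr : ((c `^ r) `^ r^-1 = c)%R.
      by rewrite -powRrM mulfV ?gt_eqF// powRr1.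
    rewrite poweR_EFin; congr EFin.
    by rewrite [RHS]powRM ?cr// ?powR_ge0// mulr_ge0 ?powR_ge0.
  by apply: le_poweR; [rewrite invr_ge0 ltW|exact: I0|exact: integral_le_admissible].
(* An infinite total norm has inverse 0, so the term vanishes. Otherwise the total norm dominates
   every M(t)^(1/theta), and the single-ball estimates pass to the whole space. *)
rewrite /J; have [N1oo|N1oo] := eqVneq (N1 `]0%R, +oo[%classic) +oo.
  by rewrite N1oo invey mul0e lee_fin.
have N1fin : N1 `]0%R, +oo[%classic \is a fin_num.
  by rewrite ge0_fin_numE ?norm_on_ge0// ltey.
set m := fine (N1 `]0%R, +oo[%classic).
have mE : N1 `]0%R, +oo[%classic = m%:E by rewrite fineK.
have m0 : (0 < m)%R by rewrite -lte_fin -mE.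
rewrite mE inver gt_eqF//.
have NT : N setT <= (m * c)%:E.
  have -> : [set: X] = \bigcup_k ball k.+1%:R.
    apply/seteqP; split => // x _; exists (Num.truncn (rho x)) => //.
    by rewrite /rball/= truncnS_gt.
  apply: (norm_exp_to_bigcup p0 pP mu_u).
  - by move=> k; exact: measurable_rball.
  - by move=> a b ab; apply/subsetPset; apply: rball_subset; rewrite ler_nat.
  - by rewrite lee_fin mulr_ge0// ltW.
  move=> k; apply: le_trans (hardy_admissible_ball c0 Hc _) _ => //.
  rewrite lee_fin mulrC ler_wpM2r// -lee_fin -mE; exact: N1_le.
apply: (@le_trans _ _ ((m^-1)%:E * (m * c)%:E)).
  by rewrite lee_wpmul2l// lee_fin invr_ge0 ltW.
by rewrite -EFinM mulrA mulVf ?gt_eqF// mul1r.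
Qed.

End large_theta.
End characterization.

(** Infinite values need little care: without admissible constants the infimum is [+oo] and the
    lower bound is vacuous, while for infinite [Q] the upper bound is trivial. *)
Lemma equiv_upto_id_norm (R : realType) (T : Type) (X Y : qspace R T) (lam a b : R) (Q : \bar R) :
  (1 <= lam)%R -> (a <= lam)%R -> (b <= lam)%R -> 0 <= Q ->
  (Q \is a fin_num -> id_norm X Y <= (a * fine Q)%:E) ->
  (forall c, (0 <= c)%R -> (forall f, carrier X f -> qnorm Y f <= c%:E * qnorm X f) ->
    Q <= (b * c)%:E) ->
  equiv_upto lam (id_norm X Y) Q.
Proof.
move=> lam1 alam blam Q0 upper lower; have lam0 : (0 < lam)%R by exact: lt_le_trans lam1.
split.
  apply: le_ereal_inf_tmp => _ [c [c0 Hc] <-].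
  have Qc : Q <= (lam * c)%:E.
    by apply: le_trans (lower c c0 Hc) _; rewrite lee_fin ler_wpM2r.
  apply: (@le_trans _ _ ((lam^-1)%:E * (lam * c)%:E)).
    by rewrite lee_wpmul2l// lee_fin invr_ge0 ltW.
  by rewrite -EFinM mulrA mulVf ?gt_eqF// mul1r.
have [Qy|Qy] := eqVneq Q +oo; first by rewrite Qy gt0_muley ?leey// lte_fin.
have Qfin : Q \is a fin_num by rewrite ge0_fin_numE// ltey.
apply: le_trans (upper Qfin) _; rewrite EFinM (fineK Qfin).
by rewrite lee_wpmul2r// lee_fin.
Qed.

Unset Implicit Arguments.

Theorem theorem2p4 (R : realType) (n : nat) (p1 p2 theta1 theta2 : R)
    (hp1 : (0 < p1)%R) (hp2 : (0 < p2)%R)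
    (htheta1 : (0 < theta1)%R) (htheta2 : (0 < theta2)%R)
    (htheta2p2 : theta2 = p2) (hp21 : (p2 <= p1)%R) (hp1theta1 : p1 <> theta1) :
  exists lam : R, (1 <= lam)%R /\
  forall (v1 v2 : Rn R n -> \bar R) (omega1 omega2 : Rline R -> \bar R)
    (hv1 : weight lebesgue_Rn setT v1) (hv2 : weight lebesgue_Rn setT v2)
    (homega1 : cOmega theta1%:E omega1) (homega2 : Omega theta2%:E omega2),
  let normI := id_norm (cLM p1%:E theta1%:E omega1 v1)
                       (LM p2%:E theta2%:E omega2 v2) in
  let w := fun x : Rn R n => (v1 x)^-1 * v2 x in
  let N1 := fun A : set R => norm_on completed_lebesgue_measure theta1%:E A omega1 in
  let N2 := fun A : set (Rn R n) => wnorm_on lebesgue_Rn (exp_to p1%:E p2%:E) w A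
                       (omega_tail p2%:E omega2) in
  ((theta1 <= p2)%R ->
     equiv_upto lam normI
       (ereal_sup [set (N1 `]0%R, t[%classic)^-1 * N2 (eball t) | t in `]0%R, +oo[%classic]))
  /\
  ((p2 < theta1)%R ->
     let r := fine (exp_to theta1%:E p2%:E) in
     equiv_upto lam normI
       ((\int[stieltjes_measure (neg_pow_nd htheta1 hp2 homega1)]_(t in `]0%R, +oo[%classic)
           N2 (eball t) `^ r) `^ r^-1
        + (N1 `]0%R, +oo[%classic)^-1 * N2 setT)).

Proof.
have c4 : (1 <= 4 `^ theta1^-1 :> R)%R.
  by rewrite -[leLHS](powRr0 (4 : R)) ler_powR ?ler1n// invr_ge0 ltW.
(* Both constants depend on the exponents alone, so one [lam] for the two cases is fixed before the
   weights. *)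
pose a := upper_const p2 theta1; pose b := lower_const p1 p2 theta1.
pose lam := (4 `^ theta1^-1 + `|a| + `|b|)%R.
have lam1 : (1 <= lam)%R by rewrite /lam -addrA (le_trans c4)// lerDl addr_ge0.
have lam4 : (4 `^ theta1^-1 <= lam)%R by rewrite /lam -addrA lerDl addr_ge0.
have lama : (a <= lam)%R.
  by rewrite (le_trans (ler_norm a))// /lam addrAC lerDr addr_ge0// (le_trans _ c4).
have lamb : (b <= lam)%R.
  by rewrite (le_trans (ler_norm b))// /lam lerDr addr_ge0// (le_trans _ c4).
exists lam; split=> // v1 v2 omega1 omega2 hv1 hv2 homega1 homega2.
subst theta2.
have mu_u := measurable_density hp2 hv1 hv2 homega2.
have mrho := @measurable_eucl_norm R n.
have rho0 := @eucl_norm_ge0 R n.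
have null := @lebesgue_Rn_origin R n.
move=> normI w N1 N2; split=> [thetap|ptheta].
- apply: (@equiv_upto_id_norm _ _ _ _ lam (4 `^ theta1^-1)%R 1%R) => //.
  + exact: sup_condition_ge0.
  + move=> Qfin; apply: (id_norm_le hp1 hp2 htheta1 hv1 hv2 homega2).
      by rewrite mulr_ge0 ?powR_ge0 ?fine_ge0 ?sup_condition_ge0.
    exact: (hardy_upper_sup mrho rho0 null hp2 hp21 htheta1 mu_u homega1 thetap Qfin).
  + move=> c c0 Hc; rewrite mul1r.
    apply: (sup_le_admissible mrho hp2 hp21 htheta1 mu_u homega1 c0).
    exact: (id_norm_bound_hardy hp1 hp2 htheta1 hv1 hv2 homega2 c0 Hc).
- rewrite /= exp_to_lt//.
  apply: (@equiv_upto_id_norm _ _ _ _ lam a b) => //.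
  + exact: integral_condition_ge0.
  + move=> Qfin; apply: (id_norm_le hp1 hp2 htheta1 hv1 hv2 homega2).
      by rewrite mulr_ge0 ?upper_const_ge0 ?fine_ge0 ?integral_condition_ge0.
    exact: (hardy_upper_integral mrho rho0 null hp21 mu_u ptheta Qfin).
  + move=> c c0 Hc.
    apply: (integral_condition_le_admissible mrho rho0 hp2 hp21 htheta1 mu_u homega1 ptheta c0).
    exact: (id_norm_bound_hardy hp1 hp2 htheta1 hv1 hv2 homega2 c0 Hc).
Qed.
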